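(* Let $V$ be a complete holomorphic vector field on $\mathbb{C}^d$ with $V(0)=0$ which is globally asymptotically stable (with equilibrium point $0$), and let $X(\lambda,z)$, $\lambda\in\mathbb{C}$, $z\in\mathbb{C}^d$, denote its complex-time flow, $X_\lambda:=X(\lambda,\cdot)$. Let $D\subset\mathbb{C}^d$ be a domain containing the origin which is spirallike and circularlike with respect to $V$, i.e. $X_t(D)\subset D$ for all real $t\ge 0$ and $X_{is}(D)\subseteq D$ for all $s\in(-\pi/2,\pi/2)$. Then the following are equivalent: (1) $D$ is bounded; (2) $D$ is biholomorphic to a bounded domain; (3) $D$ is Kobayashi hyperbolic; (4) the core $\mathfrak{c}(D)$ of $D$ is empty; (5) $D$ is Carathéodory hyperbolic.
   Context: A holomorphic vector field on $\mathbb{C}^d$ is identified with a holomorphic map $\widetilde V=(v_1,\dots,v_d):\mathbb{C}^d\to\mathbb{C}^d$; its flow is given by solutions of the holomorphic ODE $\dot x(\lambda)=\widetilde V(x(\lambda))$, $x(0)=z_0$, with complex time $\lambda$. $V$ is complete if the solution exists for all $z_0\in\mathbb{C}^d$ and all real times (it then exists for all complex times $\lambda$, and $X_{\lambda+\mu}=X_\lambda\circ X_\mu$). The origin (with $V(0)=0$) is globally asymptotically stable if for every $\varepsilon>0$ there is $\delta>0$ with $X_t(B(0,\delta))\subset B(0,\varepsilon)$ for all real $t\ge0$, and $\lim_{t\to+\infty}X(t,z)=0$ for every $z\in\mathbb{C}^d$; a complete vector field with such an equilibrium is called globally asymptotically stable. A domain $D$ is Kobayashi (resp. Carathéodory) hyperbolic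 if its Kobayashi (resp. Carathéodory) pseudo-distance is a distance. The core of a domain $D$ is $\mathfrak{c}(D):=\{\zeta\in D:$ every continuous plurisubharmonic function on $D$ that is bounded from above fails to be strictly plurisubharmonic at $\zeta\}$. *)

(* Defs.v *)
(* C = R[i] (complex numbers over an arbitrary
   realType R), C^d = 'rV[R[i]]_d with its canonical normed R[i]-module
   structure (so "differentiable" = complex Fréchet differentiable
   = holomorphic). *)
From HB Require Import structures.
From mathcomp Require Import all_boot all_order all_algebra.
From mathcomp Require Import all_classical all_reals all_analysis.
From mathcomp Require Import complex.
Import Order.TTheory GRing.Theory Num.Theory.
Import numFieldNormedType.Exports.

Set Implicit Arguments.
Unset Strict Implicit.
Unset Printing Implicit Defensive.

Local Open Scope ring_scope.
Local Open Scope classical_set_scope.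
Local Open Scope complex_scope.

Definition Cx (R : realType) : normedModType R[i] := (R[i])^o.
Definition Cn (R : realType) (d : nat) : normedModType R[i] := 'rV[R[i]]_d.

Definition holo_on (R : realType) (V W : normedModType R[i])
  (f : V -> W) (U : set V) : Prop :=
  forall x, U x -> differentiable f x.

Definition is_domain (R : realType) (V : normedModType R[i]) (D : set V) :=
  [/\ open D, connected D & D !=set0].

Definition udisc (R : realType) : set (Cx R) := [set z | `|z| < 1].

Definition pseudo_hyp (R : realType) (a b : Cx R) : R :=
  complex.Re (`|a - b| / `|1 - a^* * b|).
Definition poincare (R : realType) (a b : Cx R) : R :=
  2^-1 * ln ((1 + pseudo_hyp a b) / (1 - pseudo_hyp a b)).

Definition kob_chain_lengths (R : realType) (d : nat) (D : set (Cn R d))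
  (z w : Cn R d) : set (\bar R) :=
  [set x | exists (n : nat) (p : nat -> Cn R d) (a b : nat -> Cx R)
                  (f : nat -> Cx R -> Cn R d),
     p 0%N = z /\ p n = w /\
        (forall j, (j < n)%N ->
           holo_on (f j) (@udisc R) /\ (forall l, udisc l -> D (f j l)) /\
           udisc (a j) /\ udisc (b j) /\ f j (a j) = p j /\
           f j (b j) = p j.+1) /\
      x = (\sum_(j < n) poincare (a j) (b j))%:E].

Definition kobayashi (R : realType) (d : nat) (D : set (Cn R d))
  (z w : Cn R d) : \bar R := ereal_inf (kob_chain_lengths D z w).

Definition caratheodory (R : realType) (d : nat) (D : set (Cn R d))
  (z w : Cn R d) : \bar R :=
  ereal_sup [set (poincare (f z) (f w))%:E |
             f in [set f : Cn R d -> Cx R |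
                     holo_on f D /\ (forall x, D x -> udisc (f x))]].

Definition kobayashi_hyperbolic (R : realType) (d : nat) (D : set (Cn R d)) :=
  forall z w, D z -> D w -> z != w -> (0 < kobayashi D z w)%E.
Definition caratheodory_hyperbolic (R : realType) (d : nat)
  (D : set (Cn R d)) :=
  forall z w, D z -> D w -> z != w -> (0 < caratheodory D z w)%E.

Definition biholo_to_bounded_domain (R : realType) (d : nat)
  (D : set (Cn R d)) :=
  exists (f g : Cn R d -> Cn R d) (G : set (Cn R d)),
    [/\ is_domain G, bounded_set G, holo_on f D, holo_on g G &
        [/\ f @` D = G, (forall z, D z -> g (f z) = z)
           & (forall y, G y -> f (g y) = y)]].

(* plurisubharmonic functions (continuous, real valued):
   sub-mean value property on every closed disc of every complex line *)
Definition subharmonic_on (R : realType) (v : Cx R -> R) (O : set (Cx R)) :=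
  forall (c : Cx R) (r : R), 0 < r ->
    (forall l : Cx R, `|l - c| <= r%:C -> O l) ->
    ((2 * pi * v c)%:E <=
      \int[@lebesgue_measure R]_(t in `[0%R, (2 * pi)%R])
         (v (c + r%:C * (cos t +i* sin t)))%:E)%E.

Definition psh_on (R : realType) (d : nat) (u : Cn R d -> R)
  (D : set (Cn R d)) :=
  forall a b : Cn R d,
    subharmonic_on (fun l : Cx R => u (a + l *: b)) [set l | D (a + l *: b)].

Definition eucl2 (R : realType) (d : nat) (z : Cn R d) : R :=
  \sum_(j < d) complex.Re (`|z ord0 j| ^+ 2).

Definition strictly_psh_at (R : realType) (d : nat) (D : set (Cn R d)) (u : Cn R d -> R)
  (zeta : Cn R d) :=
  exists (U : set (Cn R d)) (c : R),
    [/\ open U, U `<=` D, U zeta, 0 < c & psh_on (fun z => u z - c * eucl2 z) U].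

Definition core (R : realType) (d : nat) (D : set (Cn R d)) : set (Cn R d) :=
  [set zeta | D zeta /\
     forall u : Cn R d -> R,
       {within D, continuous u} -> (exists M, forall z, D z -> u z <= M) ->
       psh_on u D -> ~ strictly_psh_at D u zeta].

(* Main.v *)
(* If D is bounded, coordinate functions, Cauchy's estimate on discs and |z|^2 give
   (2)-(5).  If D is unbounded, pick z_n in D tending to infinity and follow
   the flow until it crosses a small sphere around 0, at w_n = X_{t_n} z_n; then t_n tends
   to infinity and w_n to some w in D, along a subsequence.  As D is invariant under X_l for
   Re l >= 0, the curve l |-> X_l w_n stays in D on the half-plane Re l >= -t_n.
   Hence in the limit a bounded holomorphic function satisfies f (X_s w) = f w
   (Liouville), the Kobayashi distance from w to X_s w is 0, and a bounded above
   plurisubharmonic function satisfies u (X_l w) <= u w (three circles), which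
   prevents strict plurisubharmonicity at w; while X_s w differs from w for large s.
   The mean value property comes from Goursat's theorem in logarithmic coordinates.
   Plurisubharmonicity being defined on complex lines only, its transfer to the
   orbits X_l w is obtained by doubling of variables. *)
Require Import Defs.
From HB Require Import structures.
From mathcomp Require Import all_boot all_order all_algebra.
From mathcomp Require Import all_classical all_reals all_analysis.
From mathcomp Require Import complex.
From mathcomp Require Import ring lra.
Import Order.TTheory GRing.Theory Num.Theory.
Import numFieldNormedType.Exports.
Local Open Scope ring_scope.
Local Open Scope classical_set_scope.
Local Open Scope complex_scope.

Set Implicit Arguments.
Unset Strict Implicit.
Unset Printing Implicit Defensive.

Local Notation normc := Normc.normc.

(** The backward orbit of the limit point [w] is not known to stay in [D]: as a limit of points of
    [D] it is only known to lie in the closure. Hence no Liouville theorem is applied to that orbit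
    itself. Each argument is quantitative and runs on the orbit of some [w'] near [w], over times
    reaching [- T], with an error that is small for large [T]; continuity of the flow, uniform on
    bounded sets of times, then brings the estimate back to [w]. A bound [u (X_l w) <= u w] does not
    by itself exclude a plurisubharmonic [u], since [u] may be constant. The contradiction comes
    from the term [c |z|^2] in strict plurisubharmonicity, whose restriction to the orbit is
    strictly subharmonic at [w] because [V w] is nonzero. Doubling of variables takes the place of
    the usual regularisation by convolution: it only uses continuity of [u] and its sub-mean values
    on complex lines. *)

(** The multiplied form also holds at [h = 0], which removes the punctured neighbourhood. The field
    [K] is general because both real and complex derivatives are read this way. *)
Lemma is_derive_epsP (K : numFieldType) (W : normedModType K) (f : K^o -> W)
    (x : K^o) (l : W) :
  is_derive x (1 : K^o) f l <->
  (forall e : K, 0 < e -> exists2 d : K, 0 < d & forall h : K, `|h| < d ->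
     `|f (x + h) - f x - h *: l| <= e * `|h|).
Proof.
split=> [[fd fl] e e0|H].
  have /cvgrPdist_le/(_ e e0) : (fun h : K => h^-1 *: ((f \o shift x) (h *: (1:K^o)) - f x)) @ 0^' --> l.
    by rewrite -fl; exact: fd.
  rewrite /prop_near1 /dnbhs /within /= => /nbhs_ballP[d /= d0 hd].
  exists d => // h hh.
  have [->|h0] := eqVneq h 0; first by rewrite addr0 subrr scale0r subr0 !normr0 mulr0.
  have := hd h; rewrite /ball /= sub0r normrN => /(_ hh h0).
  rewrite /shift /= -[h *: 1]/(h * 1) mulr1 [h + x]addrC => H.
  have -> : f (x + h) - f x - h *: l = - (h *: (l - h^-1 *: (f (x + h) - f x))).
    by rewrite scalerBr scalerA divff // scale1r opprB.
  by rewrite normrN normrZ mulrC ler_wpM2r.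
have cv : (fun h : K => h^-1 *: ((f \o shift x) (h *: (1:K^o)) - f x)) @ 0^' --> l.
  apply/cvgrPdist_le => e e0; have [d d0 hd] := H e e0.
  rewrite /prop_near1 /dnbhs /within /=; apply/nbhs_ballP; exists d => //= h.
  rewrite /ball /= sub0r normrN => hh h0.
  have := hd h hh; rewrite /shift /= -[h *: 1]/(h * 1) mulr1 [h + x]addrC => {}H.
  have h0' : 0 < `|h| by rewrite normr_gt0.
  rewrite -(ler_pM2r h0') mulrC -normrZ.
  have -> : h *: (l - h^-1 *: (f (x + h) - f x)) = - (f (x + h) - f x - h *: l).
    by rewrite [RHS]opprB scalerBr scalerA divff // scale1r.
  by rewrite normrN.
by split; [apply/cvg_ex; exists l|exact: cvg_lim cv].
Qed.

(** * Real-valued modulus and derivatives in epsilon form *)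

Section Modulus.
Variable R : realType.
Implicit Types (z w : R[i]).

Lemma normcE z : `|z| = (normc z)%:C.
Proof. by case: z. Qed.

Lemma normc_ge0 z : 0 <= normc z.
Proof. by case: z => a b; rewrite sqrtr_ge0. Qed.

Lemma normc_sqr z : normc z ^+ 2 = complex.Re z ^+ 2 + complex.Im z ^+ 2.
Proof. by case: z => a b /=; rewrite sqr_sqrtr // addr_ge0 // sqr_ge0. Qed.

Lemma normcD z w : normc (z + w) <= normc z + normc w.
Proof. exact: le_normcD. Qed.

Lemma normcB z w : normc (z - w) <= normc z + normc w.
Proof. by rewrite (le_trans (normcD _ _)) // normcN. Qed.

Lemma normc_distC z w : normc (z - w) = normc (w - z).
Proof. by rewrite -normcN opprB. Qed.

Lemma normcM z w : normc (z * w) = normc z * normc w.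
Proof. exact: Normc.normcM. Qed.

Lemma normc_real (x : R) : normc x%:C = `|x|.
Proof. by rewrite /= expr0n addr0 sqrtr_sqr. Qed.

Lemma normc_eq0 z : (normc z == 0) = (z == 0).
Proof.
by apply/eqP/eqP => [/(@Normc.eq0_normc _)//|->]; exact: Normc.normc0.
Qed.

Lemma normc_gt0 z : (0 < normc z) = (z != 0).
Proof. by rewrite lt_neqAle eq_sym normc_eq0 normc_ge0 andbT. Qed.

Lemma abs_Re_le z : `|complex.Re z| <= normc z.
Proof.
by rewrite -ler_sqr ?nnegrE ?normc_ge0// normc_sqr -normrX ger0_norm ?sqr_ge0// lerDl sqr_ge0.
Qed.

Lemma abs_Im_le z : `|complex.Im z| <= normc z.
Proof.
by rewrite -ler_sqr ?nnegrE ?normc_ge0// normc_sqr -normrX ger0_norm ?sqr_ge0// lerDr sqr_ge0.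
Qed.

Lemma normc_le_ReIm z : normc z <= `|complex.Re z| + `|complex.Im z|.
Proof.
have ? := normr_ge0 (complex.Re z); have ? := normr_ge0 (complex.Im z).
rewrite -ler_sqr ?nnegrE ?normc_ge0 ?addr_ge0// normc_sqr sqrrD -!normrX.
rewrite -addrA [_ *+ 2 + _]addrC addrA [X in _ <= X + _ + _]ger0_norm ?sqr_ge0//.
by rewrite [X in _ <= _ + X + _]ger0_norm ?sqr_ge0// lerDl mulrn_wge0// mulr_ge0.
Qed.

Lemma ReD z w : complex.Re (z + w) = complex.Re z + complex.Re w.
Proof. by case: z w => ? ? []. Qed.
Lemma ImD z w : complex.Im (z + w) = complex.Im z + complex.Im w.
Proof. by case: z w => ? ? []. Qed.
Lemma ReN z : complex.Re (- z) = - complex.Re z.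
Proof. by case: z. Qed.
Lemma ImN z : complex.Im (- z) = - complex.Im z.
Proof. by case: z. Qed.
Lemma ReM z w : complex.Re (z * w) =
  complex.Re z * complex.Re w - complex.Im z * complex.Im w.
Proof. by case: z w => ? ? []. Qed.
Lemma ImM z w : complex.Im (z * w) =
  complex.Re z * complex.Im w + complex.Im z * complex.Re w.
Proof. by case: z w => ? ? []. Qed.
Lemma ReZ (x : R) z : complex.Re (x%:C * z) = x * complex.Re z.
Proof. by rewrite ReM /= mul0r subr0. Qed.
Lemma ImZ (x : R) z : complex.Im (x%:C * z) = x * complex.Im z.
Proof. by rewrite ImM /= mul0r addr0. Qed.

Lemma eqC z w : complex.Re z = complex.Re w -> complex.Im z = complex.Im w -> z = w.
Proof. by case: z w => ? ? [? ?] /= -> ->. Qed.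

Lemma gt0_real (e : R[i]) : 0 < e -> exists2 x : R, 0 < x & e = x%:C.
Proof.
case: e => a b; rewrite ltcE /= => /andP[/eqP -> a0].
by exists a.
Qed.

(** The modulus [normc] is real, so that estimates take place in a totally ordered field. *)
Definition cderiv (f : R[i] -> R[i]) (z l : R[i]) : Prop :=
  forall e : R, 0 < e -> exists2 d : R, 0 < d & forall h : R[i], normc h < d ->
    normc (f (z + h) - f z - l * h) <= e * normc h.

Lemma cderivP (f : Cx R -> Cx R) (z l : Cx R) :
  is_derive z (1 : Cx R) f l <-> cderiv f z l.
Proof.
split=> [/(@is_derive_epsP R[i] (Cx R)) H e e0|H].
  have [|d d0 hd] := H e%:C; first by rewrite ltcR.
  have [x x0 dx] := gt0_real d0; exists x => // h hx.
  have := hd h; rewrite normcE dx ltcR => /(_ hx).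
  by rewrite -[h *: l]/(h * l) -[`|f _ - _ - _|]/(`| (f (z + h) - f z - h * l : R[i])|) normcE -rmorphM lecR mulrC.
apply/(@is_derive_epsP R[i] (Cx R)) => e /gt0_real[x x0 ->].
have [d d0 hd] := H x x0; exists d%:C; first by rewrite ltcR.
move=> h; rewrite normcE ltcR => /hd.
by rewrite -[h *: l]/(h * l) -[`|f _ - _ - _|]/(`| (f (z + h) - f z - h * l : R[i])|) normcE -rmorphM lecR mulrC.
Qed.

Lemma rderivP (f : R -> R) (x l : R) : is_derive x 1 f l <->
  (forall e : R, 0 < e -> exists2 d : R, 0 < d & forall h : R, `|h| < d ->
     `|f (x + h) - f x - l * h| <= e * `|h|).
Proof.
split=> [/(@is_derive_epsP R R^o) H e e0|H].
  have [d d0 hd] := H e e0; exists d => // h /hd.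
  by rewrite -[h *: l]/(h * l) mulrC.
apply/(@is_derive_epsP R R^o) => e e0; have [d d0 hd] := H e e0.
by exists d => // h /hd; rewrite -[h *: l]/(h * l) mulrC.
Qed.

End Modulus.

(** * Calculus of complex derivatives, mean value bounds, primitives *)

Section ComplexDerivative.
Variable R : realType.
Implicit Types (f g : R[i] -> R[i]) (z l m : R[i]).

Lemma cderiv_cst (c z : R[i]) : cderiv (fun _ => c) z 0.
Proof.
move=> e e0; exists 1 => // h _.
by rewrite subrr mul0r subr0 Normc.normc0 mulr_ge0 ?normc_ge0 // ltW.
Qed.

Lemma cderiv_id z : cderiv id z 1.
Proof.
move=> e e0; exists 1 => // h _.
by rewrite /= mul1r [z + h]addrC addrK subrr Normc.normc0 mulr_ge0 ?normc_ge0 // ltW.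
Qed.

Lemma cderivD f g z l m : cderiv f z l -> cderiv g z m ->
  cderiv (fun w => f w + g w) z (l + m).
Proof.
move=> /(@cderivP R f) fl /(@cderivP R g) gm.
apply/(@cderivP R (fun w => f w + g w)).
Qed.

Lemma cderivB f g z l m : cderiv f z l -> cderiv g z m ->
  cderiv (fun w => f w - g w) z (l - m).
Proof.
move=> /(@cderivP R f) fl /(@cderivP R g) gm.
apply/(@cderivP R (fun w => f w - g w)).
Qed.

Lemma cderivM f g z l m : cderiv f z l -> cderiv g z m ->
  cderiv (fun w => f w * g w) z (f z * m + g z * l).
Proof.
move=> /(@cderivP R f) fl /(@cderivP R g) gm.
apply/(@cderivP R (fun w => f w * g w)).
Qed.

Lemma cderiv_eq f z l m : cderiv f z l -> l = m -> cderiv f z m.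
Proof. by move=> ? <-. Qed.

Lemma cderiv_ext f g z l : (forall w, f w = g w) -> cderiv f z l -> cderiv g z l.
Proof. by move=> /funext ->. Qed.

Lemma cderiv_comp f g z l m : cderiv f (g z) l -> cderiv g z m ->
  cderiv (fun w => f (g w)) z (l * m).
Proof.
move=> fl gm e e0.
have l0 : 0 < normc l + 1 by rewrite ltr_wpDl ?normc_ge0.
have m0 : 0 < normc m + 1 by rewrite ltr_wpDl ?normc_ge0.
have [|d d0 hf] := fl (e / 2 / (normc m + 1)); first by rewrite !divr_gt0.
have [|d1 d10 hg1] := gm 1; first by [].
have [|d2 d20 hg2] := gm (e / 2 / (normc l + 1)); first by rewrite !divr_gt0.
exists (Num.min (d / (normc m + 1)) (Num.min d1 d2)).
  by rewrite !lt_min divr_gt0 ?d10 ?d20.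
move=> h; rewrite !lt_min => /and3P[hd h1 h2].
pose k := g (z + h) - g z.
have kh : normc k <= (normc m + 1) * normc h.
  have -> : k = (k - m * h) + m * h by rewrite subrK.
  rewrite (le_trans (normcD _ _))// mulrDl addrC normcM lerD2l mul1r.
  by have := hg1 h h1; rewrite mul1r.
have kd : normc k < d.
  by rewrite (le_lt_trans kh)// mulrC -ltr_pdivlMr.
have := hf k kd; rewrite /k [g z + _]addrC subrK -/k => H1.
have := hg2 h h2; rewrite -/k => H2.
have -> : f (g (z + h)) - f (g z) - l * m * h =
  (f (g (z + h)) - f (g z) - l * k) + l * (k - m * h) by ring.
rewrite (le_trans (normcD _ _))// [e]splitr mulrDl lerD//.
  rewrite (le_trans H1)//.
  apply: (le_trans (ler_wpM2l _ kh)); first by rewrite !divr_ge0 // ltW.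
  by rewrite mulrA divfK ?gt_eqF.
rewrite normcM (le_trans (ler_wpM2l (normc_ge0 _) H2))//.
rewrite mulrA ler_wpM2r ?normc_ge0// mulrA ler_pdivrMr// mulrC ler_wpM2l ?lerDl//.
by rewrite divr_ge0 // ltW.
Qed.

Lemma cderiv_continuous f z l : cderiv f z l ->
  forall e : R, 0 < e -> exists2 d : R, 0 < d & forall w, normc (w - z) < d ->
    normc (f w - f z) < e.
Proof.
move=> fl e e0.
have l0 : 0 < normc l + 1 by rewrite ltr_wpDl ?normc_ge0.
have [d d0 hd] := fl 1 ltr01.
exists (Num.min d (e / (normc l + 1))); first by rewrite lt_min d0 divr_gt0.
move=> w; rewrite lt_min => /andP[wd we].
have := hd _ wd; rewrite [z + _]addrC subrK mul1r => H.
have -> : f w - f z = (f w - f z - l * (w - z)) + l * (w - z) by rewrite subrK.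
rewrite (le_lt_trans (normcD _ _))// normcM (le_lt_trans (lerD H (lexx _)))//.
by rewrite -[X in X + _]mul1r -mulrDl [1 + _]addrC mulrC -ltr_pdivlMr.
Qed.

Lemma cderiv_shift f (a : R[i]) z l : cderiv f (a + z) l ->
  cderiv (fun w => f (a + w)) z l.
Proof.
move=> fl; have := @cderiv_comp f (fun w => a + w) z l 1 fl.
rewrite mulr1; apply; rewrite -[1]add0r.
by apply: cderivD; [exact: cderiv_cst|exact: cderiv_id].
Qed.

Lemma cderivZ f (c : R[i]) z l : cderiv f z l -> cderiv (fun w => c * f w) z (c * l).
Proof.
move=> fl; apply: cderiv_eq (cderivM (cderiv_cst c z) fl) _.
by rewrite mulr0 addr0.
Qed.

(** Split into components so that the mean value theorem and the fundamental theorem of calculus for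
    real functions apply. *)
Definition rcderiv (W : R -> R[i]) (t : R) (l : R[i]) : Prop :=
  is_derive t 1 (fun s => complex.Re (W s)) (complex.Re l) /\
  is_derive t 1 (fun s => complex.Im (W s)) (complex.Im l).

Lemma rcderiv_line f (a b : R[i]) (t : R) l : cderiv f (a + t%:C * b) l ->
  rcderiv (fun s => f (a + s%:C * b)) t (l * b).
Proof.
move=> fl.
have key : forall e : R, 0 < e -> exists2 d : R, 0 < d & forall h : R, `|h| < d ->
    normc (f (a + (t + h)%:C * b) - f (a + t%:C * b) - (l * b) * h%:C) <= e * `|h|.
  move=> e e0; have b0 : 0 < normc b + 1 by rewrite ltr_wpDl ?normc_ge0.
  have [|d d0 hd] := fl (e / (normc b + 1)); first by rewrite divr_gt0.
  exists (d / (normc b + 1)); first by rewrite divr_gt0.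
  move=> h hh.
  have hb : normc (h%:C * b) <= `|h| * (normc b + 1).
    by rewrite normcM normc_real ler_wpM2l// lerDl.
  have := hd (h%:C * b); rewrite (le_lt_trans hb) -?ltr_pdivlMr// => /(_ isT).
  have -> : a + t%:C * b + h%:C * b = a + (t + h)%:C * b by rewrite rmorphD mulrDl addrA.
  have -> : l * b * h%:C = l * (h%:C * b) by ring.
  move=> /le_trans; apply.
  apply: (le_trans (ler_wpM2l _ hb)); first by rewrite divr_ge0 // ltW.
  by rewrite mulrCA mulrC divfK ?gt_eqF// mulrC.
split; apply/rderivP => e /key[d d0 hd]; exists d => // h /hd; apply: le_trans.
- apply: le_trans (abs_Re_le _).
  by rewrite !ReD !ReN [_ * h%:C]mulrC ReZ [h * _]mulrC.
- apply: le_trans (abs_Im_le _).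
  by rewrite !ImD !ImN [_ * h%:C]mulrC ImZ [h * _]mulrC.
Qed.

Lemma rcderivB (W Z : R -> R[i]) t l m : rcderiv W t l -> rcderiv Z t m ->
  rcderiv (fun s => W s - Z s) t (l - m).
Proof.
move=> [Wr Wi] [Zr Zi]; split.
  rewrite ReD ReN (_ : (fun s => _) = (fun s => complex.Re (W s)) - (fun s => complex.Re (Z s))).
    exact: is_deriveB.
  by apply/funext => s; rewrite ReD ReN.
rewrite ImD ImN (_ : (fun s => _) = (fun s => complex.Im (W s)) - (fun s => complex.Im (Z s))).
  exact: is_deriveB.
by apply/funext => s; rewrite ImD ImN.
Qed.

Lemma mvt_closed (f df : R -> R) (a b : R) : a <= b ->
  (forall t, a <= t <= b -> is_derive t 1 f (df t)) ->
  exists2 c, a <= c <= b & f b - f a = df c * (b - a).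
Proof.
move=> ab fd; have [t||c] := @MVT_segment R f df a b ab.
- by rewrite in_itv /= => /andP[? ?]; apply: fd; rewrite !ltW.
- apply: derivable_within_continuous => t; rewrite in_itv /= => /fd[].
  by [].
- by rewrite in_itv /= => ? ?; exists c.
Qed.

(** The mean value points of the real and imaginary parts differ, hence the factor 2. *)
Lemma rcderiv_bound (W w : R -> R[i]) (a b M : R) : a <= b ->
  (forall t, a <= t <= b -> rcderiv W t (w t)) ->
  (forall t, a <= t <= b -> normc (w t) <= M) ->
  normc (W b - W a) <= 2 * M * (b - a).
Proof.
move=> ab Wd wM.
have [c1 c1ab e1] := mvt_closed ab (fun t ht => (Wd t ht).1).
have [c2 c2ab e2] := mvt_closed ab (fun t ht => (Wd t ht).2).
rewrite (le_trans (normc_le_ReIm _))// ReD ReN ImD ImN e1 e2 !normrM.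
rewrite -mulrDl [`|b - a|]ger0_norm ?subr_ge0// ler_wpM2r ?subr_ge0//.
rewrite mulrDl mul1r lerD//.
  exact: le_trans (abs_Re_le _) (wM _ c1ab).
exact: le_trans (abs_Im_le _) (wM _ c2ab).
Qed.

Lemma cderiv_bound f (df : R[i] -> R[i]) (a b : R[i]) (M : R) :
  (forall t : R, 0 <= t <= 1 -> cderiv f (a + t%:C * (b - a)) (df (a + t%:C * (b - a)))) ->
  (forall t : R, 0 <= t <= 1 -> normc (df (a + t%:C * (b - a))) <= M) ->
  normc (f b - f a) <= 2 * M * normc (b - a).
Proof.
move=> fd dM.
have := @rcderiv_bound (fun t => f (a + t%:C * (b - a)))
  (fun t => df (a + t%:C * (b - a)) * (b - a)) 0 1 (M * normc (b - a)) ler01.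
rewrite mul1r mul0r addr0 [a + _]addrC subrK subr0 mulr1 mulrA; apply.
- by move=> t /fd; exact: rcderiv_line.
- by move=> t /dM; rewrite normcM => /ler_wpM2r; apply; exact: normc_ge0.
Qed.

Lemma derivable_continuous_pt (f : R -> R) (t l : R) :
  is_derive t 1 f l -> {for t, continuous f}.
Proof. by move=> [fd _]; apply: differentiable_continuous; apply/derivable1_diffP. Qed.

Lemma primitive_exists (f : R -> R) (a b : R) : a <= b ->
  (forall t, a <= t <= b -> {for t, continuous f}) ->
  exists F : R -> R, forall t, a <= t <= b -> is_derive t 1 F (f t).
Proof.
move=> ab fc.
(* Clamping to [[a, b]] makes the integrand continuous on the whole line. *)
pose cl (t : R) := Num.max a (Num.min b t).
have clc : continuous cl.
  move=> t; apply: (@continuous_max _ _ (fun=> a) (fun t => Num.min b t)).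
    exact: cvg_cst.
  by apply: (@continuous_min _ _ (fun=> b) id); [exact: cvg_cst|exact: cvg_id].
have cl_in t : a <= cl t <= b.
  by rewrite /cl le_max lexx /= ge_max ab ge_min lexx.
have gc : continuous (f \o cl).
  by move=> t; apply: continuous_comp; [exact: clc|exact: fc (cl_in t)].
(* Starting at [a - 1] makes every [t] of [[a, b]] an interior point, so the derivative is two-sided
   at the end points as well. *)
exists (fun x => \int[lebesgue_measure]_(t in `[a - 1, x]) (f (cl t))) => t /andP[at' tb].
have [||||dF F'] := @continuous_FTC1_closed R (f \o cl) (a - 1) t (t + 1).
- by rewrite ltrDl.
- apply: continuous_compact_integrable; first exact: segment_compact.
  exact: continuous_subspaceT.
- by rewrite (lt_le_trans _ at')// ltrBlDr ltrDl.
- exact: gc.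
split => //; rewrite -derive1E F' /= /cl.
by rewrite min_r// max_r.
Qed.

End ComplexDerivative.

(** * The complex exponential *)

Section ComplexExponential.
Variable R : realType.
Implicit Types (z w : R[i]) (t x y : R).

Definition cis t : R[i] := cos t +i* sin t.
Definition cexp z : R[i] := (expR (complex.Re z))%:C * cis (complex.Im z).

Lemma normc_cis t : normc (cis t) = 1.
Proof. by rewrite /= cos2Dsin2 sqrtr1. Qed.

Lemma normc_cexp z : normc (cexp z) = expR (complex.Re z).
Proof. by rewrite normcM normc_cis mulr1 normc_real ger0_norm ?expR_ge0. Qed.

Lemma cexp_line x y : cexp (x%:C + y%:C * 'i) = (expR x)%:C * cis y.
Proof. by rewrite /cexp ReD ImD ReZ ImZ /= mulr0 mulr1 addr0 add0r. Qed.

Lemma cisD x y : cis (x + y) = cis x * cis y.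
Proof.
by apply: eqC; rewrite /= ?cosD ?sinD//; ring.
Qed.

Lemma cexpD z w : cexp (z + w) = cexp z * cexp w.
Proof. by rewrite /cexp ReD ImD cisD expRD rmorphM /=; ring. Qed.

Lemma cexp0 : cexp 0 = 1.
Proof. by rewrite /cexp /= expR0 /cis cos0 sin0 mul1r. Qed.

Lemma cexp_per z : cexp (z + (2 * pi)%:C * 'i) = cexp z.
Proof.
rewrite /cexp ReD ImD ReZ ImZ /= mulr0 mulr1 addr0 /cis.
by rewrite [2 * pi]mulr_natl cosD2pi sinD2pi.
Qed.

Lemma cexp_neq0 z : cexp z != 0.
Proof. by rewrite -normc_gt0 normc_cexp expR_gt0. Qed.

Lemma cexpN z : cexp (- z) = (cexp z)^-1.
Proof.
by apply: (mulfI (cexp_neq0 z)); rewrite -cexpD subrr cexp0 divff ?cexp_neq0.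
Qed.

Lemma cderiv_cexp0 : cderiv cexp 0 1.
Proof.
(* The error is split below into terms of total weight [1 + 2 + 1 + 2 + 1 = 7]. *)
move=> e e0; pose n := e / 7; have n0 : 0 < n by rewrite divr_gt0.
have /rderivP/(_ n n0)[d1 d10 h1] := is_derive_expR (0 : R).
have /rderivP/(_ n n0)[d2 d20 h2] := is_derive_cos (0 : R).
have /rderivP/(_ n n0)[d3 d30 h3] := is_derive_sin (0 : R).
exists (Num.min (Num.min n 1) (Num.min d1 (Num.min d2 d3))).
  by rewrite !lt_min n0 ltr01 d10 d20.
move=> h hh; have xN := abs_Re_le h; have yN := abs_Im_le h.
have hx := le_lt_trans xN hh; have hy := le_lt_trans yN hh.
rewrite add0r cexp0 mul1r; set M := normc h in xN yN *.
have M0 : 0 <= M := normc_ge0 _.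
apply: (le_trans (normc_le_ReIm _)).
rewrite !ReD !ImD !ReN !ImN ReZ ImZ /= !subr0.
set x := complex.Re h in xN hx *; set y := complex.Im h in yN hy *.
move: hx hy; rewrite !lt_min => /andP[/andP[xn x1] /andP[/h1 X _]].
move=> /andP[_ /and3P[_ /h2 C /h3 S]].
move: X C S; rewrite !add0r expR0 cos0 sin0 !(oppr0, mul0r, addr0, mul1r) => X C S.
have -> : expR x * cos y - 1 - x = (expR x - 1 - x) * cos y + (1 + x) * (cos y - 1) by ring.
have -> : expR x * sin y - y = (expR x - 1 - x) * sin y + (1 + x) * (sin y - y) + x * y by ring.
have c1 : `|cos y| <= 1 by rewrite ler_norml cos_geN1 cos_le1.
have s1 : `|sin y| <= 1 by rewrite ler_norml sin_geN1 sin_le1.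
have x2 : `|1 + x| <= 2.
  by rewrite (le_trans (ler_normD _ _))// normr1 -lerBrDl (le_trans (ltW x1))// lerBrDl.
have A1 : `|(expR x - 1 - x) * cos y| <= n * M.
  rewrite normrM -[n * M]mulr1 ler_pM// (le_trans X)// ler_pM2l//.
have A2 : `|(1 + x) * (cos y - 1)| <= 2 * (n * M).
  by rewrite normrM ler_pM// (le_trans C)// ler_pM2l.
have A3 : `|(expR x - 1 - x) * sin y| <= n * M.
  rewrite normrM -[n * M]mulr1 ler_pM// (le_trans X)// ler_pM2l//.
have A4 : `|(1 + x) * (sin y - y)| <= 2 * (n * M).
  by rewrite normrM ler_pM// (le_trans S)// ler_pM2l.
have A5 : `|x * y| <= n * M by rewrite normrM ler_pM// ltW.
have -> : e * M = (n * M + 2 * (n * M)) + ((n * M + 2 * (n * M)) + n * M).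
  by rewrite /n; field.
apply: lerD; first exact: le_trans (ler_normD _ _) (lerD A1 A2).
apply: le_trans (ler_normD _ _) (lerD _ A5).
exact: le_trans (ler_normD _ _) (lerD A3 A4).
Qed.

Lemma cderiv_cexp z : cderiv cexp z (cexp z).
Proof.
have H : cderiv (fun w => cexp z * cexp (- z + w)) z (cexp z * 1).
  apply: cderivZ; apply: cderiv_shift.
  by rewrite addNr; exact: cderiv_cexp0.
rewrite -[X in cderiv _ _ X]mulr1.
by apply: cderiv_ext H => w; rewrite -cexpD addrA subrr add0r.
Qed.

End ComplexExponential.

(** * Goursat's theorem *)

Lemma nested_intervals (R : realType) (u v : nat -> R) :
  (forall n, u n <= u n.+1) -> (forall n, v n.+1 <= v n) -> (forall n, u n <= v n) ->
  exists x, forall n, u n <= x <= v n.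
Proof.
move=> u1 v1 uv.
have um n m : (n <= m)%N -> u n <= u m.
  move=> /subnKC <-; elim: (m - n)%N => [|i IH]; first by rewrite addn0.
  by rewrite addnS (le_trans IH).
have vm n m : (n <= m)%N -> v m <= v n.
  move=> /subnKC <-; elim: (m - n)%N => [|i IH]; first by rewrite addn0.
  by rewrite addnS (le_trans _ IH).
have uvm n m : u n <= v m.
  by rewrite (le_trans (um _ (maxn n m) (leq_maxl _ _)))// (le_trans (uv _))// vm// leq_maxr.
exists (sup (range u)) => n; apply/andP; split.
  apply: ub_le_sup; last by exists n.
  by exists (v 0%N) => _ [m _ <-].
by apply: ge_sup; [exists (u 0%N); exists 0%N|move=> _ [m _ <-]].
Qed.

Lemma pow2_small (R : realType) (x d : R) : 0 <= x -> 0 < d -> exists n, x / 2 ^+ n < d.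
Proof.
move=> x0 d0; exists (Num.bound (x / d)).
rewrite ltr_pdivrMr ?exprn_gt0// mulrC -ltr_pdivrMr//.
apply: lt_trans (archi_boundP _) _; first by rewrite divr_ge0// ltW.
by rewrite -natrX ltr_nat ltn_expl.
Qed.

Section Goursat.
Variables (R : realType) (f : R[i] -> R[i]).

Local Notation pt x y := ((x%:C + y%:C * 'i) : R[i]).

(* [H y] and [K x] are primitives of [f dz] along the horizontal line of
   ordinate [y] and the vertical line of abscissa [x]; the contour integral over
   the boundary of a rectangle is then a combination of their values. *)
Definition contour (H K : R -> R -> R[i]) x1 x2 y1 y2 :=
  (H y1 x2 - H y1 x1) - (H y2 x2 - H y2 x1)
  + ((K x2 y2 - K x2 y1) - (K x1 y2 - K x1 y1)).

(** The difference of the two primitives has derivative [(f - q) e] along the line, so the mean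
    value bound applies to it. *)
Lemma line_integral_approx (W : R -> R[i]) (a e : R[i]) (p1 p2 M : R)
    (Q q : R[i] -> R[i]) : normc e = 1 -> p1 <= p2 ->
  (forall t, p1 <= t <= p2 -> rcderiv W t (f (a + t%:C * e) * e)) ->
  (forall z, cderiv Q z (q z)) ->
  (forall t, p1 <= t <= p2 -> normc (f (a + t%:C * e) - q (a + t%:C * e)) <= M) ->
  normc ((W p2 - W p1) - (Q (a + p2%:C * e) - Q (a + p1%:C * e))) <= 2 * M * (p2 - p1).
Proof.
move=> e1 p12 Wd Qd fq.
have -> : (W p2 - W p1) - (Q (a + p2%:C * e) - Q (a + p1%:C * e)) =
  (W p2 - Q (a + p2%:C * e)) - (W p1 - Q (a + p1%:C * e)) by ring.
apply: (@rcderiv_bound R (fun t => W t - Q (a + t%:C * e))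
  (fun t => f (a + t%:C * e) * e - q (a + t%:C * e) * e)) => //.
  by move=> t /Wd ?; apply: rcderivB => //; apply: rcderiv_line.
by move=> t /fq; rewrite -mulrBl normcM e1 mulr1.
Qed.

(** The affine function has the primitive [Q], so its integral around the rectangle telescopes to 0.
    Only the deviation of [f] counts, for [2 M] times the length of each of the four sides. *)
Lemma contour_affine_approx (H K : R -> R -> R[i]) (x1 x2 y1 y2 M : R) (s t p : R[i]) :
  x1 <= x2 -> y1 <= y2 ->
  (forall x y, x1 <= x <= x2 -> y1 <= y <= y2 ->
     [/\ rcderiv (H y) x (f (pt x y)), rcderiv (K x) y (f (pt x y) * 'i)
       & normc (f (pt x y) - (s + t * (pt x y - p))) <= M]) ->
  normc (contour H K x1 x2 y1 y2) <= 4 * M * ((x2 - x1) + (y2 - y1)).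
Proof.
move=> x12 y12 HK.
pose Q z := s * z + t * (2^-1 * ((z - p) * (z - p))).
pose q z := s + t * (z - p).
have Qd z : cderiv Q z (q z).
  have d1 : cderiv (fun w => w - p) z (1 - 0).
    by apply: cderivB; [exact: cderiv_id|exact: cderiv_cst].
  apply: cderiv_eq (cderivD (cderivZ s (cderiv_id z)) (cderivZ t (cderivZ 2^-1 (cderivM d1 d1)))) _.
  by rewrite /q; field.
have y1in : y1 <= y1 <= y2 by rewrite lexx.
have y2in : y1 <= y2 <= y2 by rewrite lexx andbT.
have x1in : x1 <= x1 <= x2 by rewrite lexx.
have x2in : x1 <= x2 <= x2 by rewrite lexx andbT.
have nI : normc ('i : R[i]) = 1 by rewrite /= expr0n expr1n add0r sqrtr1.
have n1 : normc (1 : R[i]) = 1 by rewrite Normc.normc1.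
have hor y : y1 <= y <= y2 ->
    normc ((H y x2 - H y x1) - (Q (pt x2 y) - Q (pt x1 y))) <= 2 * M * (x2 - x1).
  move=> yin; have ptE x : pt x y = y%:C * 'i + x%:C * 1 by rewrite mulr1 addrC.
  rewrite !ptE; apply: (@line_integral_approx _ _ 1 _ _ _ _ q) => //.
    by move=> x xin; rewrite mulr1 -ptE; have [] := HK x y xin yin.
  by move=> x xin; rewrite -ptE; have [] := HK x y xin yin.
have ver x : x1 <= x <= x2 ->
    normc ((K x y2 - K x y1) - (Q (pt x y2) - Q (pt x y1))) <= 2 * M * (y2 - y1).
  move=> xin; apply: (@line_integral_approx _ _ 'i _ _ _ _ q) => //.
    by move=> y yin; have [] := HK x y xin yin.
  by move=> y yin; have [] := HK x y xin yin.
have -> : contour H K x1 x2 y1 y2 =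
  (((H y1 x2 - H y1 x1) - (Q (pt x2 y1) - Q (pt x1 y1)))
   - ((H y2 x2 - H y2 x1) - (Q (pt x2 y2) - Q (pt x1 y2))))
  + (((K x2 y2 - K x2 y1) - (Q (pt x2 y2) - Q (pt x2 y1)))
   - ((K x1 y2 - K x1 y1) - (Q (pt x1 y2) - Q (pt x1 y1)))).
  by rewrite /contour; ring.
apply: le_trans (normcD _ _) _.
have -> : 4 * M * (x2 - x1 + (y2 - y1)) =
  (2 * M * (x2 - x1) + 2 * M * (x2 - x1)) + (2 * M * (y2 - y1) + 2 * M * (y2 - y1)) by ring.
by apply: lerD; apply: le_trans (normcB _ _) _; apply: lerD; [exact: hor|exact: hor|exact: ver|exact: ver].
Qed.

(* Bisection: if the integral did not vanish, some nested sequence of quarters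
   would keep an integral of the order of their area, contradicting complex
   differentiability at their common point. *)
Lemma goursat (H K : R -> R -> R[i]) (a c h k : R) : 0 < h -> 0 < k ->
  (forall x y, a <= x <= a + h -> c <= y <= c + k ->
     [/\ rcderiv (H y) x (f (pt x y)), rcderiv (K x) y (f (pt x y) * 'i)
       & exists l, cderiv f (pt x y) l]) ->
  contour H K a (a + h) c (c + k) = 0.
Proof.
move=> h0 k0 HK; apply/eqP; apply: contraT; rewrite -normc_gt0 => N0.
set N := normc _ in N0.
pose hn n : R := h / 2 ^+ n; pose kn n : R := k / 2 ^+ n.
have hS n : hn n = hn n.+1 + hn n.+1.
  by rewrite /hn exprS; field; rewrite expf_neq0.
have kS n : kn n = kn n.+1 + kn n.+1.
  by rewrite /kn exprS; field; rewrite expf_neq0.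
have hn0 n : 0 < hn n by rewrite divr_gt0// exprn_gt0.
have kn0 n : 0 < kn n by rewrite divr_gt0// exprn_gt0.
pose big n (p : R * R) := N / 4 ^+ n <=
  normc (contour H K p.1 (p.1 + hn n) p.2 (p.2 + kn n)).
pose sub n (p p' : R * R) := [/\ p.1 <= p'.1, p'.1 + hn n.+1 <= p.1 + hn n,
   p.2 <= p'.2 & p'.2 + kn n.+1 <= p.2 + kn n].
(* The implication sits under the existential so that [choice] yields a total function; [(0, 0)] is
   its value where [big] fails. *)
have step (np : nat * (R * R)) : exists p', big np.1 np.2 -> big np.1.+1 p' /\ sub np.1 np.2 p'.
  case: np => n [x y] /=.
  pose P p' := big n.+1 p' /\ sub n (x, y) p'.
  suff : big n (x, y) -> exists p', P p'.
    have [/asboolP|nb] := pselect (big n (x, y)); last by exists (0, 0) => /nb.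
    by move=> /asboolP b /(_ b)[p' ?]; exists p'.
  (* If every quarter had less than a fourth of the bound, their sum would be less than the integral
     over the whole. *)
  move=> b; apply: contrapT => /forallNP nP.
  have small x' y' : (x' = x \/ x' = x + hn n.+1) -> (y' = y \/ y' = y + kn n.+1) ->
      normc (contour H K x' (x' + hn n.+1) y' (y' + kn n.+1)) < N / 4 ^+ n.+1.
    move=> ex ey; rewrite ltNge; apply/negP => b'; apply: (nP (x', y')); split => //.
    have := hn0 n.+1; have := kn0 n.+1; rewrite /sub /= (hS n) (kS n).
    by case: ex ey => -> [] -> ? ?; split; lra.
  have S1 := small x y (or_introl erefl) (or_introl erefl).
  have S2 := small (x + hn n.+1) y (or_intror erefl) (or_introl erefl).
  have S3 := small x (y + kn n.+1) (or_introl erefl) (or_intror erefl).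
  have S4 := small (x + hn n.+1) (y + kn n.+1) (or_intror erefl) (or_intror erefl).
  move: b; rewrite /big /= leNgt => /negP; apply.
  have -> : N / 4 ^+ n = (N / 4 ^+ n.+1 + N / 4 ^+ n.+1) + (N / 4 ^+ n.+1 + N / 4 ^+ n.+1).
    rewrite exprS invfM; have : (4 ^+ n : R) != 0 by rewrite expf_neq0.
    by move=> ?; field.
  have -> : contour H K x (x + hn n) y (y + kn n) =
    (contour H K x (x + hn n.+1) y (y + kn n.+1) +
     contour H K (x + hn n.+1) (x + hn n.+1 + hn n.+1) y (y + kn n.+1)) +
    (contour H K x (x + hn n.+1) (y + kn n.+1) (y + kn n.+1 + kn n.+1) +
     contour H K (x + hn n.+1) (x + hn n.+1 + hn n.+1) (y + kn n.+1) (y + kn n.+1 + kn n.+1)).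
    by rewrite /contour (hS n) (kS n) !addrA; ring.
  apply: le_lt_trans (normcD _ _) _; apply: ltrD; apply: le_lt_trans (normcD _ _) _; exact: ltrD.
have [g gP] := choice step.
pose s := fix s n := if n is m.+1 then g (m, s m) else (a, c).
have sP n : big n (s n).
  elim: n => [|n IH]; first by rewrite /big /hn /kn /= !expr0 !divr1.
  by have [] := gP (n, s n) IH.
have ss n : sub n (s n) (s n.+1) by have [] := gP (n, s n) (sP n).
have le_hn n : (s n).1 <= (s n).1 + hn n by rewrite lerDl ltW.
have le_kn n : (s n).2 <= (s n).2 + kn n by rewrite lerDl ltW.
have [X hX] : exists X, forall n, (s n).1 <= X <= (s n).1 + hn n.
  by apply: nested_intervals => // n; have [] := ss n.
have [Y hY] : exists Y, forall n, (s n).2 <= Y <= (s n).2 + kn n.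
  by apply: nested_intervals => // n; have [] := ss n.
have inx n : a <= (s n).1 /\ (s n).1 + hn n <= a + h.
  elim: n => [|n [IH1 IH2]]; first by rewrite /hn /= expr0 divr1.
  by have [s1 s2 _ _] := ss n; split; [exact: le_trans s1|exact: le_trans s2 IH2].
have iny n : c <= (s n).2 /\ (s n).2 + kn n <= c + k.
  elim: n => [|n [IH1 IH2]]; first by rewrite /kn /= expr0 divr1.
  by have [_ _ s1 s2] := ss n; split; [exact: le_trans s1|exact: le_trans s2 IH2].
have HK' n x y : (s n).1 <= x <= (s n).1 + hn n -> (s n).2 <= y <= (s n).2 + kn n ->
    [/\ rcderiv (H y) x (f (pt x y)), rcderiv (K x) y (f (pt x y) * 'i)
      & exists l, cderiv f (pt x y) l].
  move=> /andP[x1 x2] /andP[y1 y2]; apply: HK.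
    by rewrite (le_trans (inx n).1 x1) (le_trans x2 (inx n).2).
  by rewrite (le_trans (iny n).1 y1) (le_trans y2 (iny n).2).
have [l fl] : exists l, cderiv f (pt X Y) l by have [] := HK' 0%N X Y (hX _) (hY _).
have hk0 : 0 < h + k by rewrite addr_gt0.
(* The 8 makes the affine estimate [4 e (h + k)^2 / 4^n] equal to half of [N / 4^n]. *)
pose e := N / (8 * (h + k) ^+ 2).
have e0 : 0 < e by rewrite divr_gt0// mulr_gt0// exprn_gt0.
have [d d0 hd] := fl e e0.
have [n nd] := pow2_small (ltW hk0) d0.
have hkn : (h + k) / 2 ^+ n = hn n + kn n by rewrite mulrDl.
suff : normc (contour H K (s n).1 ((s n).1 + hn n) (s n).2 ((s n).2 + kn n)) < N / 4 ^+ n.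
  by move=> small; have := sP n; rewrite /big leNgt small.
apply: (@le_lt_trans _ _ (4 * (e * (hn n + kn n)) * (hn n + kn n))).
  rewrite [X in _ <= _ * X](_ : _ = ((s n).1 + hn n - (s n).1) + ((s n).2 + kn n - (s n).2)); last by ring.
  apply: (@contour_affine_approx _ _ _ _ _ _ _ (f (pt X Y)) l (pt X Y)) => // x y xin yin.
  have [Hx Ky _] := HK' n x y xin yin; split => //.
  have near : normc (pt x y - pt X Y) <= hn n + kn n.
    have -> : pt x y - pt X Y = (x - X)%:C + (y - Y)%:C * 'i.
      by rewrite !rmorphB; ring.
    apply: le_trans (normc_le_ReIm _) _; rewrite ReD ImD ReZ ImZ /= mulr0 mulr1 addr0 add0r.
    by move: xin yin (hX n) (hY n) => ? ? ? ?; apply: lerD; rewrite ler_norml; lra.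
  move: near (hd (pt x y - pt X Y)); set p1 := pt x y; set p0 := pt X Y => near.
  rewrite -hkn in near; rewrite (le_lt_trans near nd) => /(_ isT).
  have -> : p0 + (p1 - p0) = p1 by rewrite addrC subrK.
  have -> : f p1 - (f p0 + l * (p1 - p0)) = f p1 - f p0 - l * (p1 - p0) by ring.
  move=> nh; apply: (le_trans nh).
  by rewrite -hkn; apply: ler_wpM2l => //; exact: ltW.
rewrite -hkn /e.
have -> : (4 : R) ^+ n = 2 ^+ n * 2 ^+ n by rewrite -exprMn -natrM.
have : (2 : R) ^+ n != 0 by rewrite expf_neq0.
set w := 2 ^+ n => w0.
have -> : 4 * (N / (8 * (h + k) ^+ 2) * ((h + k) / w)) * ((h + k) / w) = N / (w * w) / 2.
  by field; rewrite w0 gt_eqF.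
have w2 : 0 < N / (w * w) by rewrite divr_gt0// -expr2 exprn_even_gt0.
by rewrite ltr_pdivrMr// ltr_pMr// ltr1n.
Qed.

End Goursat.

(** * Real-valued norms, neighbourhoods and compact rectangles *)

Section RealNorm.
Variable R : realType.

(** The norm takes its values in [R[i]], whose order is partial; this is the same number in [R]. *)
Definition nrm (V : normedModType R[i]) (x : V) : R := complex.Re `|x|.

Lemma nrmE (V : normedModType R[i]) (x : V) : `|x| = (nrm x)%:C.
Proof. by rewrite /nrm RRe_real // ger0_real. Qed.

Lemma nrm_ge0 (V : normedModType R[i]) (x : V) : 0 <= nrm x.
Proof. by rewrite -lecR -nrmE; exact: normr_ge0. Qed.

Lemma nrmD (V : normedModType R[i]) (x y : V) : nrm (x + y) <= nrm x + nrm y.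
Proof. by rewrite -lecR rmorphD /= -!nrmE ler_normD. Qed.

Lemma nrmN (V : normedModType R[i]) (x : V) : nrm (- x) = nrm x.
Proof. by rewrite /nrm normrN. Qed.

Lemma nrm_distC (V : normedModType R[i]) (x y : V) : nrm (x - y) = nrm (y - x).
Proof. by rewrite -nrmN opprB. Qed.

Lemma nrm0 (V : normedModType R[i]) : nrm (0 : V) = 0.
Proof. by rewrite /nrm normr0. Qed.

Lemma nrm_eq0 (V : normedModType R[i]) (x : V) : (nrm x == 0) = (x == 0).
Proof. by rewrite -(normr_eq0 x) nrmE fmorph_eq0. Qed.

Lemma nrmZ (V : normedModType R[i]) (c : R[i]) (x : V) : nrm (c *: x) = normc c * nrm x.
Proof.
by apply: (@complexI R); rewrite -nrmE normrZ normcE nrmE -rmorphM.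
Qed.

Lemma nrm_Cx (z : Cx R) : nrm z = normc z.
Proof. by apply: (@complexI R); rewrite -nrmE; exact: (normcE z). Qed.

Lemma nbhs_nrmP (V : normedModType R[i]) (x : V) (A : set V) :
  nbhs x A <-> exists2 d : R, 0 < d & forall y, nrm (y - x) < d -> A y.
Proof.
split=> [/nbhs_ballP[e /= /gt0_real[d d0 ->]] hA|[d d0 hA]].
  exists d => // y; rewrite -ltcR -nrmE distrC => yd; apply: hA.
  by rewrite -ball_normE.
apply/nbhs_ballP; exists d%:C; first by rewrite /= ltcR.
by move=> y; rewrite -ball_normE /= distrC nrmE ltcR => /hA.
Qed.

Lemma nbhs_absP (x : R) (A : set R) :
  nbhs x A <-> exists2 d : R, 0 < d & forall y, `|y - x| < d -> A y.
Proof.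
split=> [/nbhs_ballP[d /= d0 hA]|[d d0 hA]].
  by exists d => // y; rewrite distrC => yd; apply: hA.
by apply/nbhs_ballP; exists d => // y; rewrite /ball /= distrC => /hA.
Qed.

Lemma continuous_nrmP (V W : normedModType R[i]) (f : V -> W) (x : V) :
  {for x, continuous f} <-> (forall e : R, 0 < e ->
     exists2 d : R, 0 < d & forall y, nrm (y - x) < d -> nrm (f y - f x) < e).
Proof.
split=> [fc e e0|H A /nbhs_nrmP[e e0 hA]].
  have /fc/nbhs_nrmP[d d0 hd] : nbhs (f x) [set w | nrm (w - f x) < e].
    by apply/nbhs_nrmP; exists e.
  by exists d.
by have [d d0 hd] := H e e0; apply/nbhs_nrmP; exists d => // y /hd /hA.
Qed.

Lemma continuous_nrm_absP (V : normedModType R[i]) (f : V -> R) (x : V) :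
  {for x, continuous f} <-> (forall e : R, 0 < e ->
     exists2 d : R, 0 < d & forall y, nrm (y - x) < d -> `|f y - f x| < e).
Proof.
split=> [fc e e0|H A /nbhs_absP[e e0 hA]].
  have /fc/nbhs_nrmP[d d0 hd] : nbhs (f x) [set w | `|w - f x| < e].
    by apply/nbhs_absP; exists e.
  by exists d.
by have [d d0 hd] := H e e0; apply/nbhs_nrmP; exists d => // y /hd /hA.
Qed.

Definition crect (a b c d : R) : set (Cx R) :=
  [set z | a <= complex.Re z <= b /\ c <= complex.Im z <= d].

Lemma compact_crect (a b c d : R) : compact (crect a b c d).
Proof.
pose g (p : R * R) : Cx R := p.1 +i* p.2.
have gc : continuous g.
  move=> [x y] A /nbhs_nrmP[e e0 hA].
  have e20 : 0 < e / 2 by rewrite divr_gt0.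
  exists (ball x (e / 2), ball y (e / 2)).
    by split; apply/nbhs_ballP; exists (e / 2).
  move=> [x' y'] [/= xx yy]; apply: hA; rewrite nrm_Cx.
  apply: (le_lt_trans (normc_le_ReIm _)).
  rewrite -[_ - _]/((x' - x) +i* (y' - y)) /= [e]splitr.
  by apply: ltrD; rewrite distrC.
have -> : crect a b c d = g @` (`[a, b] `*` `[c, d]).
  apply/seteqP; split => [z [zr zi]|_ [[x y] [/= xin yin] <-]].
    exists (complex.Re z, complex.Im z); last by case: z {zr zi}.
    by rewrite /= !in_itv.
  by move: xin yin; rewrite !in_itv.
apply: continuous_compact; first exact: continuous_subspaceT.
by apply: compact_setX; exact: segment_compact.
Qed.

Lemma compact_bound (T : topologicalType) (A : set T) (f : T -> R) :
  compact A -> (forall x, A x -> {for x, continuous f}) ->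
  exists2 M, 0 <= M & forall x, A x -> f x <= M.
Proof.
move=> Ac fc; have [->|/set0P A0] := eqVneq A set0; first by exists 0.
have [|c cA hc] := compact_EVT_max A0 Ac (f := f).
  by apply: continuous_in_subspaceT => x /set_mem; exact: fc.
exists (Num.max 0 (f c)); first by rewrite le_max lexx.
by move=> x Ax; rewrite le_max hc ?orbT// inE.
Qed.

End RealNorm.

(** * Integrals over a period *)

Section CircleIntegral.
Variable R : realType.
Implicit Types (g h P : R -> R).

(** Left unnormalised to match the integral in [subharmonic_on]; [cintE] relates the two for
    continuous integrands. *)
Definition cint g : R := \int[lebesgue_measure]_(t in `[0, 2 * pi]) g t.

Lemma pi2_gt0 : 0 < 2 * pi :> R. Proof. by rewrite mulr_gt0// pi_gt0. Qed.

Lemma cint_integrable g : continuous g ->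
  lebesgue_measure.-integrable `[0, 2 * pi] (EFin \o g).
Proof.
move=> gc; apply: continuous_compact_integrable; first exact: segment_compact.
exact: continuous_subspaceT.
Qed.

Lemma cintE g : continuous g ->
  (\int[lebesgue_measure]_(t in `[0%R, (2 * pi)%R]) (g t)%:E)%E = (cint g)%:E.
Proof.
move=> gc; rewrite /cint /Rintegral fineK//.
exact: integrable_fin_num (cint_integrable gc).
Qed.

Lemma cint_cst (c : R) : cint (fun=> c) = 2 * pi * c.
Proof.
rewrite /cint Rintegral_cst//= lebesgue_measure_itv/= lte_fin pi2_gt0.
by rewrite -EFinD/= subr0 mulrC.
Qed.

Lemma cintD g h : continuous g -> continuous h ->
  cint (fun t => g t + h t) = cint g + cint h.
Proof. by move=> gc hc; rewrite /cint RintegralD//; exact: cint_integrable. Qed.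

Lemma cintZ g (c : R) : continuous g -> cint (fun t => c * g t) = c * cint g.
Proof. by move=> gc; rewrite /cint RintegralZl//; exact: cint_integrable. Qed.

Lemma le_cint g h : continuous g -> continuous h -> (forall t, g t <= h t) ->
  cint g <= cint h.
Proof. by move=> gc hc gh; apply: le_Rintegral => //; exact: cint_integrable. Qed.

Lemma cint_primitive g P : continuous g ->
  (forall t, 0 <= t <= 2 * pi -> is_derive t 1 P (g t)) -> cint g = P (2 * pi) - P 0.
Proof.
move=> gc Pg; apply: EFin_inj; rewrite -cintE// EFinB.
have Pc t : 0 <= t <= 2 * pi -> {for t, continuous P}.
  by move=> /Pg; exact: derivable_continuous_pt.
apply: continuous_FTC2; [exact: pi2_gt0|exact: continuous_subspaceT| |].
  split.
  - by move=> t; rewrite in_itv /= => /andP[? ?]; have [] := Pg t _; rewrite ?ltW.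
  - by apply: cvg_at_right_filter; apply: Pc; rewrite lexx ltW// pi2_gt0.
  - by apply: cvg_at_left_filter; apply: Pc; rewrite lexx andbT ltW// pi2_gt0.
move=> t; rewrite in_itv /= => /andP[? ?]; rewrite derive1E.
by have [] := Pg t _; rewrite ?ltW.
Qed.

End CircleIntegral.

(** * Mean value property and Cauchy estimates *)

Section CauchyTheory.
Variable R : realType.
Implicit Types (f G : R[i] -> R[i]) (a z l L : R[i]).

Local Notation pt x y := ((x%:C + y%:C * 'i) : R[i]).

Lemma line_continuous f (a b : R[i]) :
  (forall t : R, exists l, cderiv f (a + t%:C * b) l) ->
  continuous (fun t : R => complex.Re (f (a + t%:C * b))) /\
  continuous (fun t : R => complex.Im (f (a + t%:C * b))).
Proof.
move=> fd; split => t; have [l /rcderiv_line[dr di]] := fd t.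
  exact: derivable_continuous_pt dr.
exact: derivable_continuous_pt di.
Qed.

(** The factor [c] carries the [dz] of a contour integral: [1] on horizontal lines and ['i] on
    vertical ones. *)
Lemma complex_primitive f (a b c : R[i]) (p q : R) : p <= q ->
  (forall t : R, p <= t <= q -> exists l, cderiv f (a + t%:C * b) l) ->
  exists F : R -> R[i], forall t, p <= t <= q -> rcderiv F t (f (a + t%:C * b) * c).
Proof.
move=> pq fd.
have gd t : p <= t <= q -> exists l, cderiv (fun z => f z * c) (a + t%:C * b) l.
  by move=> /fd[l fl]; have := cderivM fl (cderiv_cst c _); eexists; eassumption.
have [Fr hr] : exists Fr : R -> R, forall t, p <= t <= q ->
    is_derive t 1 Fr (complex.Re (f (a + t%:C * b) * c)).
  apply: primitive_exists => // t /gd[l /rcderiv_line[dr _]].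
  exact: derivable_continuous_pt dr.
have [Fi hi] : exists Fi : R -> R, forall t, p <= t <= q ->
    is_derive t 1 Fi (complex.Im (f (a + t%:C * b) * c)).
  apply: primitive_exists => // t /gd[l /rcderiv_line[_ di]].
  exact: derivable_continuous_pt di.
by exists (fun t => Fr t +i* Fi t) => t tin; split; [exact: hr|exact: hi].
Qed.

(* Goursat on the rectangle [[s1, s] x [0, 2 pi]], where the horizontal sides
   cancel by periodicity; then let [s1] tend to [-oo]. *)
Lemma periodic_mean G L (b : R) :
  (forall z, complex.Re z < b -> exists l, cderiv G z l) ->
  (forall z, G (z + (2 * pi)%:C * 'i) = G z) ->
  (forall e : R, 0 < e -> exists s0, forall z, complex.Re z <= s0 -> normc (G z - L) <= e) ->
  forall s, s < b ->
    cint (fun t => complex.Re (G (pt s t))) = 2 * pi * complex.Re L /\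
    cint (fun t => complex.Im (G (pt s t))) = 2 * pi * complex.Im L.
Proof.
move=> Gd Gper Glim s sb.
have Rept x y : complex.Re (pt x y) = x by rewrite ReD ReZ /= mulr0 addr0.
have lc x : x < b -> continuous (fun t : R => complex.Re (G (pt x t))) /\
    continuous (fun t : R => complex.Im (G (pt x t))).
  by move=> xb; apply: line_continuous => t; apply: Gd; rewrite Rept.
have indep s1 : s1 < s -> 
    cint (fun t => complex.Re (G (pt s t))) = cint (fun t => complex.Re (G (pt s1 t))) /\
    cint (fun t => complex.Im (G (pt s t))) = cint (fun t => complex.Im (G (pt s1 t))).
  move=> s1s; have lt_b x : s1 <= x <= s -> x < b by move=> /andP[_ /le_lt_trans]; apply.
  have /choice[H HP] (y : R) : exists F : R -> R[i], forall x, s1 <= x <= s ->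
      rcderiv F x (G (pt x y)).
    have [|F FP] := @complex_primitive G (y%:C * 'i) 1 1 s1 s (ltW s1s).
      by move=> x /lt_b xb; apply: Gd; rewrite mulr1 addrC Rept.
    by exists F => x /FP; rewrite !mulr1 [_ + x%:C]addrC.
  have /choice[K KP] (x : R) : exists F : R -> R[i], s1 <= x <= s ->
      forall y, 0 <= y <= 2 * pi -> rcderiv F y (G (pt x y) * 'i).
    (* Outside [[s1, s]], where [G] may fail to be holomorphic, the primitive is 0 by default. *)
    have [/lt_b xb|nx] := boolP (s1 <= x <= s); last by exists (fun=> 0).
    have [|F FP] := @complex_primitive G x%:C 'i 'i 0 (2 * pi) (ltW (pi2_gt0 R)).
      by move=> y _; apply: Gd; rewrite Rept.
    by exists F.
  have := @goursat R G H K s1 0 (s - s1) (2 * pi).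
  rewrite subr_gt0 s1s pi2_gt0 add0r [s1 + _]addrC subrK => /(_ isT isT) cont0.
  have {}cont0 : contour H K s1 s 0 (2 * pi) = 0.
    apply: cont0 => x y xin yin; split; [exact: HP|exact: KP|].
    by apply: Gd; rewrite Rept lt_b.
  have hor : H 0 s - H 0 s1 = H (2 * pi) s - H (2 * pi) s1.
    apply/eqP; rewrite -subr_eq0 -normc_eq0 eq_le normc_ge0 andbT.
    have -> : H 0 s - H 0 s1 - (H (2 * pi) s - H (2 * pi) s1) =
      (H 0 s - H (2 * pi) s) - (H 0 s1 - H (2 * pi) s1) by ring.
    apply: le_trans (@rcderiv_bound R (fun x => H 0 x - H (2 * pi) x)
      (fun x => G (pt x 0) - G (pt x (2 * pi))) s1 s 0 (ltW s1s) _ _) _.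
    - by move=> x xin; apply: rcderivB; apply: HP.
    - move=> x xin; have -> : pt x (2 * pi) = pt x 0 + (2 * pi)%:C * 'i.
        by rewrite mul0r addr0.
      by rewrite Gper subrr Normc.normc0.
    - by rewrite mulr0 mul0r.
  have ver : K s (2 * pi) - K s 0 = K s1 (2 * pi) - K s1 0.
    by move: cont0; rewrite /contour hor subrr add0r => /eqP; rewrite subr_eq0 => /eqP.
  (* As [K x] has derivative ['i G], the real part of [G] integrates to the imaginary part of [K x],
     and its imaginary part to minus the real part. *)
  have KE x : s1 <= x <= s ->
      cint (fun t => complex.Re (G (pt x t))) = complex.Im (K x (2 * pi) - K x 0) /\
      cint (fun t => complex.Im (G (pt x t))) = - complex.Re (K x (2 * pi) - K x 0).
    move=> xin; have [cr ci] := lc x (lt_b x xin); split.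
      rewrite ImD ImN; apply: (@cint_primitive R _ (fun t => complex.Im (K x t))) => // t tin.
      have [_] := KP x xin t tin.
      by rewrite ImM /= mulr1 mulr0 addr0.
    have E : cint (fun t => -1 * complex.Im (G (pt x t))) =
        complex.Re (K x (2 * pi)) - complex.Re (K x 0).
      apply: (@cint_primitive R _ (fun t => complex.Re (K x t))).
        by move=> t; apply: cvgM; [exact: cvg_cst|exact: ci].
      move=> t tin; have [+ _] := KP x xin t tin.
      by rewrite ReM /= mulr0 mulr1 sub0r mulN1r.
    by rewrite ReD ReN -E cintZ// mulN1r opprK.
  have sin : s1 <= s <= s by rewrite lexx andbT ltW.
  have s1in : s1 <= s1 <= s by rewrite lexx ltW.
  have [-> ->] := KE s sin; have [-> ->] := KE s1 s1in.
  by rewrite ver.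
(* Far to the left [G] is uniformly close to [L], and by [indep] its integral there is the one at
   [s]. *)
have close e : 0 < e -> exists2 s1, s1 < s & forall t, normc (G (pt s1 t) - L) <= e.
  move=> e0; have [s0 hs0] := Glim e e0; exists (Num.min s0 (s - 1)).
    by rewrite gt_min ltrBlDr ltrDl ltr01 orbT.
  by move=> t; apply: hs0; rewrite Rept ge_min lexx.
have fin (x y : R) : (forall e, 0 < e -> `|x - y| <= 2 * pi * e) -> x = y.
  move=> H; apply/eqP; rewrite -subr_eq0 -normr_eq0 eq_le normr_ge0 andbT.
  apply/ler_addgt0Pr => e e0; rewrite add0r.
  have := H (e / (2 * pi)); rewrite divr_gt0 ?pi2_gt0// => /(_ isT).
  by rewrite mulrC divfK// gt_eqF ?pi2_gt0.
have est (g : R -> R) (c e : R) : continuous g -> (forall t, `|g t - c| <= e) ->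
    `|cint g - 2 * pi * c| <= 2 * pi * e.
  move=> gc ge; rewrite ler_distl; apply/andP; split.
    rewrite -mulrBr -cint_cst; apply: le_cint => //; first exact: cst_continuous.
    by move=> t; have := ge t; rewrite ler_distl => /andP[].
  rewrite -mulrDr -cint_cst; apply: le_cint => //; first exact: cst_continuous.
  by move=> t; have := ge t; rewrite ler_distl => /andP[].
split; apply: fin => e /close[s1 s1s hs1].
  have [-> _] := indep s1 s1s; have [cr _] := lc s1 (lt_trans s1s sb).
  by apply: est => // t; rewrite -ReN -ReD (le_trans (abs_Re_le _)).
have [_ ->] := indep s1 s1s; have [_ ci] := lc s1 (lt_trans s1s sb).
by apply: est => // t; rewrite -ImN -ImD (le_trans (abs_Im_le _)).
Qed.

Definition circ (a : R[i]) (r t : R) : R[i] := a + r%:C * cis t.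

Lemma normc_circ a r t : 0 <= r -> normc (circ a r t - a) = r.
Proof.
by move=> r0; rewrite /circ addrC addKr normcM normc_cis mulr1 normc_real ger0_norm.
Qed.

Lemma circ_cexp a r t : 0 < r -> circ a r t = a + cexp (pt (ln r) t).
Proof. by move=> r0; rewrite cexp_line lnK ?posrE. Qed.

Lemma small_cexp (d : R) (z : R[i]) : 0 < d -> complex.Re z < ln d -> normc (cexp z) < d.
Proof. by move=> d0 zd; rewrite normc_cexp -[X in _ < X]lnK ?posrE// ltr_expR. Qed.

(** The map [z |-> f (a + cexp z)] is holomorphic for [Re z < ln rho], has period [2 pi 'i] and
    tends to [f a] on the left; vertical lines become circles around [a]. *)
Lemma circle_mean f a (rho r : R) : 0 < r -> r < rho ->
  (forall z, normc (z - a) < rho -> exists l, cderiv f z l) ->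
  cint (fun t => complex.Re (f (circ a r t))) = 2 * pi * complex.Re (f a) /\
  cint (fun t => complex.Im (f (circ a r t))) = 2 * pi * complex.Im (f a).
Proof.
move=> r0 rrho fd; have rho0 := lt_trans r0 rrho.
have := @periodic_mean (fun z => f (a + cexp z)) (f a) (ln rho).
have -> : (fun t => complex.Re (f (circ a r t))) =
  (fun t => complex.Re (f (a + cexp (pt (ln r) t)))).
  by apply/funext => t; rewrite circ_cexp.
have -> : (fun t => complex.Im (f (circ a r t))) =
  (fun t => complex.Im (f (a + cexp (pt (ln r) t)))).
  by apply/funext => t; rewrite circ_cexp.
apply; last by rewrite ltr_ln.
- move=> z zr; have [|l fl] := fd (a + cexp z); first by rewrite addrC addKr small_cexp.
  exists (l * (0 + cexp z)); apply: (@cderiv_comp _ f (fun z => a + cexp z)) => //.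
  by apply: cderivD; [exact: cderiv_cst|exact: cderiv_cexp].
- by move=> z; rewrite cexp_per.
- move=> e e0; have [l fl] : exists l, cderiv f a l by apply: fd; rewrite subrr Normc.normc0.
  have [d d0 hd] := cderiv_continuous fl e0.
  exists (ln d - 1) => z zd; apply/ltW/hd; rewrite addrC addKr small_cexp//.
  by rewrite (le_lt_trans zd)// ltrBlDr ltrDl.
Qed.

(* The Laurent coefficient formula [2 pi f'(a) r = \int (f (a + r e^it) - f a) e^-it dt]. *)
Lemma cauchy_estimate f a l (rho M : R) : 0 < rho ->
  (forall z, normc (z - a) < rho -> exists l, cderiv f z l) ->
  (forall z, normc (z - a) < rho -> normc (f z - f a) <= M) ->
  cderiv f a l -> normc l <= 4 * M / rho.
Proof.
move=> rho0 fd fM fl; pose r := rho / 2.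
have r0 : 0 < r by rewrite divr_gt0.
have rrho : r < rho by rewrite ltr_pdivrMr// ltr_pMr// ltr1n.
(* [G] is the difference quotient of [f] at [a], with limit [l] on the left. On the circle of radius
   [rho / 2] it is at most [2 M / rho], and adding real and imaginary parts gives the 4. *)
pose G z := (f (a + cexp z) - f a) * cexp (- z).
have Gd z : complex.Re z < ln rho -> exists l, cderiv G z l.
  move=> zr; have [|k fk] := fd (a + cexp z); first by rewrite addrC addKr small_cexp.
  have d1 : cderiv (fun z => f (a + cexp z)) z (k * (0 + cexp z)).
    apply: (@cderiv_comp _ f (fun z => a + cexp z)) => //.
    by apply: cderivD; [exact: cderiv_cst|exact: cderiv_cexp].
  have d2 : cderiv (fun z => cexp (- z)) z (cexp (- z) * (0 - 1)).
    apply: (@cderiv_comp _ (@cexp R) (fun z => - z)); first exact: cderiv_cexp.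
    apply: (@cderiv_ext _ (fun z => 0 - z)) => [w|]; first by rewrite sub0r.
    by apply: cderivB; [exact: cderiv_cst|exact: cderiv_id].
  by have := cderivM (cderivB d1 (cderiv_cst (f a) z)) d2; eexists; eassumption.
have nG z : normc (G z) = normc (f (a + cexp z) - f a) / normc (cexp z).
  by rewrite normcM cexpN Normc.normcV.
have [] := @periodic_mean G l (ln rho) Gd _ _ (ln r).
- move=> z; rewrite /G cexp_per opprD; congr (_ * _).
  by rewrite -[in RHS](subrK ((2 * pi)%:C * 'i) (- z)) cexp_per.
- move=> e e0; have [d d0 hd] := fl e e0.
  exists (ln d - 1) => z zd.
  have hz : normc (cexp z) < d.
    by apply: small_cexp => //; rewrite (le_lt_trans zd)// ltrBlDr ltrDl.
  have -> : G z - l = (f (a + cexp z) - f a - l * cexp z) * cexp (- z).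
    by rewrite [in RHS]mulrBl cexpN mulfK ?cexp_neq0// -cexpN.
  rewrite normcM cexpN Normc.normcV ler_pdivrMr ?normc_cexp ?expR_gt0//.
  by rewrite -normc_cexp; exact: hd.
- by rewrite ltr_ln.
have Gb t : normc (G (pt (ln r) t)) <= M / r.
  rewrite nG cexp_line lnK ?posrE// normcM normc_cis mulr1 normc_real gtr0_norm//.
  rewrite ler_pM2r ?invr_gt0//; apply: fM.
  by rewrite -/(circ a r t) normc_circ ?ltW.
have [cr ci] : continuous (fun t : R => complex.Re (G (pt (ln r) t))) /\
    continuous (fun t : R => complex.Im (G (pt (ln r) t))).
  apply: line_continuous => t; apply: Gd; rewrite ReD ReZ /= mulr0 addr0.
  by rewrite ltr_ln.
have bnd (g : R -> R) c : continuous g -> (forall t, `|g t| <= M / r) ->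
    cint g = 2 * pi * c -> `|c| <= M / r.
  move=> gc gM gE; rewrite ler_norml; apply/andP; split.
    rewrite -(ler_pM2l (pi2_gt0 R)) -gE -cint_cst; apply: le_cint => //; first exact: cst_continuous.
    by move=> t; have := gM t; rewrite ler_norml => /andP[].
  rewrite -(ler_pM2l (pi2_gt0 R)) -gE -cint_cst; apply: le_cint => //; first exact: cst_continuous.
  by move=> t; have := gM t; rewrite ler_norml => /andP[].
move=> /bnd br /bnd bi; apply: (le_trans (normc_le_ReIm _)).
have -> : 4 * M / rho = M / r + M / r by rewrite /r; field; rewrite gt_eqF.
apply: lerD; [apply: br|apply: bi] => // t.
  exact: le_trans (abs_Re_le _) (Gb t).
exact: le_trans (abs_Im_le _) (Gb t).
Qed.

(** Cauchy's estimate around each point of the segment bounds the derivative. The 16 is 2 from the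
    mean value bound, 4 from Cauchy's estimate and 2 from bounding a difference of values by
    [M + M]. *)
Lemma cauchy_lipschitz f (p q : R[i]) (rho M : R) : 0 < rho ->
  (forall (t : R) z, 0 <= t <= 1 -> normc (z - (p + t%:C * (q - p))) < rho ->
     (exists l, cderiv f z l) /\ normc (f z) <= M) ->
  normc (f q - f p) <= 16 * M / rho * normc (q - p).
Proof.
move=> rho0 fd.
have /choice[df dfP] z : exists l, (exists l, cderiv f z l) -> cderiv f z l.
  by have [[l ?]|?] := pselect (exists l, cderiv f z l); [exists l|exists 0].
have fdt (t : R) : 0 <= t <= 1 -> cderiv f (p + t%:C * (q - p)) (df (p + t%:C * (q - p))).
  by move=> t01; apply: dfP; apply: (fd t _ t01 _).1; rewrite subrr Normc.normc0.
have -> : 16 * M / rho = 2 * (4 * (M + M) / rho) by field; rewrite gt_eqF.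
apply: (@cderiv_bound _ f df) => // t t01.
apply: (@cauchy_estimate f (p + t%:C * (q - p))) => //; last exact: fdt.
  by move=> z zr; exact: (fd t z t01 zr).1.
move=> z zr; apply: le_trans (normcB _ _) _; apply: lerD; first exact: (fd t z t01 zr).2.
by apply: (fd t _ t01 _).2; rewrite subrr Normc.normc0.
Qed.

End CauchyTheory.

(** * Continuity of coordinates, maximum norm and Euclidean norm *)

Section ContinuityTools.
Variable R : realType.

Lemma continuous_Re : continuous (fun z : Cx R => complex.Re z).
Proof.
move=> z; apply/continuous_nrm_absP => e e0; exists e => // y.
by rewrite nrm_Cx; apply: le_lt_trans; rewrite -ReN -ReD; exact: abs_Re_le.
Qed.

Lemma continuous_Im : continuous (fun z : Cx R => complex.Im z).
Proof.
move=> z; apply/continuous_nrm_absP => e e0; exists e => // y.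
by rewrite nrm_Cx; apply: le_lt_trans; rewrite -ImN -ImD; exact: abs_Im_le.
Qed.

Lemma continuous_ReIm (T : topologicalType) (f : T -> Cx R) (x : T) :
  {for x, continuous (fun t => complex.Re (f t))} ->
  {for x, continuous (fun t => complex.Im (f t))} -> {for x, continuous f}.
Proof.
move=> cr ci A /nbhs_nrmP[e e0 hA].
have e20 : 0 < e / 2 by rewrite divr_gt0.
have nr : nbhs x [set t | `|complex.Re (f t) - complex.Re (f x)| < e / 2].
  by apply: (cr [set y | `|y - complex.Re (f x)| < e / 2]); apply/nbhs_absP; exists (e / 2).
have ni : nbhs x [set t | `|complex.Im (f t) - complex.Im (f x)| < e / 2].
  by apply: (ci [set y | `|y - complex.Im (f x)| < e / 2]); apply/nbhs_absP; exists (e / 2).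
change (nbhs x (f @^-1` A)).
apply: filterS (filterI nr ni) => t [/= hr hi]; apply: hA.
rewrite nrm_Cx (le_lt_trans (normc_le_ReIm _))// ReD ReN ImD ImN [e]splitr.
exact: ltrD.
Qed.

Lemma cderiv_continuous_Cx (f : R[i] -> R[i]) (z l : R[i]) : cderiv f z l ->
  {for z, continuous (f : Cx R -> Cx R)}.
Proof.
move=> fl; apply/continuous_nrmP => e e0; have [d d0 hd] := cderiv_continuous fl e0.
by exists d => // y; rewrite !nrm_Cx; exact: hd.
Qed.

Lemma continuous_circ (a : R[i]) (r : R) : continuous (circ a r : R -> Cx R).
Proof.
move=> t; apply: continuous_ReIm.
  rewrite (_ : (fun t => _) = (fun t => complex.Re a + r * cos t)); last first.
    by apply/funext => s; rewrite /circ ReD ReZ.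
  apply: cvgD; first exact: cvg_cst.
  by apply: cvgM; [exact: cvg_cst|exact: continuous_cos].
rewrite (_ : (fun t => _) = (fun t => complex.Im a + r * sin t)); last first.
  by apply/funext => s; rewrite /circ ImD ImZ.
apply: cvgD; first exact: cvg_cst.
by apply: cvgM; [exact: cvg_cst|exact: continuous_sin].
Qed.

Lemma continuous_sumR (T : topologicalType) n (f : 'I_n -> T -> R) (x : T) :
  (forall i, {for x, continuous (f i)}) ->
  {for x, continuous (fun t => \sum_(i < n) f i t)}.
Proof.
elim: n f => [|n IH] f fc.
  rewrite (_ : (fun t => _) = (fun=> 0)); first exact: cvg_cst.
  by apply/funext => t; rewrite big_ord0.
rewrite (_ : (fun t => _) =
  (fun t => \sum_(i < n) f (widen_ord (leqnSn n) i) t + f ord_max t)).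
  by apply: cvgD; [exact: IH|exact: fc].
by apply/funext => t; rewrite big_ord_recr.
Qed.

Lemma cint_sum n (f : 'I_n -> R -> R) : (forall i, continuous (f i)) ->
  cint (fun t => \sum_(i < n) f i t) = \sum_(i < n) cint (f i).
Proof.
elim: n f => [|n IH] f fc.
  rewrite (_ : (fun t => _) = (fun=> 0)); first by rewrite cint_cst mulr0 big_ord0.
  by apply/funext => t; rewrite big_ord0.
rewrite (_ : (fun t => _) =
  (fun t => \sum_(i < n) f (widen_ord (leqnSn n) i) t + f ord_max t)); last first.
  by apply/funext => t; rewrite big_ord_recr.
rewrite cintD ?IH ?big_ord_recr//.
by move=> t; apply: continuous_sumR => i; exact: fc.
Qed.

Section Euclid.
Variable d : nat.
Implicit Types z w : Cn R d.

Lemma normc_coord_le z j : normc (z ord0 j) <= nrm z.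
Proof.
rewrite -lecR -nrmE -normcE -[`|z|]/(mx_norm z) mx_normE.
by rewrite -[leLHS]nngE num_le; exact: (le_bigmax _ _ (ord0, j)).
Qed.

(** The norm of a row vector is the maximum over its coordinates; as [d] may be 0, positivity is
    what provides a coordinate. *)
Lemma nrm_coord z : 0 < nrm z -> exists j, nrm z = normc (z ord0 j).
Proof.
move=> z0; have [|[i j] /= E] := @mx_norm_neq0 _ _ _ z.
  by rewrite -[mx_norm z]/(`|z|) normr_eq0 -nrm_eq0 gt_eqF.
exists j; apply: (@complexI R); rewrite -nrmE -normcE -[`|z|]/(mx_norm z) E.
by rewrite ord1.
Qed.

Lemma nrm_lt_coord z (e : R) : 0 < e -> (forall j, normc (z ord0 j) < e) -> nrm z < e.
Proof.
move=> e0 H; have [z0|] := ltP 0 (nrm z); last by move=> /le_lt_trans; apply.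
by have [j ->] := nrm_coord z0.
Qed.

Lemma nrm_le_coord z (e : R) : 0 <= e -> (forall j, normc (z ord0 j) <= e) -> nrm z <= e.
Proof.
move=> e0 H; have [z0|] := ltP 0 (nrm z); last by move=> /le_trans; apply.
by have [j ->] := nrm_coord z0.
Qed.

Lemma eucl2E z : eucl2 z = \sum_(j < d) normc (z ord0 j) ^+ 2.
Proof. by apply: eq_bigr => j _; rewrite normcE -rmorphXn. Qed.

Lemma eucl2_ge0 z : 0 <= eucl2 z.
Proof. by rewrite eucl2E sumr_ge0// => j _; rewrite sqr_ge0. Qed.

Lemma eucl2_0 : eucl2 (0 : Cn R d) = 0.
Proof. by rewrite eucl2E big1// => j _; rewrite mxE Normc.normc0 expr0n. Qed.

Lemma coord_le_eucl2 z j : normc (z ord0 j) ^+ 2 <= eucl2 z.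
Proof.
by rewrite eucl2E (bigD1 j)//= lerDl sumr_ge0// => i _; rewrite sqr_ge0.
Qed.

(** The topology is that of the maximum norm, while the penalty terms and Gronwall's inequality use
    the smooth function [eucl2]; this and the next lemma pass between them. *)
Lemma nrm2_le_eucl2 z : nrm z ^+ 2 <= eucl2 z.
Proof.
have [z0|z0] := ltP 0 (nrm z); first by have [j ->] := nrm_coord z0; exact: coord_le_eucl2.
by rewrite (_ : nrm z = 0) ?expr0n ?eucl2_ge0//; apply/eqP; rewrite eq_le z0 nrm_ge0.
Qed.

Lemma eucl2_le_nrm2 z : eucl2 z <= d%:R * nrm z ^+ 2.
Proof.
have -> : d%:R * nrm z ^+ 2 = \sum_(j < d) nrm z ^+ 2.
  by rewrite sumr_const card_ord mulr_natl.
rewrite eucl2E; apply: ler_sum => j _.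
by rewrite ler_sqr ?nnegrE ?normc_ge0 ?nrm_ge0//; exact: normc_coord_le.
Qed.

Lemma continuous_coord (j : 'I_d) : continuous (fun z : Cn R d => z ord0 j : Cx R).
Proof.
move=> z; apply/continuous_nrmP => e e0; exists e => // y.
by apply: le_lt_trans; rewrite nrm_Cx; have := normc_coord_le (y - z) j; rewrite !mxE.
Qed.

Lemma continuous_eucl2 : continuous (@eucl2 R d).
Proof.
move=> z; rewrite (_ : @eucl2 R d = (fun w => \sum_(j < d)
  (complex.Re (w ord0 j) * complex.Re (w ord0 j) +
   complex.Im (w ord0 j) * complex.Im (w ord0 j)))); last first.
  by apply/funext => w; rewrite eucl2E; apply: eq_bigr => j _; rewrite normc_sqr !expr2.
apply: continuous_sumR => j.
have cr : {for z, continuous (fun w : Cn R d => complex.Re (w ord0 j))}.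
  apply: (@continuous_comp _ _ _ (fun w : Cn R d => w ord0 j : Cx R) (fun c : Cx R => complex.Re c)).
    exact: continuous_coord.
  exact: continuous_Re.
have ci : {for z, continuous (fun w : Cn R d => complex.Im (w ord0 j))}.
  apply: (@continuous_comp _ _ _ (fun w : Cn R d => w ord0 j : Cx R) (fun c : Cx R => complex.Im c)).
    exact: continuous_coord.
  exact: continuous_Im.
exact: cvgD (cvgM cr cr) (cvgM ci ci).
Qed.

End Euclid.
End ContinuityTools.

(** * Second-order Taylor estimate for entire functions *)

Section SecondOrder.
Variable R : realType.

Lemma entire_bounded (f : R[i] -> R[i]) (a : R[i]) (r : R) :
  (forall z, exists l, cderiv f z l) ->
  exists2 M, 0 <= M & forall z, normc (z - a) <= r -> normc (f z) <= M.
Proof.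
move=> fd.
pose K := crect (complex.Re a - r) (complex.Re a + r) (complex.Im a - r) (complex.Im a + r).
have [|M M0 hM] := @compact_bound R (Cx R) K (fun z => normc (f z)) (@compact_crect _ _ _ _ _).
  move=> z _; apply/continuous_nrm_absP => e e0; have [l /cderiv_continuous fl] := fd z.
  have [d d0 hd] := fl e e0; exists d => // y; rewrite nrm_Cx => /hd.
  apply: le_lt_trans; rewrite ler_norml lerBlDr; apply/andP; split.
    rewrite lerNl opprB lerBlDr normc_distC.
    by rewrite -[X in normc X <= _](subrK (f y)) normcD.
  by rewrite -[X in normc X <= _](subrK (f z)) normcD.
exists M => // z zr; apply: hM; rewrite /K /crect /= -!ler_distl; split.
  by rewrite -ReN -ReD (le_trans (abs_Re_le _)).
by rewrite -ImN -ImD (le_trans (abs_Im_le _)).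
Qed.

(* The derivative of [f] at [a + h] minus that at [a] is the derivative at [a] of the
   difference [z |-> f (h + z) - f z], hence small by Cauchy's estimate. *)
Lemma entire_second_order (f df : R[i] -> R[i]) (a : R[i]) :
  (forall z, cderiv f z (df z)) ->
  exists2 C, 0 <= C & forall h, normc h <= 1 ->
    normc (f (a + h) - f a - df a * h) <= C * normc h ^+ 2.
Proof.
move=> fd; have fd' z : exists l, cderiv f z l by exists (df z).
(* The points used in [lip] are within three displacements of size at most 1 from [a]. *)
have [M M0 hM] := entire_bounded a 4 fd'.
(* Cauchy's estimate with bound [16 M + 16 M] gives the 128 of [dfl], and the mean value bound
   doubles it. *)
exists (256 * M); first by rewrite mulr_ge0.
have lip z k : normc (z - a) <= 1 -> normc k <= 1 ->
    normc (f (k + z) - f z) <= 16 * M * normc k.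
  move=> za k1; have := @cauchy_lipschitz R f z (k + z) 1 M ltr01.
  rewrite divr1 addrK; apply => t w /andP[t0 t1] wz; split => //; apply: hM.
  have -> : w - a = (w - (z + t%:C * k)) + (z - a) + t%:C * k by ring.
  apply: le_trans (normcD _ _) _.
  have tk : normc (t%:C * k) <= 1.
    by rewrite normcM normc_real ger0_norm// mulr_ile1// normc_ge0.
  apply: (@le_trans _ _ (1 + 1 + 1)); last by lra.
  by apply: lerD => //; apply: le_trans (normcD _ _) _; apply: lerD => //; exact: ltW.
have dfl k : normc k <= 1 -> normc (df (a + k) - df a) <= 128 * M * normc k.
  move=> k1; have -> : 128 * M * normc k = 4 * (16 * M * normc k + 16 * M * normc k) / 1.
    by rewrite divr1; ring.
  have d1 z : cderiv (fun z => f (k + z) - f z) z (df (k + z) - df z).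
    by apply: cderivB => //; apply: cderiv_shift.
  apply: (@cauchy_estimate R (fun z => f (k + z) - f z) a) => //.
  - by move=> z _; exists (df (k + z) - df z).
  - move=> z /ltW za; apply: le_trans (normcB _ _) _.
    by apply: lerD; apply: lip => //; rewrite subrr Normc.normc0.
  - by rewrite [a + k]addrC; exact: d1.
move=> h h1; pose g z := f z - df a * z.
have gd z : cderiv g z (df z - df a).
  apply: cderivB => //; rewrite -[X in cderiv _ _ X]mulr1.
  by apply: cderivZ; exact: cderiv_id.
have -> : f (a + h) - f a - df a * h = g (a + h) - g a by rewrite /g; ring.
have -> : 256 * M * normc h ^+ 2 = 2 * (128 * M * normc h) * normc ((a + h) - a).
  by rewrite addrC addKr; ring.
apply: (@cderiv_bound R g (fun z => df z - df a)) => // t /andP[t0 t1].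
rewrite [a + h]addrC addrK.
have th : normc (t%:C * h) <= normc h.
  by rewrite normcM normc_real ger0_norm// ler_piMl// normc_ge0.
apply: le_trans (dfl _ (le_trans th h1)) _.
by rewrite ler_wpM2l// mulr_ge0.
Qed.

End SecondOrder.

(** * Compact boxes and expansion of the penalty *)

Section Comparison.
Variables (R : realType) (d : nat).

Lemma compact_box (r : R) :
  compact [set p : Cn R d | forall j, crect (- r) r (- r) r (p ord0 j)].
Proof. by apply: (@rV_compact (Cx R) d (fun=> crect (- r) r (- r) r)) => j; exact: compact_crect. Qed.

Lemma box_nrm (r : R) (p : Cn R d) : 0 <= r ->
  (forall j, crect (- r) r (- r) r (p ord0 j)) -> nrm p <= 2 * r.
Proof.
move=> r0 H; apply: nrm_le_coord => [|j]; first by rewrite mulr_ge0.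
have [pr pi] := H j; apply: le_trans (normc_le_ReIm _) _.
by rewrite mulrDl mul1r lerD// ler_norml.
Qed.

Lemma eucl2_box (r : R) (p : Cn R d) : 0 <= r -> eucl2 p <= r ^+ 2 ->
  forall j, crect (- r) r (- r) r (p ord0 j).
Proof.
move=> r0 pr j; have : normc (p ord0 j) <= r.
  by rewrite -ler_sqr ?nnegrE ?normc_ge0// (le_trans (coord_le_eucl2 _ _)).
move=> H; split; rewrite -ler_norml; first exact: le_trans (abs_Re_le _) H.
exact: le_trans (abs_Im_le _) H.
Qed.

(** The cross term is written as a real linear form in the real and imaginary parts of [h], whose
    circle means [circle_mean] gives when [h] is holomorphic. *)
Lemma eucl2B (p h : Cn R d) : eucl2 (p - h) = eucl2 p + eucl2 h +
  \sum_(j < d) (-2 * complex.Re (p ord0 j) * complex.Re (h ord0 j)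
              + -2 * complex.Im (p ord0 j) * complex.Im (h ord0 j)).
Proof.
rewrite !eucl2E -!big_split /=; apply: eq_bigr => j _.
by rewrite !mxE !normc_sqr ReD ReN ImD ImN; ring.
Qed.

Lemma continuous_affine (z b : Cn R d) : continuous (fun l : Cx R => z + l *: b).
Proof.
move=> l; apply/continuous_nrmP => e e0.
have b0 : 0 < nrm b + 1 by rewrite ltr_wpDl ?nrm_ge0.
exists (e / (nrm b + 1)) => [|m]; first by rewrite divr_gt0.
rewrite nrm_Cx ltr_pdivlMr// => H.
have -> : z + m *: b - (z + l *: b) = (m - l) *: b by rewrite scalerBl opprD addrACA subrr add0r.
by rewrite nrmZ (le_lt_trans _ H)// ler_wpM2l ?normc_ge0// lerDl.
Qed.

Lemma continuous_line (u : Cn R d -> R) (z b : Cn R d) (r : R) :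
  (forall t, {for z + circ 0 r t *: b, continuous u}) ->
  continuous (fun t => u (z + circ 0 r t *: b)).
Proof.
move=> uc t; apply: (@continuous_comp _ _ _ (fun t => z + (circ 0 r t : Cx R) *: b) u); last exact: uc.
apply: (@continuous_comp _ _ _ (circ 0 r : R -> Cx R) (fun l : Cx R => z + l *: b)).
  exact: continuous_circ.
exact: continuous_affine.
Qed.

End Comparison.

(** * A comparison principle along holomorphic curves *)

Section ComparisonPrinciple.
Variables (R : realType) (d : nat).

(** Compactness of the parameter set turns pointwise continuity into one radius valid along the
    whole curve; it fixes the range of the second variable in the doubling argument. *)
Lemma uniform_tube (K : set (Cx R)) (c : Cx R -> Cn R d) (u : Cn R d -> R)
    (U : set (Cn R d)) (m : R) : compact K -> continuous c -> open U -> 0 < m ->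
  (forall z, U z -> {for z, continuous u}) -> (forall l, K l -> U (c l)) ->
  exists2 rho : R, 0 < rho & forall p l, nrm p < rho -> K l ->
    U (c l + p) /\ `|u (c l + p) - u (c l)| < m.
Proof.
move=> /compact_near_coveringP Kc cc Uo m0 uc KU.
pose P (p : Cn R d) (l : Cx R) := U (c l + p) /\ `|u (c l + p) - u (c l)| < m.
have near0 l : K l -> \forall l' \near l & p \near (0 : Cn R d), P p l'.
  move=> Kl; have Ucl := KU l Kl.
  have m20 : 0 < m / 2 by rewrite divr_gt0.
  have /nbhs_nrmP[d1 d10 h1] : nbhs (c l) U by apply: open_nbhs_nbhs.
  have /continuous_nrm_absP/(_ _ m20)[d2 d20 h2] := uc _ Ucl.
  pose dd := Num.min d1 d2; have dd0 : 0 < dd by rewrite lt_min d10.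
  have dd20 : 0 < dd / 2 by rewrite divr_gt0.
  have /continuous_nrmP/(_ _ dd20)[d3 d30 h3] := cc l.
  exists ([set l' | nrm (l' - l) < d3], [set p | nrm (p - 0) < dd / 2]).
    by split; apply/nbhs_nrmP; [exists d3|exists (dd / 2)].
  move=> [l' p] [/= /h3 hl]; rewrite subr0 => hp.
  have n1 : nrm (c l' + p - c l) < dd.
    rewrite addrAC [dd]splitr; apply: le_lt_trans (nrmD _ _) _; exact: ltrD.
  have n2 : nrm (c l' - c l) < dd.
    by rewrite (lt_trans hl)// ltr_pdivrMr// ltr_pMr// ltr1n.
  move: n1 n2; rewrite !lt_min => /andP[/h1 U1 /h2 u1] /andP[_ /h2 u2].
  split => //.
  have -> : u (c l' + p) - u (c l') = (u (c l' + p) - u (c l)) - (u (c l') - u (c l)) by ring.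
  by rewrite [m]splitr; apply: le_lt_trans (ler_normB _ _) _; exact: ltrD.
have cov : nbhs (0 : Cn R d) [set p | K `<=` P p] by exact: Kc near0.
have [rho rho0 hrho] := (nbhs_nrmP _ _).1 cov.
exists rho => // p l pr Kl; apply: (hrho p _ l Kl).
by rewrite subr0.
Qed.

(* Doubling of variables.  If [u o c - q] has a positive maximum [m], maximise
   [u (c l + p) - q l - N |p|^2] over [l] in the rectangle and [p] in a small box; for
   [N] large the maximum is interior.  Moving [l] to [l + mu] and [p] to [p - h mu],
   where [h mu = c (l + mu) - c l - mu c' l], moves the argument of [u] along
   a complex line, where the sub-mean value property applies.  The penalty changes
   by [-2 Re <p, h mu> + |h mu|^2]: the first term has mean zero since [h] is
   holomorphic and vanishes at [0], the second is [O (|mu|^4)]. *)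
Lemma psh_curve_comparison (u : Cn R d -> R) (U : set (Cn R d))
    (c c' : Cx R -> Cn R d) (q : Cx R -> R) (x1 x2 y1 y2 kappa : R) :
  open U -> psh_on u U -> (forall z, U z -> {for z, continuous u}) ->
  continuous c ->
  (forall l j, cderiv (fun m => c m ord0 j) l (c' l ord0 j)) ->
  continuous q -> 0 < kappa ->
  (forall l : Cx R, x1 < complex.Re l < x2 -> y1 < complex.Im l < y2 ->
     exists2 r0 : R, 0 < r0 & forall r, 0 < r < r0 ->
       cint (fun t => q (circ l r t)) <= 2 * pi * q l - kappa * r ^+ 2) ->
  (forall l, crect x1 x2 y1 y2 l -> U (c l)) ->
  (forall l, crect x1 x2 y1 y2 l ->
     [\/ complex.Re l = x1, complex.Re l = x2, complex.Im l = y1 | complex.Im l = y2] ->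
     u (c l) <= q l) ->
  forall l, crect x1 x2 y1 y2 l -> u (c l) <= q l.
Proof.
move=> Uo upsh uc cc cd qc k0 qmean KU bdry l1 Kl1.
set K := crect x1 x2 y1 y2 in KU bdry Kl1 *.
have Kc : compact K by exact: compact_crect.
rewrite leNgt; apply/negP => m0; rewrite -subr_gt0 in m0.
set m := u (c l1) - q l1 in m0.
have m20 : 0 < m / 2 by rewrite divr_gt0.
have [rho2 rho20 tube] := uniform_tube Kc cc Uo m20 uc KU.
(* A point of the box of half-side [rho] has norm at most [2 rho], below [rho2]. *)
pose rho := rho2 / 4; have rho0 : 0 < rho by rewrite divr_gt0.
pose P := [set p : Cn R d | forall j, crect (- rho) rho (- rho) rho (p ord0 j)].
have {}tube p l : P p -> K l -> U (c l + p) /\ `|u (c l + p) - u (c l)| < m / 2.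
  move=> Pp; apply: tube; apply: le_lt_trans (box_nrm (ltW rho0) Pp) _.
  by rewrite /rho; lra.
have uccont l : K l -> {for l, continuous (u \o c)}.
  by move=> /KU Ul; apply: continuous_comp; [exact: cc|exact: uc].
have [|S S0 hS] := @compact_bound R (Cx R) K (fun l => u (c l) - q l) Kc.
  by move=> l Kl; exact: (@cvgB _ _ _ _ _ (u \o c) q _ _ (uccont l Kl) (qc l)).
(* With [N rho^2 = S + m], a point with [|p| >= rho] has [Phi < S + m / 2 - (S + m) < 0], whereas
   the maximum is at least [m]. *)
pose N := (S + m) / rho ^+ 2.
have rho2_0 : 0 < rho ^+ 2 by rewrite exprn_gt0.
have N0 : 0 < N by rewrite divr_gt0// ltr_wpDl.
pose Phi (x : Cn R d * Cx R) := u (c x.2 + x.1) - q x.2 - N * eucl2 x.1.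
have P0 : P 0 by apply: eucl2_box; rewrite ?eucl2_0// ltW.
have [||[p l] /set_mem [/= Pp Kl] pmax] :=
    @compact_EVT_max _ _ Phi (P `*` K) _ (compact_setX (@compact_box R d rho) Kc).
- by exists (0, l1).
- apply: continuous_in_subspaceT => -[p l] /set_mem [/= Pp Kl].
  have [Ul _] := tube p l Pp Kl.
  have c2 : {for (p, l), continuous (fun x : Cn R d * Cx R => x.2)} by exact: cvg_snd.
  have c1 : {for (p, l), continuous (fun x : Cn R d * Cx R => x.1)} by exact: cvg_fst.
  apply: cvgB; first apply: cvgB.
  + apply: (@continuous_comp _ _ _ (fun x : Cn R d * Cx R => c x.2 + x.1) u); last exact: uc.
    apply: (@cvgD _ (Cn R d)); last exact: c1.
    exact: (@continuous_comp _ _ _ (fun x : Cn R d * Cx R => x.2) c (p, l) c2 (cc l)).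
  + exact: (@continuous_comp _ _ _ (fun x : Cn R d * Cx R => x.2) q (p, l) c2 (qc l)).
  + apply: cvgM; first exact: cvg_cst.
    exact: (@continuous_comp _ _ _ (fun x : Cn R d * Cx R => x.1) (@eucl2 R d) (p, l) c1 (@continuous_eucl2 R d p)).
have {}pmax p' l' : P p' -> K l' -> Phi (p', l') <= Phi (p, l).
  by move=> Pp' Kl'; apply: pmax; rewrite inE.
have mle : m <= Phi (p, l).
  have := pmax 0 l1 P0 Kl1; apply: le_trans.
  by rewrite /Phi /= addr0 eucl2_0 mulr0 subr0.
have [Ul ul] := tube p l Pp Kl.
have ul' : u (c l + p) < u (c l) + m / 2.
  by move: ul; rewrite ltr_distl => /andP[_].
have pint : eucl2 p < rho ^+ 2.
  rewrite ltNge; apply/negP => ple.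
  have : N * rho ^+ 2 <= N * eucl2 p by rewrite ler_pM2l.
  rewrite divfK ?gt_eqF// => NS; have := hS l Kl.
  by move: mle; rewrite /Phi /=; lra.
(* On the sides [u (c l) <= q l], so [Phi] is below [m / 2] there. *)
have lint : (x1 < complex.Re l < x2) /\ (y1 < complex.Im l < y2).
  have nb : ~ [\/ complex.Re l = x1, complex.Re l = x2, complex.Im l = y1 | complex.Im l = y2].
    move=> /(bdry l Kl) uq; have : 0 <= N * eucl2 p by rewrite mulr_ge0 ?eucl2_ge0// ltW.
    by move: mle; rewrite /Phi /=; lra.
  have [/andP[a1 a2] /andP[b1 b2]] := Kl.
  by rewrite !lt_neqAle a1 a2 b1 b2 !andbT; split; apply/andP; split; apply/eqP => E; apply: nb;
    [constructor 1|constructor 2|constructor 3|constructor 4].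
pose b := c' l; pose h (mu : Cx R) : Cn R d := c (l + mu) - c l - mu *: b.
have [C C0 hC] : exists2 C, 0 <= C & forall mu j, normc mu <= 1 ->
    normc (h mu ord0 j) <= C * normc mu ^+ 2.
  have /choice[Cj hCj] (j : 'I_d) : exists C, 0 <= C /\ forall mu, normc mu <= 1 ->
      normc (h mu ord0 j) <= C * normc mu ^+ 2.
    have [C C0 hC] := @entire_second_order R (fun m => c m ord0 j) (fun m => c' m ord0 j) l
      (fun z => cd z j).
    by exists C; split => // mu /hC; rewrite !mxE [mu * _]mulrC.
  exists (\sum_j Cj j); first by apply: sumr_ge0 => j _; exact: (hCj j).1.
  move=> mu j mu1; apply: le_trans ((hCj j).2 mu mu1) _; rewrite ler_wpM2r ?sqr_ge0//.
  by rewrite (bigD1 j)//= lerDl; apply: sumr_ge0 => i _; exact: (hCj i).1.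
have hnrm mu : normc mu <= 1 -> nrm (h mu) <= C * normc mu ^+ 2.
  by move=> mu1; apply: nrm_le_coord => [|j]; [rewrite mulr_ge0 ?sqr_ge0|exact: hC].
have [e1 e10 he1] : exists2 e, 0 < e & forall p', nrm (p' - p) < e -> P p'.
  have gap : 0 < rho ^+ 2 - eucl2 p by rewrite subr_gt0.
  have /continuous_nrm_absP/(_ _ gap)[e e0 he] := @continuous_eucl2 R d p.
  exists e => // p' /he; rewrite ltr_distl => /andP[_]; rewrite addrC subrK => H.
  by apply: eucl2_box; exact: ltW.
have [r0 r00 hr0] := qmean l lint.1 lint.2.
move: lint => [/andP[a1 a2] /andP[b1 b2]].
pose s := Num.min (Num.min 1 r0) (Num.min (Num.min (complex.Re l - x1) (x2 - complex.Re l))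
   (Num.min (complex.Im l - y1) (y2 - complex.Im l))).
have s0 : 0 < s by rewrite !lt_min ltr01 r00 !subr_gt0 a1 a2 b1 b2.
have [r [r_gt0 rs rC rk]] : exists r, [/\ 0 < r, r < s, C * r ^+ 2 < e1 &
    2 * pi * N * (d%:R * C ^+ 2) * r ^+ 2 < kappa].
  (* [B] adds up the inverses of both thresholds on the square of the radius. Since [B >= 1], the
     condition [t B < 1] also gives [t ^+ 2 <= t], hence both conditions. *)
  pose B := C / e1 + 2 * pi * N * (d%:R * C ^+ 2) / kappa + 1.
  have B0 : 0 <= C / e1 by rewrite divr_ge0// ltW.
  have W0 : 0 <= 2 * pi * N * (d%:R * C ^+ 2).
    apply: mulr_ge0; first by rewrite mulr_ge0 ?(ltW (pi2_gt0 R))// ltW.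
    by rewrite mulr_ge0 ?ler0n ?sqr_ge0.
  have B1 : 0 <= 2 * pi * N * (d%:R * C ^+ 2) / kappa by rewrite divr_ge0// ltW.
  have Bgt : 1 <= B by rewrite /B lerDr addr_ge0.
  have Bp : 0 < B by exact: lt_le_trans Bgt.
  pose t := Num.min (s / 2) (1 / (2 * B)).
  have t0 : 0 < t by rewrite lt_min !divr_gt0// mulr_gt0.
  have ts : t < s.
    by rewrite gt_min ltr_pdivrMr// ltr_pMr// ltr1n.
  have tB : t * B < 1.
    rewrite -ltr_pdivlMr//; apply: (@le_lt_trans _ _ (1 / (2 * B))); first by rewrite ge_min lexx orbT.
    by rewrite ltr_pM2l// ltf_pV2 ?posrE ?mulr_gt0// ltr_pMl// ltr1n.
  have t1 : t <= 1.
    have : t * 1 <= t * B by rewrite ler_pM2l.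
    by rewrite mulr1 => /le_trans; apply; exact: ltW.
  have tt : t ^+ 2 <= t by rewrite expr2 ler_piMl// ltW.
  exists t; split => //.
    apply: le_lt_trans (ler_wpM2l C0 tt) _.
    have : t * (C / e1) < 1.
      by apply: le_lt_trans tB; rewrite ler_wpM2l ?(ltW t0)// /B -addrA lerDl addr_ge0.
    by rewrite mulrA ltr_pdivrMr// mul1r mulrC.
  set W := 2 * pi * N * (d%:R * C ^+ 2) in W0 B1 *.
  apply: le_lt_trans (ler_wpM2l W0 tt) _.
  have : t * (W / kappa) < 1.
    apply: le_lt_trans tB; rewrite ler_wpM2l ?(ltW t0)// /B addrAC lerDr.
    by rewrite addr_ge0.
  by rewrite mulrA ltr_pdivrMr// mul1r mulrC.
move: rs; rewrite !lt_min => /andP[/andP[r1 rr0] /andP[/andP[ra1 ra2] /andP[rb1 rb2]]].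
have Kmu mu : normc mu <= r -> K (l + mu).
  move=> mur; have := le_trans (abs_Re_le mu) mur; have := le_trans (abs_Im_le mu) mur.
  rewrite !ler_norml => /andP[i1 i2] /andP[j1 j2]; rewrite /K /crect /= ReD ImD.
  by split; apply/andP; split; lra.
have Pmu mu : normc mu <= r -> P (p - h mu).
  move=> mur; apply: he1; rewrite addrAC subrr add0r nrmN.
  apply: le_lt_trans (hnrm mu (le_trans mur (ltW r1))) _; apply: le_lt_trans rC.
  by rewrite ler_wpM2l// ler_sqr ?nnegrE ?normc_ge0// ltW.
have zmu mu : c (l + mu) + (p - h mu) = c l + p + mu *: b.
  by rewrite /h opprB opprB addrC !addrA subrK addrC addrA.
pose mu t : Cx R := circ 0 r t.
have nmu t : normc (mu t) = r.
  by have := @normc_circ R 0 r t (ltW r_gt0); rewrite subr0.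
have nmu_le t : normc (mu t) <= r by rewrite nmu.
have qmu t : q (l + mu t) = q (circ l r t) by rewrite /mu /circ add0r.
pose lin t := \sum_(j < d) (-2 * complex.Re (p ord0 j) * complex.Re (h (mu t) ord0 j)
              + -2 * complex.Im (p ord0 j) * complex.Im (h (mu t) ord0 j)).
have bound t : u (c l + p + mu t *: b) <=
    (u (c l + p) - q l + N * (d%:R * C ^+ 2) * r ^+ 4) + (q (circ l r t) + N * lin t).
  have H := pmax (p - h (mu t)) (l + mu t).
  have {}H := H (Pmu _ (nmu_le t)) (Kmu _ (nmu_le t)).
  move: H; rewrite /Phi /= zmu qmu eucl2B -/(lin t).
  have hh : N * eucl2 (h (mu t)) <= N * (d%:R * C ^+ 2) * r ^+ 4.
    rewrite -mulrA ler_pM2l//; apply: le_trans (eucl2_le_nrm2 _) _; rewrite -mulrA ler_wpM2l//.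
    have := hnrm (mu t); rewrite nmu => /(_ (ltW r1)) => H.
    by rewrite (_ : 4 = 2 * 2)%N// exprM -exprMn ler_sqr ?nnegrE ?nrm_ge0// mulr_ge0// sqr_ge0.
  by rewrite !mulrDr; lra.
have uline : continuous (fun t => u (c l + p + mu t *: b)).
  apply: continuous_line => t; apply: uc; rewrite -/(mu t) -zmu.
  by apply: (tube _ _ _ _).1; [apply: Pmu|apply: Kmu]; rewrite nmu.
have qline : continuous (fun t => q (circ l r t)).
  move=> t; apply: (@continuous_comp _ _ _ (circ l r : R -> Cx R) q); last exact: qc.
  exact: continuous_circ.
have hd j z : cderiv (fun z => h z ord0 j) z (c' (l + z) ord0 j - b ord0 j).
  apply: (@cderiv_ext _ (fun z => c (l + z) ord0 j - c l ord0 j - b ord0 j * z)).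
    by move=> w; rewrite !mxE [w * _]mulrC.
  apply: cderiv_eq (cderivB (cderivB (cderiv_shift (cd _ j)) (cderiv_cst _ z))
     (cderivZ (b ord0 j) (cderiv_id z))) _.
  by rewrite subr0 mulr1.
have h0 : h 0 = 0 by rewrite /h addr0 subrr scale0r subr0.
have hcont j : continuous (fun t => complex.Re (h (mu t) ord0 j)) /\
    continuous (fun t => complex.Im (h (mu t) ord0 j)).
  have hc t : {for t, continuous (fun t => (h (mu t) ord0 j : Cx R))}.
    apply: (@continuous_comp _ _ _ (circ 0 r : R -> Cx R) (fun z : Cx R => h z ord0 j : Cx R)).
      exact: continuous_circ.
    exact: cderiv_continuous_Cx (hd j _).
  split => t.
    exact: (@continuous_comp _ _ _ _ (fun z : Cx R => complex.Re z) _ (hc t) (@continuous_Re R _)).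
  exact: (@continuous_comp _ _ _ _ (fun z : Cx R => complex.Im z) _ (hc t) (@continuous_Im R _)).
have term_cont j : continuous (fun t =>
    -2 * complex.Re (p ord0 j) * complex.Re (h (mu t) ord0 j)
    + -2 * complex.Im (p ord0 j) * complex.Im (h (mu t) ord0 j)).
  have [cr ci] := hcont j.
  by move=> t; apply: cvgD; (apply: cvgM; first exact: cvg_cst); [exact: cr|exact: ci].
have linc : continuous lin by move=> t; apply: continuous_sumR => j; exact: term_cont.
have lin0 : cint lin = 0.
  rewrite /lin cint_sum// big1// => j _; have [cr ci] := hcont j.
  rewrite cintD; last 2 first.
  - by move=> t; apply: cvgM; [exact: cvg_cst|exact: cr].
  - by move=> t; apply: cvgM; [exact: cvg_cst|exact: ci].
  rewrite !cintZ//.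
  have [|-> ->] := @circle_mean R (fun z => h z ord0 j) 0 (r + 1) r r_gt0 (ltr_pwDr ltr01 (lexx r)).
    by move=> z _; exists (c' (l + z) ord0 j - b ord0 j).
  by rewrite h0 mxE /= !mulr0 addr0.
have sub : 2 * pi * u (c l + p) <= cint (fun t => u (c l + p + mu t *: b)).
  rewrite -lee_fin -cintE//.
  have /= := upsh (c l + p) b 0 r r_gt0; rewrite scale0r addr0; apply.
  move=> z; rewrite subr0 normcE lecR => zr.
  by rewrite -zmu; apply: (tube _ _ _ _).1; [exact: Pmu|exact: Kmu].
have {}bound := @le_cint R _ _ uline _ bound.
have := hr0 r; rewrite r_gt0 rr0 => /(_ isT) => qm.
have c1 : continuous (fun t => q (circ l r t) + N * lin t).
  move=> t; apply: cvgD; first exact: qline.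
  by apply: cvgM; [exact: cvg_cst|exact: linc].
have Nlin : continuous (fun t => N * lin t).
  by move=> t; apply: cvgM; [exact: cvg_cst|exact: linc].
have c0 (x : R) : continuous (fun _ : R => x) by move=> t; exact: cvg_cst.
have c2 (x : R) : continuous (fun t => x + (q (circ l r t) + N * lin t)).
  by move=> t; apply: cvgD; [exact: c0|exact: c1].
have := bound (c2 _).
rewrite (cintD (c0 _) c1) (cintD qline Nlin).
rewrite cintZ// lin0 mulr0 addr0 cint_cst => bnd.
(* The loss in the mean of [q] would be covered by an error of order [r^4], which the choice of [r]
   excludes. *)
have : kappa * r ^+ 2 <= 2 * pi * N * (d%:R * C ^+ 2) * r ^+ 2 * r ^+ 2.
  have -> : 2 * pi * N * (d%:R * C ^+ 2) * r ^+ 2 * r ^+ 2 =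
    2 * pi * (N * (d%:R * C ^+ 2) * r ^+ 4) by ring.
  move: sub bnd qm; move: (2 * pi : R) => w.
  by move=> s1 s2 s3; lra.
by rewrite ler_pM2r ?exprn_gt0// leNgt rk.
Qed.

End ComparisonPrinciple.

(** * The flow *)

Section HolomorphicMaps.
Variables (R : realType) (d : nat).

Lemma differentiable_cderiv (f : Cx R -> Cx R) (z : Cx R) :
  differentiable f z -> exists l, cderiv f z l.
Proof.
move=> /(@derivable1_diffP R[i] (Cx R) f)/derivableP fd.
by exists ('D_1 f z); apply/cderivP.
Qed.

Lemma is_derive_coord (f : Cx R -> Cn R d) (l : Cx R) (v : Cn R d) (j : 'I_d) :
  is_derive l (1 : Cx R) f v -> cderiv (fun m => f m ord0 j) l (v ord0 j).
Proof.
move=> /(@is_derive_epsP R[i] (Cn R d)) H e e0.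
have [|dd] := H e%:C; first by rewrite ltcR.
move=> /gt0_real[x x0 ->] hd; exists x => // h hx.
have := hd h; rewrite normcE ltcR => /(_ hx).
rewrite nrmE -rmorphM lecR; apply: le_trans.
by have := normc_coord_le (f (l + h) - f l - h *: v) j; rewrite !mxE [h * _]mulrC.
Qed.

Lemma is_derive_continuous (f : Cx R -> Cn R d) (l : Cx R) (v : Cn R d) :
  is_derive l (1 : Cx R) f v -> differentiable f l.
Proof. by move=> [fd _]; apply/(@derivable1_diffP R[i] (Cn R d) f). Qed.

Lemma differentiable_affine (W : normedModType R[i]) (p b : W) (z : Cx R) :
  differentiable (fun l : Cx R => p + l *: b) z.
Proof.
apply: (@differentiableD _ _ _ (cst p) (fun l : Cx R => l *: b)).
  exact: differentiable_cst.
by apply: ex_diff.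
Qed.

Lemma slice_cderiv (f : Cn R d -> Cx R) (p b : Cn R d) (z : R[i]) :
  differentiable f (p + z *: b) -> exists l, cderiv (fun w => f (p + w *: b)) z l.
Proof.
move=> fd; apply: (@differentiable_cderiv (fun w => f (p + w *: b))).
exact: (@differentiable_comp _ _ _ _ (fun l : Cx R => p + l *: b) f _ (@differentiable_affine _ p b z) fd).
Qed.

(** Restrict [f] to the complex line through [q] and [p]. The radius [1 / |p - q|] in the parameter
    is a displacement of size 1 in space, so one bound on the ball of radius [rho + 1] serves all
    pairs. *)
Lemma entire_locally_lipschitz (f : Cn R d -> Cx R) (rho : R) :
  (forall z, differentiable f z) -> 0 <= rho ->
  exists2 L, 0 <= L & forall p q, nrm p <= rho -> nrm q <= rho ->
    normc (f p - f q) <= L * nrm (p - q).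
Proof.
move=> fd rho0.
have [|M M0 hM] := @compact_bound R _ _ (fun z => normc (f z)) (@compact_box R d (rho + 1)).
  move=> z _; apply/continuous_nrm_absP => e e0.
  have /continuous_nrmP/(_ _ e0)[dd dd0 hd] : {for z, continuous f}.
    exact: differentiable_continuous.
  exists dd => // y /hd; rewrite nrm_Cx; apply: le_lt_trans.
  rewrite ler_norml lerBlDr; apply/andP; split.
    rewrite lerNl opprB lerBlDr normc_distC.
    by rewrite -[X in normc X <= _](subrK (f y)) normcD.
  by rewrite -[X in normc X <= _](subrK (f z)) normcD.
have {}hM z : nrm z <= rho + 1 -> normc (f z) <= M.
  move=> zr; apply: hM => j; have cz := le_trans (normc_coord_le z j) zr.
  by split; rewrite -ler_norml; [exact: le_trans (abs_Re_le _) cz|exact: le_trans (abs_Im_le _) cz].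
exists (16 * M) => [|p q pr qr]; first by rewrite mulr_ge0.
have [pq0|pq0] := ltP 0 (nrm (p - q)); last first.
  have /eqP : nrm (p - q) = 0 by apply/eqP; rewrite eq_le pq0 nrm_ge0.
  rewrite nrm_eq0 subr_eq0 => /eqP ->.
  by rewrite !subrr Normc.normc0 nrm0 mulr0.
have := @cauchy_lipschitz R (fun w => f (q + w *: (p - q))) 0 1 (nrm (p - q))^-1 M.
rewrite invrK invr_gt0 pq0 scale1r scale0r addr0 subr0 Normc.normc1 mulr1.
rewrite [q + _]addrC subrK; apply => // t z /andP[t0 t1]; rewrite add0r mulr1 => zt.
split; first exact: slice_cderiv.
apply: hM.
have -> : q + z *: (p - q) = (((1 - t)%:C : Cx R) *: q + (t%:C : Cx R) *: p) + (z - t%:C) *: (p - q).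
  rewrite rmorphB /= !scalerBl !scalerBr scale1r.
  set a := z *: p; set b := z *: q; set c := _ *: q; set e := _ *: p.
  by rewrite [q - c + e]addrAC -[q + e - c]addrA -[q + (e - c) + _]addrA [e - c + _]addrC subrK.
apply: le_trans (nrmD _ _) _; apply: lerD; last first.
  by rewrite nrmZ -ler_pdivlMr// div1r ltW.
apply: le_trans (nrmD _ _) _; rewrite !nrmZ !normc_real !ger0_norm ?subr_ge0//.
have -> : rho = (1 - t) * rho + t * rho by ring.
by apply: lerD; rewrite ler_wpM2l// subr_ge0.
Qed.

End HolomorphicMaps.

(** * Gronwall's inequality below a barrier *)

Section Gronwall.
Variable R : realType.

(** The differential inequality is assumed only while [N < B], since it comes from a local Lipschitz
    constant. As long as it holds, [N t exp (- K t)] does not increase, and so never reaches the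
    barrier. *)
Lemma gronwall (N N' : R -> R) (K B : R) : 0 <= K ->
  (forall t : R, is_derive t (1 : R) N (N' t)) -> (forall t, 0 <= N t) ->
  (forall t, 0 <= t <= 1 -> N t < B -> N' t <= K * N t) ->
  N 0 * expR K < B ->
  N 1 <= N 0 * expR K.
Proof.
move=> K0 Nd N0 NK NB.
pose M t := N t * expR (- K * t).
have Md (t : R) : is_derive t (1 : R) M ((N' t - K * N t) * expR (- K * t)).
  have ed : is_derive t (1 : R) (fun t : R => expR (- K * t)) (- K * expR (- K * t)).
    rewrite mulrC; apply: (@is_derive1_comp R (@expR R) (fun t => - K * t)).
    apply/rderivP => e e0; exists 1 => // h _.
    rewrite (_ : - K * (t + h) - - K * t - - K * h = 0); last by ring.
    by rewrite normr0 mulr_ge0// ltW.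
  apply: is_derive_eq (is_deriveM (Nd t) ed) _.
  rewrite -![_ *: _]/(_ * _); ring.
have Mc : continuous M by move=> t; exact: derivable_continuous_pt (Md t).
have M0 : M 0 = N 0 by rewrite /M mulr0 expR0 mulr1.
have NM t : N t = M t * expR (K * t).
  by rewrite /M -mulrA -expRD mulNr addNr expR0 mulr1.
have eK t : 0 <= t <= 1 -> expR (K * t) <= expR K.
  by move=> /andP[t0 t1]; rewrite ler_expR ler_piMr.
have lt_B t : 0 <= t <= 1 -> M t < B / expR K -> N t < B.
  move=> t01 Mt; rewrite NM; apply: (@le_lt_trans _ _ (M t * expR K)).
    by rewrite ler_wpM2l ?eK// mulr_ge0// expR_ge0.
  by rewrite -ltr_pdivlMr ?expR_gt0.
have decr c : 0 < c -> c <= 1 -> (forall t, 0 <= t < c -> M t < B / expR K) -> M c <= M 0.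
  move=> c0 c1 Mlt.
  have [|x] := @MVT R M (fun t => (N' t - K * N t) * expR (- K * t)) 0 c c0.
    exact: continuous_subspaceT.
  rewrite in_itv /= subr0 => /andP[x0 xc] E.
  rewrite -subr_le0 E pmulr_lle0// pmulr_lle0 ?expR_gt0// subr_le0.
  have x01 : 0 <= x <= 1 by rewrite (ltW x0) (le_trans (ltW xc)).
  by apply: NK => //; apply: lt_B => //; apply: Mlt; rewrite (ltW x0).
have Mlt t : 0 <= t <= 1 -> M t < B / expR K.
  move=> t01; rewrite ltNge; apply/negP => Mt.
  (* The least element of [S] is the first crossing time; up to it [M] does not increase, so it
     cannot have risen to the barrier. *)
  pose S := `[0, 1]%classic `&` (M @^-1` [set y | B / expR K <= y]).
  have Sc : compact S.
    apply: compact_closedI; first exact: segment_compact.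
    apply: closed_comp; first by move=> ? _; exact: Mc.
    exact: closed_ge.
  have S0 : S !=set0 by exists t; split => //=; rewrite in_itv.
  have [|c] := @compact_EVT_min _ R id S S0 Sc.
    by apply: continuous_subspaceT => x; exact: cvg_id.
  rewrite inE => -[/=]; rewrite in_itv /= => /andP[c0 c1] Mcge cmin.
  move: c0; rewrite le_eqVlt => /orP[/eqP c0|c0].
    by move: Mcge; rewrite -c0 M0 leNgt ltr_pdivlMr ?expR_gt0// NB.
  have := decr c c0 c1; rewrite leNgt => H.
  have : M 0 < M c.
    by apply: lt_le_trans Mcge; rewrite M0 ltr_pdivlMr ?expR_gt0.
  apply/negP; apply: H => s /andP[s0 sc]; rewrite ltNge; apply/negP => Ms.
  have : s \in S by rewrite inE; split => //=; rewrite in_itv /= s0 (le_trans (ltW sc)).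
  by move=> /cmin; rewrite leNgt sc.
rewrite NM mulr1 -M0 ler_pM2r ?expR_gt0//; apply: decr => // t /andP[t0 t1].
by apply: Mlt; rewrite t0 ltW.
Qed.

End Gronwall.

(** * Uniqueness, group law and continuous dependence *)

Section Flow.
Variables (R : realType) (d : nat) (V : Cn R d -> Cn R d) (X : Cx R -> Cn R d -> Cn R d).
Hypothesis V_holo : forall z, differentiable V z.
Hypothesis X_0 : forall z, X 0 z = z.
Hypothesis X_ode : forall (l : Cx R) z, is_derive l (1 : Cx R) (fun m => X m z) (V (X l z)).

Lemma flow_cderiv (z : Cn R d) (l : R[i]) (j : 'I_d) :
  cderiv (fun m => X m z ord0 j) l (V (X l z) ord0 j).
Proof. exact: is_derive_coord. Qed.

Lemma flow_differentiable (z : Cn R d) (l : Cx R) : differentiable (fun m => X m z) l.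
Proof. exact: is_derive_continuous (X_ode l z). Qed.

Lemma flow_continuous (z : Cn R d) : continuous (fun m => X m z).
Proof. by move=> l; apply: differentiable_continuous; exact: flow_differentiable. Qed.

Lemma nrm_continuous (W : normedModType R[i]) : continuous (@nrm R W).
Proof.
move=> z; apply/continuous_nrm_absP => e e0; exists e => // y; apply: le_lt_trans.
rewrite ler_norml lerBlDr; apply/andP; split.
  rewrite lerNl opprB lerBlDr nrm_distC.
  by rewrite -[X in nrm X <= _](subrK y) nrmD.
by rewrite -[X in nrm X <= _](subrK z) nrmD.
Qed.

Lemma flow_bounded (z : Cn R d) (T : R) :
  exists2 M, 0 <= M & forall l, normc l <= T -> nrm (X l z) <= M.
Proof.
have [|M M0 hM] := @compact_bound R _ _ (fun l => nrm (X l z)) (@compact_crect R (- T) T (- T) T).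
  move=> l _; apply: (@continuous_comp _ _ _ (fun m => X m z) (@nrm R _)).
    exact: flow_continuous.
  exact: nrm_continuous.
exists M => // l lT; apply: hM; split; rewrite -ler_norml.
  exact: le_trans (abs_Re_le _) lT.
exact: le_trans (abs_Im_le _) lT.
Qed.

Lemma field_locally_lipschitz (rho : R) : 0 <= rho ->
  exists2 L, 0 <= L & forall p q, nrm p <= rho -> nrm q <= rho -> forall j,
    normc (V p ord0 j - V q ord0 j) <= L * nrm (p - q).
Proof.
move=> rho0.
have /choice[L hL] (j : 'I_d) : exists L, 0 <= L /\ forall p q, nrm p <= rho -> nrm q <= rho ->
    normc (V p ord0 j - V q ord0 j) <= L * nrm (p - q).
  have [|L L0 hL] := @entire_locally_lipschitz R d (fun z => V z ord0 j) rho _ rho0.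
    move=> z; apply: (@differentiable_comp _ _ _ _ V (fun w : Cn R d => w ord0 j : Cx R)) => //.
    exact: differentiable_coord.
  by exists L.
exists (\sum_j L j); first by apply: sumr_ge0 => j _; exact: (hL j).1.
move=> p q pr qr j; apply: le_trans ((hL j).2 p q pr qr) _.
rewrite ler_wpM2r ?nrm_ge0// (bigD1 j)//= lerDl.
by apply: sumr_ge0 => i _; exact: (hL i).1.
Qed.

(** Real time from 0 to 1 runs through the complex times from 0 to [l]: the complex flow is studied
    as the real flow of the field [l V]. *)
Definition integral_curve (l : R[i]) (phi : R -> Cn R d) :=
  forall (t : R) j, rcderiv (fun s => phi s ord0 j) t (V (phi t) ord0 j * l).

Lemma flow_integral_curve (m l : Cx R) (z : Cn R d) :
  integral_curve l (fun t => X (m + t%:C * l) z).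
Proof. by move=> t j; apply: (rcderiv_line (f := fun m => X m z ord0 j)); exact: flow_cderiv. Qed.

(** Gronwall's inequality with barrier 1 for the squared distance: below it, the bound on [psi]
    keeps both curves in the ball of radius [rho + 1], where [V] is Lipschitz. [K] sums over [d]
    coordinates two products, each at most [2 L T] times the squared distance. *)
Lemma integral_curve_dependence (rho T : R) : 0 <= rho -> 0 <= T ->
  exists2 K : R, 0 <= K & forall l phi psi, normc l <= T ->
    integral_curve l phi -> integral_curve l psi ->
    (forall t, 0 <= t <= 1 -> nrm (psi t) <= rho) ->
    eucl2 (phi 0 - psi 0) * expR K < 1 ->
    eucl2 (phi 1 - psi 1) <= eucl2 (phi 0 - psi 0) * expR K.
Proof.
move=> rho0 T0; have [|L L0 hL] := @field_locally_lipschitz (rho + 1); first by rewrite addr_ge0.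
pose K := 4 * d%:R * L * T; have K0 : 0 <= K by rewrite !mulr_ge0.
exists K => // l phi psi lT phid psid psib close.
pose D t j : R[i] := phi t ord0 j - psi t ord0 j.
pose D' t j : R[i] := V (phi t) ord0 j * l - V (psi t) ord0 j * l.
have Dd t j : rcderiv (fun s => D s j) t (D' t j) by apply: rcderivB; [exact: phid|exact: psid].
pose N' t := \sum_(j < d) (complex.Re (D t j) * complex.Re (D' t j) * 2
                         + complex.Im (D t j) * complex.Im (D' t j) * 2).
have NE t : eucl2 (phi t - psi t) = \sum_(j < d) (complex.Re (D t j) * complex.Re (D t j) + complex.Im (D t j) * complex.Im (D t j)).
  by rewrite eucl2E; apply: eq_bigr => j _; rewrite normc_sqr !mxE !expr2.
have Nd (t : R) : is_derive t (1 : R) (fun t => eucl2 (phi t - psi t)) (N' t).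
  rewrite (_ : (fun t => _) = \sum_(j < d) (fun t => complex.Re (D t j) * complex.Re (D t j) + complex.Im (D t j) * complex.Im (D t j))).
    apply: is_derive_sum => j; have [dr di] := Dd t j.
    apply: is_deriveD.
      apply: is_derive_eq (is_deriveM dr dr) _.
      by rewrite -![_ *: _]/(_ * _); ring.
    apply: is_derive_eq (is_deriveM di di) _.
    by rewrite -![_ *: _]/(_ * _); ring.
  by apply/funext => s; rewrite NE fct_sumE.
apply: (@gronwall R (fun t => eucl2 (phi t - psi t)) N' K 1) => //.
  by move=> t; exact: eucl2_ge0.
move=> t t01 Nlt.
have dist : nrm (phi t - psi t) <= 1.
  by rewrite -[_ <= 1](@ler_sqr R) ?nnegrE ?nrm_ge0// expr1n (le_trans (nrm2_le_eucl2 _))// ltW.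
have psir : nrm (psi t) <= rho + 1 by rewrite (le_trans (psib t t01))// lerDl.
have phir : nrm (phi t) <= rho + 1.
  rewrite -(subrK (psi t) (phi t)) addrC (le_trans (nrmD _ _))// [X in _ <= X]addrC addrC.
  by apply: lerD => //; exact: psib.
have -> : K * eucl2 (phi t - psi t) = d%:R * (4 * L * T * eucl2 (phi t - psi t)).
  by rewrite /K; ring.
have -> : d%:R * (4 * L * T * eucl2 (phi t - psi t)) =
    \sum_(j < d) (4 * L * T * eucl2 (phi t - psi t)).
  by rewrite sumr_const card_ord mulr_natl.
apply: ler_sum => j _.
have D'le : normc (D' t j) <= L * T * nrm (phi t - psi t).
  rewrite /D' -mulrBl normcM mulrAC; apply: ler_pM; rewrite ?normc_ge0//.
  exact: hL.
have Dle : normc (D t j) <= nrm (phi t - psi t).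
  by have := normc_coord_le (phi t - psi t) j; rewrite !mxE.
have prod (x y : R) : `|x| <= normc (D t j) -> `|y| <= normc (D' t j) ->
    x * y * 2 <= 2 * L * T * eucl2 (phi t - psi t).
  move=> xD yD; have -> : 2 * L * T * eucl2 (phi t - psi t) = (L * T * eucl2 (phi t - psi t)) * 2 by ring.
  rewrite ler_pM2r//; apply: le_trans (ler_norm _) _; rewrite normrM.
  apply: (@le_trans _ _ (nrm (phi t - psi t) * (L * T * nrm (phi t - psi t)))).
    apply: ler_pM => //; [exact: le_trans xD Dle|exact: le_trans yD D'le].
  rewrite mulrCA -expr2 ler_wpM2l ?nrm2_le_eucl2// mulr_ge0//.
have -> : 4 * L * T * eucl2 (phi t - psi t) =
  2 * L * T * eucl2 (phi t - psi t) + 2 * L * T * eucl2 (phi t - psi t) by ring.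
by apply: lerD; apply: prod; [exact: abs_Re_le|exact: abs_Re_le|exact: abs_Im_le|exact: abs_Im_le].
Qed.

(** Both sides are end points of integral curves starting at [X m z]; with initial distance 0 the
    dependence estimate identifies them. *)
Lemma flowD (l m : Cx R) (z : Cn R d) : X (m + l) z = X l (X m z).
Proof.
have [rho rho0 hrho] := flow_bounded (X m z) (normc l).
have [K K0 hK] := integral_curve_dependence rho0 (normc_ge0 l).
have := hK l (fun t => X (m + t%:C * l) z) (fun t => X (0 + t%:C * l) (X m z)) (lexx _)
  (@flow_integral_curve m l z) (@flow_integral_curve 0 l (X m z)).
rewrite /= !mul0r !mul1r !addr0 !add0r X_0 subrr eucl2_0 mul0r ltr01 => H.
apply/eqP; rewrite -subr_eq0 -nrm_eq0 -sqrf_eq0 eq_le sqr_ge0 andbT.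
apply: le_trans (nrm2_le_eucl2 _) _; apply: H => // t /andP[t0 t1].
rewrite add0r; apply: hrho; rewrite normcM normc_real ger0_norm//.
by rewrite ler_piMl// normc_ge0.
Qed.

Lemma flow_dependence (w : Cn R d) (T e : R) : 0 <= T -> 0 < e ->
  exists2 dl : R, 0 < dl & forall w' l, nrm (w' - w) < dl -> normc l <= T ->
    nrm (X l w' - X l w) < e.
Proof.
move=> T0 e0; have [rho rho0 hrho] := flow_bounded w T.
have [K K0 hK] := integral_curve_dependence rho0 T0.
(* When [nrm (w' - w) < 1] the squared Euclidean distance is at most [d] times the norm; the added 1
   keeps [B] positive if [d = 0]. *)
pose B := (d%:R + 1) * expR K; have B0 : 0 < B by rewrite mulr_gt0 ?expR_gt0// ltr_wpDl.
pose eta := Num.min 1 (e ^+ 2); have eta0 : 0 < eta by rewrite lt_min ltr01 exprn_gt0.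
exists (Num.min 1 (eta / B)); first by rewrite lt_min ltr01 divr_gt0.
move=> w' l; rewrite lt_min => /andP[w1 wB] lT.
have small : eucl2 (w' - w) * expR K < eta.
  apply: (@le_lt_trans _ _ (nrm (w' - w) * B)); last by rewrite -ltr_pdivlMr.
  rewrite /B mulrA ler_pM2r ?expR_gt0//; apply: le_trans (eucl2_le_nrm2 _) _.
  rewrite mulrC mulrDr mulr1 expr2 -mulrA ler_wpDr ?nrm_ge0//.
  by rewrite ler_wpM2l ?nrm_ge0// ler_piMl ?ler0n// ltW.
have := hK l (fun t => X (0 + t%:C * l) w') (fun t => X (0 + t%:C * l) w) lT
  (@flow_integral_curve 0 l w') (@flow_integral_curve 0 l w).
rewrite /= !mul0r !mul1r !addr0 !add0r !X_0 => H.
have {}H : eucl2 (X l w' - X l w) <= eucl2 (w' - w) * expR K.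
  apply: H; last by move: small; rewrite lt_min => /andP[].
  move=> t /andP[t0 t1]; rewrite add0r; apply: hrho.
  by rewrite normcM normc_real ger0_norm// (le_trans _ lT)// ler_piMl// normc_ge0.
rewrite -ltr_sqr ?nnegrE ?nrm_ge0 ?(ltW e0)//.
apply: le_lt_trans (nrm2_le_eucl2 _) _; apply: le_lt_trans H _.
by move: small; rewrite lt_min => /andP[].
Qed.

End Flow.

(** * Unbounded domains *)

Lemma bounded_nrmP (R : realType) (W : normedModType R[i]) (D : set W) :
  bounded_set D <-> exists M, forall z, D z -> nrm z <= M.
Proof.
split=> [[M [Mr hM]]|[M hM]].
  exists (complex.Re M + 1) => z Dz; rewrite -lecR -nrmE; apply: hM => //.
  by rewrite -(RRe_real Mr) ltcR ltrDl.
exists M%:C; split; first by rewrite complex_real.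
move=> x Mx z Dz; rewrite /= nrmE; apply: le_trans (ltW Mx).
by rewrite lecR hM.
Qed.

Section EscapeLimit.
Variables (R : realType) (d : nat) (V : Cn R d -> Cn R d) (X : Cx R -> Cn R d -> Cn R d).
Variable D : set (Cn R d).
Hypothesis V_holo : forall z, differentiable V z.
Hypothesis X_0 : forall z, X 0 z = z.
Hypothesis X_ode : forall (l : Cx R) z, is_derive l (1 : Cx R) (fun m => X m z) (V (X l z)).
Hypothesis X_attr : forall z, X t%:C z @[t --> +oo] --> (0 : Cn R d).
Hypothesis D_open : open D.
Hypothesis D_0 : D 0.
Hypothesis D_spiral : forall (t : R) z, 0 <= t -> D z -> D (X t%:C z).
Hypothesis D_circ : forall (s : R) z, - (pi / 2) < s < pi / 2 -> D z -> D (X (0 +i* s) z).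

Lemma flow_attracted (z : Cn R d) (e : R) : 0 < e ->
  exists2 T, 0 < T & nrm (X T%:C z) < e.
Proof.
move=> e0; have n0 : nbhs (0 : Cn R d) [set y | nrm y < e].
  by apply/nbhs_nrmP; exists e => // y; rewrite subr0.
have [M [_ hM]] := X_attr z n0.
exists (Num.max 1 (M + 1)); first by rewrite lt_max ltr01.
by apply: hM; rewrite lt_max ltrDl ltr01 orbT.
Qed.

Lemma continuous_real_complex : continuous (fun t : R => t%:C : Cx R).
Proof. by move=> t; apply: continuous_ReIm; [exact: cvg_id|exact: cvg_cst]. Qed.

(** The imaginary time is cut into [n] equal steps shorter than [pi / 2], each allowed by
    circularlikeness; the real time [Re l >= 0] then follows by spirallikeness. *)
Lemma D_halfplane (l : Cx R) (z : Cn R d) : 0 <= complex.Re l -> D z -> D (X l z).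
Proof.
move=> l0 Dz; pose s := complex.Im l.
have -> : l = ((0 +i* s) + (complex.Re l)%:C : Cx R).
  by apply: eqC; rewrite ?ReD ?ImD /= ?add0r ?addr0.
rewrite (flowD V_holo X_0 X_ode); apply: D_spiral => //.
have p20 : 0 < pi / 2 :> R by rewrite divr_gt0 ?pi_gt0.
pose n := Num.bound (`|s| / (pi / 2)).
have nb : `|s| / (pi / 2) < n%:R by apply: archi_boundP; rewrite divr_ge0// ltW.
have n0 : 0 < n%:R :> R by apply: le_lt_trans nb; rewrite divr_ge0// ltW.
pose q := s / n%:R.
have qb : - (pi / 2) < q < pi / 2.
  by rewrite -ltr_norml normrM normfV [`|n%:R|]gtr0_norm// ltr_pdivrMr// mulrC -ltr_pdivrMr.
have -> : s = n%:R * q by rewrite mulrC divfK// gt_eqF.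
elim: n {nb n0 q qb}(q) (qb) => [|n IH] q qb; first by rewrite mul0r X_0.
have -> : (0 +i* (n.+1%:R * q) : Cx R) = (0 +i* (n%:R * q)) + (0 +i* q).
  by apply: eqC; rewrite ?ReD ?ImD /= ?addr0// -natr1 mulrDl mul1r.
by rewrite (flowD V_holo X_0 X_ode); apply: D_circ => //; exact: IH.
Qed.

(* Follow far away points of [D] along the flow until they cross a fixed sphere around
   the origin; the crossing times tend to infinity, so that a limit [w] of
   the crossing points is approximated by points whose backward orbits stay in
   [D] for an arbitrarily long time. *)
Lemma escape_limit : (forall M, exists2 z, D z & M < nrm z) ->
  exists w, [/\ 0 < nrm w, (forall z, nrm z <= nrm w -> D z)
    & forall T dl : R, 0 <= T -> 0 < dl -> exists2 w', nrm (w' - w) < dl &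
        forall l, - T <= complex.Re l -> D (X l w')].
Proof.
move=> unb; have /nbhs_nrmP[r2 r20 hr2] : nbhs (0 : Cn R d) D by apply: open_nbhs_nbhs.
pose r := r2 / 2; have r0 : 0 < r by rewrite divr_gt0.
have Dr z : nrm z <= r -> D z.
  by move=> zr; apply: hr2; rewrite subr0 (le_lt_trans zr)// ltr_pdivrMr// ltr_pMr// ltr1n.
have /choice[zt hzt] (n : nat) : exists zt : Cn R d * R,
    [/\ D zt.1, n%:R < nrm zt.1, 0 <= zt.2 & nrm (X zt.2%:C zt.1) = r].
  (* The point is both farther than [n] and outside the sphere of radius [r] to be crossed. *)
  have [z Dz zn] := unb (n%:R + r).
  have [T T0 hT] := flow_attracted z r0.
  have fc : continuous (fun t : R => nrm (X t%:C z)).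
    move=> t; apply: (@continuous_comp _ _ _ (fun t : R => X t%:C z) (@nrm R _)); last exact: nrm_continuous.
    apply: (@continuous_comp _ _ _ (fun t : R => t%:C : Cx R) (fun l => X l z)).
      exact: continuous_real_complex.
    exact: (flow_continuous X_ode).
  have rz : r <= nrm z by rewrite (le_trans _ (ltW zn))// lerDr.
  have [||t] := @IVT R (fun t => nrm (X t%:C z)) 0 T r (ltW T0).
  - exact: continuous_subspaceT.
  - by rewrite X_0 ge_min le_max (ltW hT) orbT rz.
  rewrite in_itv /= => /andP[t0 _] tr; exists (z, t); split => //=.
  by rewrite (lt_trans _ zn)// ltrDl.
pose w n := X (zt n).2%:C (zt n).1.
have wr n : nrm (w n) = r by have [] := hzt n.
have [|wl [_ wcl]] := @compact_box R d r (w @ \oo) _.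
  exists 0%N => // n _ j; have cz := normc_coord_le (w n) j; rewrite wr in cz.
  by split; rewrite -ler_norml; [exact: le_trans (abs_Re_le _) cz|exact: le_trans (abs_Im_le _) cz].
(* A cluster point is approached at arbitrarily late indices, which replaces extracting a
   subsequence. *)
have freq e N : 0 < e -> exists2 n, (N <= n)%N & nrm (w n - wl) < e.
  move=> e0; have [|| y [[n /= Nn <-] yw]] := wcl [set y | exists2 n, (N <= n)%N & w n = y] [set y | nrm (y - wl) < e].
  - by exists N => // n Nn; exists n.
  - by apply/nbhs_nrmP; exists e.
  by exists n.
have wlr : nrm wl = r.
  apply/eqP; rewrite -subr_eq0 -normr_eq0 eq_le normr_ge0 andbT.
  apply/ler_addgt0Pr => e e0; rewrite add0r.
  have [n _ hn] := freq e 0%N e0; apply: le_trans (ltW hn); rewrite -(wr n).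
  rewrite ler_norml lerBlDr; apply/andP; split.
    rewrite lerNl opprB lerBlDr.
    by rewrite -[X in nrm X <= _](subrK wl) nrmD.
  rewrite nrm_distC.
  by rewrite -[X in nrm X <= _](subrK (w n)) nrmD.
exists wl; split; rewrite ?wlr// => T dl T0 dl0.
have [M M0 hM] := flow_bounded X_ode wl T.
have [d1 d10 hd1] := flow_dependence V_holo X_0 X_ode wl T0 ltr01.
have mn0 : 0 < Num.min dl d1 by rewrite lt_min dl0.
(* Such an index forces [T < t_n]: a backward flow of time [t_n <= T] would bring [w_n] to [z_n]
   within distance 1 of the orbit of [wl], hence into the ball of radius [M + 1]. *)
have [n nN] := freq _ (Num.bound (M + 1)) mn0.
rewrite lt_min => /andP[ndl nd1].
exists (w n) => // l lT.
have [Dz zn t0 _] := hzt n.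
have Tt : T < (zt n).2.
  rewrite ltNge; apply/negP => tT.
  have back : X (- (zt n).2%:C) (w n) = (zt n).1.
    by rewrite /w -(flowD V_holo X_0 X_ode) subrr X_0.
  have nt : normc (- (zt n).2%:C) <= T by rewrite normcN normc_real ger0_norm.
  have := hd1 _ _ nd1 nt; rewrite back => H.
  have : nrm (zt n).1 <= M + 1.
    rewrite -(subrK (X (- (zt n).2%:C) wl) (zt n).1) addrC.
    by apply: le_trans (nrmD _ _) _; apply: lerD; [exact: hM|exact: ltW].
  rewrite leNgt => /negP; apply; apply: le_lt_trans zn.
  have : M + 1 < (Num.bound (M + 1))%:R by apply: archi_boundP; rewrite addr_ge0.
  by move=> /ltW/le_trans; apply; rewrite ler_nat.
rewrite /w -(flowD V_holo X_0 X_ode); apply: D_halfplane => //.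
by rewrite ReD /= -lerBlDl sub0r (le_trans _ lT)// lerN2 ltW.
Qed.

End EscapeLimit.

(** * Circle means of quadratic functions and along holomorphic curves *)

Section CircleMeans.
Variable R : realType.

Lemma cint_circ_id (l : R[i]) (r : R) : 0 < r ->
  cint (fun t => complex.Re (circ l r t)) = 2 * pi * complex.Re l /\
  cint (fun t => complex.Im (circ l r t)) = 2 * pi * complex.Im l.
Proof.
move=> r0; apply: (@circle_mean R id l (r + 1)) => //; first by rewrite ltrDl.
by move=> z _; exists 1; exact: cderiv_id.
Qed.

Lemma continuous_circ_Re (l : R[i]) (r : R) : continuous (fun t => complex.Re (circ l r t)).
Proof.
move=> t; exact: (@continuous_comp _ _ _ (circ l r : R -> Cx R) (fun z : Cx R => complex.Re z) t
  (@continuous_circ R l r t) (@continuous_Re R _)).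
Qed.

Lemma continuous_circ_Im (l : R[i]) (r : R) : continuous (fun t => complex.Im (circ l r t)).
Proof.
move=> t; exact: (@continuous_comp _ _ _ (circ l r : R -> Cx R) (fun z : Cx R => complex.Im z) t
  (@continuous_circ R l r t) (@continuous_Im R _)).
Qed.

(* [Re (z ^ 2) = x ^ 2 - y ^ 2] is harmonic, and [x ^ 2 + y ^ 2] is computed on the circle. *)
Lemma cint_circ_sqr (l : R[i]) (r : R) : 0 < r ->
  cint (fun t => complex.Re (circ l r t) * complex.Re (circ l r t)) =
    2 * pi * (complex.Re l ^+ 2 + r ^+ 2 / 2) /\
  cint (fun t => complex.Im (circ l r t) * complex.Im (circ l r t)) =
    2 * pi * (complex.Im l ^+ 2 + r ^+ 2 / 2).
Proof.
move=> r0.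
have cR := @continuous_circ_Re l r; have cI := @continuous_circ_Im l r.
have cRR : continuous (fun t => complex.Re (circ l r t) * complex.Re (circ l r t)).
  by move=> t; exact: cvgM (cR t) (cR t).
have cII : continuous (fun t => complex.Im (circ l r t) * complex.Im (circ l r t)).
  by move=> t; exact: cvgM (cI t) (cI t).
have cst c : continuous (fun _ : R => c : R) by move=> t; exact: cvg_cst.
have [eR eI] := cint_circ_id l r0.
have [|dif _] := @circle_mean R (fun z => z * z) l (r + 1) r r0 (ltr_pwDr ltr01 (lexx r)).
  by move=> z _; exists (z * 1 + z * 1); apply: cderivM; exact: cderiv_id.
pose p := 2 * complex.Re l; pose q := 2 * complex.Im l.
pose k := r ^+ 2 - complex.Re l ^+ 2 - complex.Im l ^+ 2.
have E1 t : complex.Re (circ l r t) * complex.Re (circ l r t) =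
    2^-1 * (complex.Re (circ l r t * circ l r t) + (k + (p * complex.Re (circ l r t) + q * complex.Im (circ l r t)))).
  rewrite /circ !ReM !ReD !ImD !ReZ !ImZ /= /k /p /q.
  have := cos2Dsin2 t; set c := cos t; set s := sin t => cs.
  have -> : r ^+ 2 = r ^+ 2 * (c ^+ 2 + s ^+ 2) by rewrite cs mulr1.
  by field.
have E2 t : complex.Im (circ l r t) * complex.Im (circ l r t) =
    complex.Re (circ l r t) * complex.Re (circ l r t) - complex.Re (circ l r t * circ l r t).
  by rewrite ReM; ring.
have clin : continuous (fun t => p * complex.Re (circ l r t) + q * complex.Im (circ l r t)).
  by move=> t; exact: cvgD (cvgM (cvg_cst _) (cR t)) (cvgM (cvg_cst _) (cI t)).
have cdif : continuous (fun t => complex.Re (circ l r t * circ l r t)).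
  rewrite (_ : (fun t => _) = (fun t => complex.Re (circ l r t) * complex.Re (circ l r t)
    - complex.Im (circ l r t) * complex.Im (circ l r t))).
    by move=> t; exact: cvgB (cRR t) (cII t).
  by apply/funext => t; rewrite ReM.
have ck : continuous (fun t => k + (p * complex.Re (circ l r t) + q * complex.Im (circ l r t))).
  by move=> t; exact: cvgD (cvg_cst _) (clin t).
have cpR : continuous (fun t => p * complex.Re (circ l r t)).
  by move=> t; exact: cvgM (cvg_cst _) (cR t).
have cqI : continuous (fun t => q * complex.Im (circ l r t)).
  by move=> t; exact: cvgM (cvg_cst _) (cI t).
have RR : cint (fun t => complex.Re (circ l r t) * complex.Re (circ l r t)) =
    2 * pi * (complex.Re l ^+ 2 + r ^+ 2 / 2).
  rewrite (_ : (fun t => _) = (fun t => 2^-1 * (complex.Re (circ l r t * circ l r t) +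
    (k + (p * complex.Re (circ l r t) + q * complex.Im (circ l r t)))))); last first.
    by apply/funext => t; exact: E1.
  rewrite cintZ; last by move=> t; exact: cvgD (cdif t) (ck t).
  rewrite (cintD cdif ck) dif (cintD (cst k) clin) cint_cst (cintD cpR cqI) !cintZ// eR eI.
  by rewrite ReM /k /p /q; field.
split => //.
rewrite (_ : (fun t => _) = (fun t => complex.Re (circ l r t) * complex.Re (circ l r t) +
  -1 * complex.Re (circ l r t * circ l r t))); last by apply/funext => t; rewrite E2 mulN1r.
rewrite cintD//; last by move=> t; exact: cvgM (cvg_cst _) (cdif t).
by rewrite RR cintZ// dif ReM; field.
Qed.

Lemma polar_form (l : R[i]) : l != 0 -> exists z, l = cexp z.
Proof.
move=> l0; have n0 : 0 < normc l by rewrite normc_gt0.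
pose x := complex.Re l / normc l.
have x1 : -1 <= x <= 1.
  rewrite -ler_norml normrM normfV [`|normc l|]gtr0_norm// ler_pdivrMr// mul1r.
  exact: abs_Re_le.
have xin : x \in `[-1, 1]%R by rewrite in_itv.
have sE : sin (acos x) = `|complex.Im l| / normc l.
  rewrite sin_acos//.
  have -> : 1 - x ^+ 2 = (complex.Im l / normc l) ^+ 2.
    apply: (mulIf (x := normc l ^+ 2)); first by rewrite expf_neq0// gt_eqF.
    rewrite mulrBl -!exprMn !divfK ?gt_eqF// mul1r normc_sqr; ring.
  by rewrite sqrtr_sqr normrM normfV [`|normc l|]gtr0_norm.
have [i0|i0] := leP 0 (complex.Im l).
  exists (ln (normc l) +i* acos x); rewrite /cexp /= lnK ?posrE//.
  apply: eqC; rewrite ?ReZ ?ImZ /= ?acosK// ?sE.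
    by rewrite mulrC divfK ?gt_eqF.
  by rewrite ger0_norm// mulrC divfK ?gt_eqF.
exists (ln (normc l) +i* (- acos x)); rewrite /cexp /= lnK ?posrE//.
apply: eqC; rewrite ?ReZ ?ImZ /= ?cosN ?sinN ?acosK// ?sE.
  by rewrite mulrC divfK ?gt_eqF.
by rewrite ltr0_norm// mulNr opprK mulrC divfK ?gt_eqF.
Qed.

Section Curves.
Variables (d : nat) (c : Cx R -> Cn R d) (c' : Cx R -> Cn R d).
Hypothesis c_holo : forall (l : R[i]) j, cderiv (fun m => c m ord0 j) l (c' l ord0 j).

Lemma curve_continuous : continuous c.
Proof.
move=> l; apply/continuous_nrmP => e e0.
have /choice[dl hdl] (j : 'I_d) : exists dl, 0 < dl /\ forall m : R[i], normc (m - l) < dl ->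
    normc (c m ord0 j - c l ord0 j) < e.
  by have [dl dl0 h] := cderiv_continuous (c_holo l j) e0; exists dl.
exists (\big[Num.min/1]_j dl j).
  by elim/big_ind: _ => // [x y x0 y0|j _]; [rewrite lt_min x0|exact: (hdl j).1].
move=> m; rewrite nrm_Cx => ml; apply: nrm_lt_coord => // j; rewrite !mxE.
by apply: (hdl j).2; apply: lt_le_trans ml _; exact: bigmin_le_cond.
Qed.

Lemma curve_circ_continuous (l : R[i]) (r : R) :
  continuous (fun t => eucl2 (c (circ l r t))) /\
  continuous (fun t => eucl2 (c (circ l r t) - c l)).
Proof.
have cc : continuous (fun t => c (circ l r t)).
  move=> t; exact: (@continuous_comp _ _ _ (circ l r : R -> Cx R) c t
    (@continuous_circ R l r t) (@curve_continuous _)).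
split=> t; first exact: (@continuous_comp _ _ _ (fun t => c (circ l r t)) (@eucl2 R d) t (cc t)
  (@continuous_eucl2 R d _)).
apply: (@continuous_comp _ _ _ (fun t => c (circ l r t) - c l) (@eucl2 R d)).
  by apply: (@cvgB _ (Cn R d)); [exact: cc|exact: cvg_cst].
exact: continuous_eucl2.
Qed.

(** The cross term is the real part of a holomorphic function that vanishes at [l], so its mean is
    0. *)
Lemma eucl2_circle_mean (l : R[i]) (r : R) : 0 < r ->
  cint (fun t => eucl2 (c (circ l r t))) =
  2 * pi * eucl2 (c l) + cint (fun t => eucl2 (c (circ l r t) - c l)).
Proof.
move=> r0; have [cc cd] := curve_circ_continuous l r.
pose g j (z : R[i]) := c z ord0 j - c l ord0 j.
have gd j z : cderiv (g j) z (c' z ord0 j - 0).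
  by apply: cderivB; [exact: c_holo|exact: cderiv_cst].
have gc j : continuous (fun t => complex.Re (g j (circ l r t))) /\
    continuous (fun t => complex.Im (g j (circ l r t))).
  have hc t : {for t, continuous (fun t => (g j (circ l r t) : Cx R))}.
    exact: (@continuous_comp _ _ _ (circ l r : R -> Cx R) (g j : Cx R -> Cx R) t
      (@continuous_circ R l r t) (cderiv_continuous_Cx (gd j _))).
  split => t.
    exact: (@continuous_comp _ _ _ _ (fun z : Cx R => complex.Re z) _ (hc t) (@continuous_Re R _)).
  exact: (@continuous_comp _ _ _ _ (fun z : Cx R => complex.Im z) _ (hc t) (@continuous_Im R _)).
pose lin t := \sum_(j < d) (2 * complex.Re (c l ord0 j) * complex.Re (g j (circ l r t))
              + 2 * complex.Im (c l ord0 j) * complex.Im (g j (circ l r t))).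
have cont1 j : continuous (fun t => 2 * complex.Re (c l ord0 j) * complex.Re (g j (circ l r t))).
  by move=> t; exact: cvgM (cvg_cst _) ((gc j).1 t).
have cont2 j : continuous (fun t => 2 * complex.Im (c l ord0 j) * complex.Im (g j (circ l r t))).
  by move=> t; exact: cvgM (cvg_cst _) ((gc j).2 t).
have contj j : continuous (fun t => 2 * complex.Re (c l ord0 j) * complex.Re (g j (circ l r t))
     + 2 * complex.Im (c l ord0 j) * complex.Im (g j (circ l r t))).
  by move=> t; exact: cvgD (cont1 j t) (cont2 j t).
have linc : continuous lin by move=> t; apply: continuous_sumR => j; exact: contj.
have lin0 : cint lin = 0.
  rewrite /lin cint_sum// big1// => j _; rewrite (cintD (cont1 j) (cont2 j)).
  rewrite (cintZ _ (gc j).1) (cintZ _ (gc j).2).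
  have [|-> ->] := @circle_mean R (g j) l (r + 1) r r0 (ltr_pwDr ltr01 (lexx r)).
    by move=> z _; eexists; exact: gd.
  by rewrite /g subrr /= !mulr0 addr0.
have E t : eucl2 (c (circ l r t)) = eucl2 (c l) + (eucl2 (c (circ l r t) - c l) + lin t).
  rewrite /lin !eucl2E -!big_split /=; apply: eq_bigr => j _.
  by rewrite !mxE /g !normc_sqr !ReD !ImD !ReN !ImN; ring.
rewrite (_ : (fun t => eucl2 (c (circ l r t))) =
  (fun t => eucl2 (c l) + (eucl2 (c (circ l r t) - c l) + lin t))); last exact/funext.
rewrite cintD; last 2 first.
- by move=> t; exact: cvg_cst.
- by move=> t; exact: cvgD (cd t) (linc t).
by rewrite (cintD cd linc) lin0 addr0 cint_cst.
Qed.

Lemma eucl2_submean (l : R[i]) (r : R) : 0 < r ->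
  2 * pi * eucl2 (c l) <= cint (fun t => eucl2 (c (circ l r t))).
Proof.
move=> r0; rewrite eucl2_circle_mean// lerDl.
have [_ cd] := curve_circ_continuous l r.
rewrite -(mulr0 (2 * pi)) -cint_cst; apply: le_cint => //.
  by move=> t; exact: cvg_cst.
by move=> t; exact: eucl2_ge0.
Qed.

(** By Taylor, coordinate [j] moves by at least [nu r - C r^2]; the bound on [r] makes the second
    term at most half the first, which leaves [(nu r / 2)^2]. *)
Lemma eucl2_strict_submean (l : R[i]) (j : 'I_d) (nu : R) : 0 < nu ->
  nu <= normc (c' l ord0 j) ->
  exists2 r0 : R, 0 < r0 & forall r, 0 < r < r0 ->
    2 * pi * (eucl2 (c l) + r ^+ 2 * (nu ^+ 2 / 4)) <=
    cint (fun t => eucl2 (c (circ l r t))).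
Proof.
move=> nu0 nule.
have [C C0 hC] := @entire_second_order R (fun m => c m ord0 j) (fun m => c' m ord0 j) l
  (fun z => c_holo z j).
have CC : 0 < 2 * (C + 1) by rewrite mulr_gt0// ltr_wpDl.
exists (Num.min 1 (nu / (2 * (C + 1)))); first by rewrite lt_min ltr01 divr_gt0.
move=> r /andP[r0]; rewrite lt_min => /andP[r1 rnu].
rewrite eucl2_circle_mean// mulrDr lerD2l.
have [_ cd] := curve_circ_continuous l r.
rewrite -cint_cst; apply: le_cint => //; first by move=> t; exact: cvg_cst.
move=> t; apply: le_trans (coord_le_eucl2 _ j).
have -> : r ^+ 2 * (nu ^+ 2 / 4) = (r * (nu / 2)) ^+ 2 by field.
rewrite ler_sqr ?nnegrE ?normc_ge0//; last by rewrite mulr_ge0 ?divr_ge0// ltW.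
pose mu := circ l r t - l; have nmu : normc mu = r by rewrite normc_circ// ltW.
have := hC mu; rewrite nmu (ltW r1) => /(_ isT).
rewrite [l + _]addrC subrK => H; rewrite !mxE.
have tri : normc (c' l ord0 j * mu) <= normc (c (circ l r t) ord0 j - c l ord0 j) + C * r ^+ 2.
  rewrite -(subrK (c (circ l r t) ord0 j - c l ord0 j) (c' l ord0 j * mu)) addrC.
  by apply: le_trans (normcD _ _) _; rewrite lerD2l normc_distC.
rewrite normcM nmu in tri.
have lower : nu * r <= normc (c' l ord0 j) * r by rewrite ler_pM2r.
have Crr : C * r ^+ 2 <= r * (nu / 2).
  rewrite expr2 mulrA mulrC ler_pM2l//.
  move: rnu; rewrite ltr_pdivlMr// => /ltW.
  have : C * r <= (C + 1) * r by rewrite ler_pM2r// lerDl.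
  by move: (C * r) => y; lra.
by lra.
Qed.

End Curves.
End CircleMeans.

(** * Bounded holomorphic and plurisubharmonic functions at the escape limit *)

Section AtEscapeLimit.
Variables (R : realType) (d : nat) (V : Cn R d -> Cn R d) (X : Cx R -> Cn R d -> Cn R d).
Variables (D : set (Cn R d)) (w : Cn R d).
Hypothesis V_holo : forall z, differentiable V z.
Hypothesis X_0 : forall z, X 0 z = z.
Hypothesis X_ode : forall (l : Cx R) z, is_derive l (1 : Cx R) (fun m => X m z) (V (X l z)).
Hypothesis D_open : open D.
Hypothesis w_approx : forall T dl : R, 0 <= T -> 0 < dl ->
  exists2 w', nrm (w' - w) < dl & forall l, - T <= complex.Re l -> D (X l w').

(** Cauchy's estimate on discs of radius [T] bounds the variation of [f] along the orbit of [w'] by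
    [16 M s / T]. This costs one third of [e]; continuity at [w] and at [X s w] costs the other
    two. *)
Lemma orbit_liouville (f : Cn R d -> Cx R) (M s : R) : holo_on f D ->
  (forall z, D z -> normc (f z) <= M) -> 0 <= s -> D w -> D (X s%:C w) ->
  f (X s%:C w) = f w.
Proof.
move=> fD fM s0 Dw Ds.
have M0 : 0 <= M := le_trans (normc_ge0 _) (fM w Dw).
apply/eqP; rewrite -subr_eq0 -normc_eq0 eq_le normc_ge0 andbT.
apply/ler_addgt0Pr => e e0; rewrite add0r.
have e30 : 0 < e / 3 by rewrite divr_gt0.
have /continuous_nrmP/(_ _ e30)[d1 d10 h1] : {for w, continuous f}.
  exact: differentiable_continuous (fD _ Dw).
have /continuous_nrmP/(_ _ e30)[d2 d20 h2] : {for X s%:C w, continuous f}.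
  exact: differentiable_continuous (fD _ Ds).
have [d3 d30 h3] := flow_dependence V_holo X_0 X_ode w s0 d20.
pose T := 16 * M * s / (e / 3) + 1.
have T0 : 0 < T by rewrite ltr_wpDl// divr_ge0 ?(ltW e30)// !mulr_ge0.
have md0 : 0 < Num.min d1 d3 by rewrite lt_min d10.
have [w' + DX] := w_approx (ltW T0) md0; rewrite lt_min => /andP[n1 n3].
have B1 : normc (f w' - f w) <= e / 3 by rewrite -nrm_Cx ltW// h1.
have B2 : normc (f (X s%:C w') - f (X s%:C w)) <= e / 3.
  by rewrite -nrm_Cx ltW// h2// h3// normc_real ger0_norm.
have B3 : normc (f (X s%:C w') - f w') <= e / 3.
  have := @cauchy_lipschitz R (fun l => f (X l w')) 0 s%:C T M T0.
  rewrite subr0 X_0 normc_real ger0_norm// => H; apply: le_trans (H _) _.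
    move=> t z /andP[t0 t1]; rewrite add0r => zt.
    have Dz : D (X z w').
      apply: DX; have := le_lt_trans (abs_Re_le _) zt.
      rewrite ReD ReN ReZ /= ltr_norml => /andP[+ _]; have : 0 <= t * s by rewrite mulr_ge0.
      by move: (t * s) => y; lra.
    split; last exact: fM.
    apply: (@differentiable_cderiv R (fun l => f (X l w'))).
    apply: (@differentiable_comp _ _ _ _ (fun l : Cx R => X l w') f); last exact: fD.
    exact: (flow_differentiable X_ode).
  rewrite mulrAC ler_pdivrMr//; rewrite /T mulrDr mulr1 [e / 3 * (_ / _)]mulrC divfK ?gt_eqF//.
  by rewrite lerDl ltW.
have -> : f (X s%:C w) - f w = (f w' - f w) + (f (X s%:C w') - f w') - (f (X s%:C w') - f (X s%:C w)).
  by ring.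
have -> : e = e / 3 + e / 3 + e / 3 by field.
apply: le_trans (normcB _ _) _; apply: lerD => //.
by apply: le_trans (normcD _ _) _; apply: lerD.
Qed.

(* Three circles theorem with one circle shrinking to a point and another growing
   to infinity, in logarithmic coordinates [l = cexp z]: [q] is a strictly superharmonic
   majorant of [u (X (cexp z) w')] on the boundary of a large rectangle. *)
Lemma psh_orbit_max (u : Cn R d -> R) (M : R) (l0 : Cx R) : psh_on u D ->
  (forall z, D z -> {for z, continuous u}) -> (forall z, D z -> u z <= M) ->
  D w -> D (X l0 w) -> u (X l0 w) <= u w.
Proof.
move=> upsh uc uM Dw Dl0.
have [->|l00] := eqVneq l0 0; first by rewrite X_0.
have [z0 l0E] := polar_form l00.
pose x0 := complex.Re z0; pose y0 := complex.Im z0.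
(* Four errors of size [e]: the value of [u] near [w], the slope [beta], the terms in [k], and the
   return from [w'] to [w]. *)
apply/ler_addgt0Pr => e4 e40; pose e := e4 / 4; have e0 : 0 < e by rewrite divr_gt0.
have /continuous_nrm_absP/(_ _ e0)[d1 d10 h1] := uc _ Dw.
have /continuous_nrm_absP/(_ _ e0)[d3 d30 h3] := uc _ Dl0.
have d120 : 0 < d1 / 2 by rewrite divr_gt0.
have /continuous_nrmP/(_ _ d120)[d2 d20 h2] := @flow_continuous _ _ _ _ X_ode w 0.
(* The logarithm of the inner radius, below [ln d2] so that times on that circle move [w] by less
   than [d1 / 2]. *)
pose a := Num.min (x0 - 1) (ln d2 - 1).
have ax0 : a < x0 by rewrite gt_min ltrBlDr ltrDl ltr01.
have ad2 : expR a < d2.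
  rewrite -[X in _ < X]lnK ?posrE// ltr_expR gt_min ltrBlDr.
  by rewrite [X in _ || X]ltrBlDr ltrDl ltr01 orbT.
pose M' := `|M - u w - e| + 1; have M'0 : 0 < M' by rewrite ltr_wpDl.
have MM' : M <= u w + e + M'.
  by rewrite /M'; have := ler_norm (M - u w - e); move: `|_| => y; lra.
(* The outer side is so far that a slope rising by [M'] from [a] to [b] gains at most [e] at
   [x0]. *)
pose b := a + (x0 - a) * (1 + M' / e).
have xa0 : 0 < x0 - a by rewrite subr_gt0.
have Me0 : 0 < M' / e by rewrite divr_gt0.
have bx0 : x0 < b.
  rewrite /b mulrDr mulr1; have : 0 < (x0 - a) * (M' / e) by rewrite mulr_gt0.
  by move: (_ * (M' / e)) => y; lra.
have ba0 : 0 < b - a by rewrite subr_gt0 (lt_trans ax0).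
pose beta := M' / (b - a); have beta0 : 0 < beta by rewrite divr_gt0.
have beta_e : beta * (x0 - a) <= e.
  have -> : beta * (x0 - a) = M' / (1 + M' / e).
    have y0' : 1 + M' / e != 0 by rewrite gt_eqF// addr_gt0.
    have z0' : x0 - a != 0 by rewrite gt_eqF.
    rewrite /beta /b [a + _]addrC addrK; move: (1 + M' / e) (x0 - a) y0' z0' => y z y0' z0'.
    by field; rewrite y0' z0'.
  rewrite ler_pdivrMr ?addr_gt0// mulrDr mulr1 mulrCA divff ?gt_eqF// mulr1.
  by rewrite lerDr ltW.
(* [W] dominates the factor of [k] in [q z0], so these terms cost at most [e]; [Tl] is then so large
   that the quadratic term reaches [M'] on the horizontal sides. *)
pose W := (x0 - a) * (b - x0) + y0 ^+ 2 + 1.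
have W0 : 0 < W.
  by rewrite ltr_wpDl// addr_ge0 ?sqr_ge0// mulr_ge0 ?subr_ge0// ltW.
pose k := e / W; have k0 : 0 < k by rewrite divr_gt0.
pose Tl := `|y0| + 1 + 2 * M' / k.
have Mk0 : 0 <= 2 * M' / k by apply: ltW; rewrite divr_gt0// mulr_gt0.
have Tl1 : 1 <= Tl.
  by rewrite /Tl; have := normr_ge0 y0; move: `|y0| => y; move: Mk0; move: (_ / k) => *; lra.
have TlM : M' <= k / 2 * Tl ^+ 2.
  apply: (@le_trans _ _ (k / 2 * Tl)).
    have -> : M' = k / 2 * (2 * M' / k) by field; rewrite gt_eqF.
    rewrite ler_pM2l ?divr_gt0// /Tl lerDr addr_ge0//.
  by rewrite ler_pM2l ?divr_gt0// expr2 ler_peMl// (le_trans ler01).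
have y0T : `|y0| <= Tl by rewrite /Tl -addrA lerDl addr_ge0// ltW.
pose A := u w + e.
(* The affine part is harmonic. The quadratic terms have second derivatives [- 2 k] in [Re z] and
   [k] in [Im z], so the Laplacian is [- k]. *)
pose q (z : Cx R) := A + beta * (complex.Re z - a)
  + k * ((complex.Re z - a) * (b - complex.Re z)) + k / 2 * complex.Im z ^+ 2.
have md0 : 0 < Num.min (d1 / 2) d3 by rewrite lt_min d120.
(* All times [cexp z] on the rectangle have modulus at most [exp b]. *)
have [d4 d40 h4] := flow_dependence V_holo X_0 X_ode w (expR_ge0 b) md0.
have [w' n4 DX] := w_approx (expR_ge0 b) d40.
have h4' z : complex.Re z <= b -> nrm (X (cexp z) w' - X (cexp z) w) < Num.min (d1 / 2) d3.
  by move=> zb; apply: h4 => //; rewrite normc_cexp ler_expR.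
pose c (z : Cx R) := X (cexp z) w'.
pose c' (z : Cx R) := cexp z *: V (X (cexp z) w').
have c_holo (z : R[i]) j : cderiv (fun m => c m ord0 j) z (c' z ord0 j).
  apply: cderiv_eq (@cderiv_comp R (fun m => X m w' ord0 j) (@cexp R) z _ _ _ (cderiv_cexp z)) _.
    exact: (flow_cderiv X_ode).
  by rewrite !mxE mulrC.
have cRe : continuous (fun z : Cx R => complex.Re z) := @continuous_Re R.
have cIm : continuous (fun z : Cx R => complex.Im z) := @continuous_Im R.
have qc : continuous q.
  move=> z; have cst (y : R) : {for z, continuous (fun _ : Cx R => y)}.
    by apply/continuous_nrm_absP => e1 e10; exists 1 => // y1 _; rewrite subrr normr0.
  have i2 : {for z, continuous (fun z : Cx R => complex.Im z ^+ 2)}.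
    rewrite (_ : (fun z : Cx R => _) = (fun z => complex.Im z * complex.Im z)).
      exact: cvgM (cIm z) (cIm z).
    by apply/funext => y; rewrite expr2.
  exact: cvgD (cvgD (cvgD (cst A) (cvgM (cst beta) (cvgB (cRe z) (cst a))))
    (cvgM (cst k) (cvgM (cvgB (cRe z) (cst a)) (cvgB (cst b) (cRe z)))))
    (cvgM (cst (k / 2)) i2).
have qmean (l : Cx R) : a < complex.Re l < b -> - Tl < complex.Im l < Tl ->
    exists2 r0 : R, 0 < r0 & forall r, 0 < r < r0 ->
      cint (fun t => q (circ l r t)) <= 2 * pi * q l - (k * pi / 2) * r ^+ 2.
  move=> _ _; exists 1 => // r /andP[r0 _].
  have [eR eI] := cint_circ_id l r0; have [eRR eII] := cint_circ_sqr l r0.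
  pose g1 t := (beta + k * (a + b)) * complex.Re (circ l r t).
  pose g2 t := - k * (complex.Re (circ l r t) * complex.Re (circ l r t)).
  pose g3 t := k / 2 * (complex.Im (circ l r t) * complex.Im (circ l r t)).
  have cR := @continuous_circ_Re R l r; have cI := @continuous_circ_Im R l r.
  have cRR : continuous (fun t => complex.Re (circ l r t) * complex.Re (circ l r t)).
    by move=> t; exact: cvgM (cR t) (cR t).
  have cII : continuous (fun t => complex.Im (circ l r t) * complex.Im (circ l r t)).
    by move=> t; exact: cvgM (cI t) (cI t).
  have c1 : continuous g1 by move=> t; exact: cvgM (cvg_cst _) (cR t).
  have c2 : continuous g2 by move=> t; exact: cvgM (cvg_cst _) (cRR t).
  have c3 : continuous g3 by move=> t; exact: cvgM (cvg_cst _) (cII t).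
  have c23 : continuous (fun t => g2 t + g3 t) by move=> t; exact: cvgD (c2 t) (c3 t).
  have c123 : continuous (fun t => g1 t + (g2 t + g3 t)) by move=> t; exact: cvgD (c1 t) (c23 t).
  have cst : continuous (fun _ : R => A - beta * a - k * a * b) by move=> t; exact: cvg_cst.
  have qE : (fun t : R => q (circ l r t)) =
      (fun t => (A - beta * a - k * a * b) + (g1 t + (g2 t + g3 t))).
    by apply/funext => t; rewrite /q /g1 /g2 /g3; ring.
  rewrite qE (cintD cst c123) (cintD c1 c23) (cintD c2 c3) cint_cst /g1 /g2 /g3 !cintZ//.
  by rewrite eR eRR eII /q; move: (pi : R) => p; rewrite le_eqVlt; apply/orP; left; apply/eqP; field.
have kp0 : 0 < k * pi / 2 by rewrite divr_gt0// mulr_gt0// pi_gt0.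
have inD z : crect a b (- Tl) Tl z -> D (c z).
  move=> [/andP[_ zb] _]; apply: DX; rewrite lerNl.
  apply: le_trans (_ : expR (complex.Re z) <= _); last by rewrite ler_expR.
  by rewrite -normc_cexp -ReN (le_trans (ler_norm _))// (le_trans (abs_Re_le _))// normcN.
have bdry z : crect a b (- Tl) Tl z ->
    [\/ complex.Re z = a, complex.Re z = b, complex.Im z = - Tl | complex.Im z = Tl] ->
    u (c z) <= q z.
  move=> zin bz; have Dz := inD z zin; have [/andP[az zb] zi] := zin.
  have t1 : 0 <= beta * (complex.Re z - a) by rewrite mulr_ge0 ?subr_ge0// ltW.
  have t2 : 0 <= k * ((complex.Re z - a) * (b - complex.Re z)).
    by apply: mulr_ge0; [exact: ltW|apply: mulr_ge0; rewrite subr_ge0].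
  have t3 : 0 <= k / 2 * complex.Im z ^+ 2 by rewrite mulr_ge0 ?sqr_ge0// divr_ge0// ltW.
  have far : M <= q z -> u (c z) <= q z by move=> /(le_trans (uM _ Dz)).
  case: bz => E.
  - have near : nrm (c z - w) < d1.
      have -> : c z - w = (X (cexp z) w' - X (cexp z) w) + (X (cexp z) w - w).
        by rewrite addrA subrK.
      rewrite [d1]splitr; apply: le_lt_trans (nrmD _ _) _; apply: ltrD.
        by have := h4' z zb; rewrite lt_min => /andP[].
      have := h2 (cexp z); rewrite X_0 subr0 nrm_Cx normc_cexp E; apply; exact: ad2.
    have := h1 _ near; rewrite ltr_distl => /andP[_ /ltW uA].
    by apply: le_trans uA _; rewrite /q /A; move: t1 t2 t3; lra.
  - apply: far; apply: le_trans MM' _.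
    have bE : beta * (complex.Re z - a) = M' by rewrite E /beta divfK// gt_eqF.
    by rewrite /q bE /A; move: t2 t3; lra.
  - apply: far; apply: le_trans MM' _.
    have iE : M' <= k / 2 * complex.Im z ^+ 2 by rewrite E sqrrN.
    by rewrite /q /A; move: t1 t2 iE; lra.
  - apply: far; apply: le_trans MM' _.
    have iE : M' <= k / 2 * complex.Im z ^+ 2 by rewrite E.
    by rewrite /q /A; move: t1 t2 iE; lra.
have z0in : crect a b (- Tl) Tl z0.
  by split; rewrite -?ler_norml// (ltW ax0) ltW.
have := psh_curve_comparison D_open upsh uc (curve_continuous c_holo) c_holo qc kp0 qmean
  inD bdry z0in.
rewrite /c -l0E => uq.
have qz0 : q z0 <= u w + 3 * e.
  have kW : k * ((x0 - a) * (b - x0)) + k * y0 ^+ 2 + k = e.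
    have <- : k * W = e by rewrite /k divfK// gt_eqF.
    by rewrite /W; ring.
  have kh : k / 2 * y0 ^+ 2 <= k * y0 ^+ 2.
    by apply: ler_wpM2r; [exact: sqr_ge0|move: k0; lra].
  rewrite /q /A -/x0 -/y0; move: beta_e kW kh.
  move: (beta * _) (k * (_ * _)) (k / 2 * _) (k * _ ^+ 2) => p1 p2 p3 p4.
  by move: k0; lra.
have close : `|u (X l0 w') - u (X l0 w)| < e.
  apply: h3; rewrite l0E; have := h4' z0 (ltW bx0); rewrite lt_min => /andP[_].
  by [].
move: close; rewrite ltr_distl => /andP[+ _].
by move: uq qz0; rewrite /e; lra.
Qed.

End AtEscapeLimit.

(** * Strict plurisubharmonicity and Kobayashi distance at the escape limit *)

Section AtEscapeLimit2.
Variables (R : realType) (d : nat) (V : Cn R d -> Cn R d) (X : Cx R -> Cn R d -> Cn R d).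
Variables (D : set (Cn R d)) (w : Cn R d).
Hypothesis V_holo : forall z, differentiable V z.
Hypothesis X_0 : forall z, X 0 z = z.
Hypothesis X_ode : forall (l : Cx R) z, is_derive l (1 : Cx R) (fun m => X m z) (V (X l z)).
Hypothesis D_open : open D.
Hypothesis w_approx : forall T dl : R, 0 <= T -> 0 < dl ->
  exists2 w', nrm (w' - w) < dl & forall l, - T <= complex.Re l -> D (X l w').

(** The constant curve is an integral curve, so uniqueness applies. Since the flow moves [w], this
    makes [V w] nonzero. *)
Lemma equilibrium_fixed (z : Cn R d) (l : Cx R) : V z = 0 -> X l z = z.
Proof.
move=> Vz; have [K K0 hK] := integral_curve_dependence V_holo (nrm_ge0 z) (normc_ge0 l).
have const : integral_curve V l (fun=> z).
  move=> t j; rewrite Vz mxE mul0r; split; exact: is_derive_cst.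
have := hK l (fun t => X (0 + t%:C * l) z) (fun=> z) (lexx _)
  (@flow_integral_curve _ _ _ _ X_ode 0 l z) const.
rewrite /= !mul0r !mul1r !addr0 !add0r X_0 subrr eucl2_0 mul0r ltr01 => H.
apply/eqP; rewrite -subr_eq0 -nrm_eq0 -sqrf_eq0 eq_le sqr_ge0 andbT.
by apply: le_trans (nrm2_le_eucl2 _) _; apply: H.
Qed.

Lemma continuous_norm2 : continuous (fun l : Cx R => complex.Re l ^+ 2 + complex.Im l ^+ 2).
Proof.
move=> l; have -> : (fun l : Cx R => complex.Re l ^+ 2 + complex.Im l ^+ 2) =
    (fun l => complex.Re l * complex.Re l + complex.Im l * complex.Im l).
  by apply/funext => z; rewrite !expr2.
exact: cvgD (cvgM (@continuous_Re R l) (@continuous_Re R l)) (cvgM (@continuous_Im R l) (@continuous_Im R l)).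
Qed.

(* On the orbit of [w], where [u] has a maximum at [w], the function
   [u - c |z|^2] would lie below [u w - c |X l w|^2], which is strictly superharmonic. *)
Lemma not_strictly_psh (u : Cn R d -> R) (M : R) : V w != 0 -> D w -> psh_on u D ->
  (forall z, D z -> {for z, continuous u}) -> (forall z, D z -> u z <= M) ->
  ~ strictly_psh_at D u w.
Proof.
move=> Vw0 Dw upsh uc uM [U [c0 [Uo UD Uw c00 vpsh]]].
have Vw : 0 < nrm (V w) by rewrite lt_neqAle nrm_ge0 eq_sym nrm_eq0 Vw0.
have [j jE] := nrm_coord Vw.
pose nu := nrm (V w) / 2; have nu0 : 0 < nu by rewrite divr_gt0.
pose c (l : Cx R) := X l w.
have c_holo (l : R[i]) i : cderiv (fun m => c m ord0 i) l (V (c l) ord0 i).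
  exact: (flow_cderiv X_ode).
have cc : continuous c := curve_continuous c_holo.
have [d1 d10 h1] : exists2 d1 : R, 0 < d1 & forall l, normc l < d1 -> U (c l).
  have /nbhs_nrmP[e e0 he] : nbhs (c 0) U by rewrite /c X_0; apply: open_nbhs_nbhs.
  have /continuous_nrmP/(_ _ e0)[d1 d10 hd] := cc 0.
  by exists d1 => // l ld; apply/he/hd; rewrite subr0 nrm_Cx.
have [d2 d20 h2] : exists2 d2 : R, 0 < d2 & forall l, normc l < d2 -> nu <= normc (V (c l) ord0 j).
  have Vc : {for 0, continuous (fun l => V (c l))}.
    apply: (@continuous_comp _ _ _ c V); first exact: cc.
    exact: differentiable_continuous.
  have /continuous_nrmP/(_ _ nu0)[d2 d20 hd] := Vc.
  exists d2 => // l ld; have := hd l; rewrite subr0 nrm_Cx => /(_ ld).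
  rewrite /c X_0 => H.
  have := le_lt_trans (normc_coord_le _ j) H; rewrite !mxE => {}H.
  have : normc (V w ord0 j) <= normc (V (X l w) ord0 j) + normc (V (X l w) ord0 j - V w ord0 j).
    rewrite normc_distC -[X in normc X <= _](subrK (V (X l w) ord0 j)) addrC.
    exact: normcD.
  by rewrite -jE; move: H; rewrite /nu; move: (normc _) (normc _) => p1 p2; lra.
pose r := Num.min d1 d2 / 4; have r0 : 0 < r by rewrite divr_gt0// lt_min d10.
have small l : crect (- r) r (- r) r l -> normc l < d1 /\ normc l < d2.
  rewrite /crect /= -!ler_norml => -[lr li].
  have : normc l <= r + r by apply: le_trans (normc_le_ReIm _) _; exact: lerD.
  have : r + r < Num.min d1 d2.
    have : 0 < Num.min d1 d2 by rewrite lt_min d10.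
    by rewrite /r; move: (Num.min _ _) => m; lra.
  by move=> a b; have := le_lt_trans b a; rewrite lt_min => /andP[].
(* By [eucl2_strict_submean] the term in [c0] lowers the circle integral by at least
   [2 pi (2 k) s^2], of which [k |l|^2] restores half. *)
pose k := c0 * (nu ^+ 2 / 8).
have k0 : 0 < k by rewrite mulr_gt0// divr_gt0// exprn_gt0.
(* As [|l| >= r] on the sides of the square, the last term is nonnegative there; at the centre it is
   [- k r^2], which contradicts the comparison. *)
pose q (l : Cx R) := u w - c0 * eucl2 (c l) + k * (complex.Re l ^+ 2 + complex.Im l ^+ 2 - r ^+ 2).
have ec : continuous (fun l => eucl2 (c l)).
  move=> l; exact: (@continuous_comp _ _ _ c (@eucl2 R d) l (cc l) (@continuous_eucl2 R d _)).
have cst (y : R) (z : Cx R) : {for z, continuous (fun _ : Cx R => y)}.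
  by apply/continuous_nrm_absP => e1 e10; exists 1 => // y1 _; rewrite subrr normr0.
have qc : continuous q.
  move=> l; exact: cvgD (cvgB (cst (u w) l) (cvgM (cst c0 l) (ec l)))
    (cvgM (cst k l) (cvgB (@continuous_norm2 l) (cst (r ^+ 2) l))).
have kp0 : 0 < 2 * pi * k by rewrite mulr_gt0// pi2_gt0.
have qmean (l : Cx R) : - r < complex.Re l < r -> - r < complex.Im l < r ->
    exists2 r0 : R, 0 < r0 & forall s, 0 < s < r0 ->
      cint (fun t => q (circ l s t)) <= 2 * pi * q l - (2 * pi * k) * s ^+ 2.
  move=> /andP[a1 a2] /andP[b1 b2].
  have lin : crect (- r) r (- r) r l by split; apply/andP; split; exact: ltW.
  have [s0 s00 hs0] := eucl2_strict_submean c_holo nu0 (h2 l (small l lin).2).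
  exists s0 => // s /[dup] ss /andP[s_gt0 _].
  have H := hs0 s ss.
  have [eRR eII] := cint_circ_sqr l s_gt0.
  have [cE _] := curve_circ_continuous c_holo l s.
  pose g1 t := - c0 * eucl2 (c (circ l s t)).
  pose g2 t := k * (complex.Re (circ l s t) * complex.Re (circ l s t)).
  pose g3 t := k * (complex.Im (circ l s t) * complex.Im (circ l s t)).
  have cR := @continuous_circ_Re R l s; have cI := @continuous_circ_Im R l s.
  have cRR : continuous (fun t => complex.Re (circ l s t) * complex.Re (circ l s t)).
    by move=> t; exact: cvgM (cR t) (cR t).
  have cII : continuous (fun t => complex.Im (circ l s t) * complex.Im (circ l s t)).
    by move=> t; exact: cvgM (cI t) (cI t).
  have c1 : continuous g1 by move=> t; exact: cvgM (cvg_cst _) (cE t).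
  have c2 : continuous g2 by move=> t; exact: cvgM (cvg_cst _) (cRR t).
  have c3 : continuous g3 by move=> t; exact: cvgM (cvg_cst _) (cII t).
  have c23 : continuous (fun t => g2 t + g3 t) by move=> t; exact: cvgD (c2 t) (c3 t).
  have c123 : continuous (fun t => g1 t + (g2 t + g3 t)) by move=> t; exact: cvgD (c1 t) (c23 t).
  have cstc : continuous (fun _ : R => u w - k * r ^+ 2) by move=> t; exact: cvg_cst.
  have qE : (fun t : R => q (circ l s t)) = (fun t => (u w - k * r ^+ 2) + (g1 t + (g2 t + g3 t))).
    by apply/funext => t; rewrite /q /g1 /g2 /g3; ring.
  rewrite qE (cintD cstc c123) (cintD c1 c23) (cintD c2 c3) cint_cst /g1 /g2 /g3.
  rewrite (cintZ _ cE) (cintZ _ cRR) (cintZ _ cII) eRR eII /q.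
  have {}H : c0 * (2 * pi * (eucl2 (c l) + s ^+ 2 * (nu ^+ 2 / 4))) <=
      c0 * cint (fun t => eucl2 (c (circ l s t))) by rewrite ler_pM2l.
  move: H; have -> : c0 * (2 * pi * (eucl2 (c l) + s ^+ 2 * (nu ^+ 2 / 4))) =
    2 * pi * (c0 * eucl2 (c l)) + 2 * pi * (2 * k) * s ^+ 2 by rewrite /k; field.
  move: (2 * pi : R) (cint _) => p m; move: (eucl2 _) => x; lra.
have inU l : crect (- r) r (- r) r l -> U (c l) by move=> /small[/h1].
have vc z : U z -> {for z, continuous (fun z => u z - c0 * eucl2 z)}.
  move=> Uz; have cst' : {for z, continuous (fun _ : Cn R d => c0)}.
    by apply/continuous_nrm_absP => e1 e10; exists 1 => // y1 _; rewrite subrr normr0.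
  exact: cvgB (uc _ (UD _ Uz)) (cvgM cst' (@continuous_eucl2 R d z)).
have bdry l : crect (- r) r (- r) r l ->
    [\/ complex.Re l = - r, complex.Re l = r, complex.Im l = - r | complex.Im l = r] ->
    u (c l) - c0 * eucl2 (c l) <= q l.
  move=> lin E; have Dl := UD _ (inU l lin).
  have umax : u (c l) <= u w.
    exact: (psh_orbit_max V_holo X_0 X_ode D_open w_approx upsh uc uM Dw Dl).
  have : 0 <= k * (complex.Re l ^+ 2 + complex.Im l ^+ 2 - r ^+ 2).
    apply: mulr_ge0; first exact: ltW.
    by rewrite subr_ge0; case: E => ->; rewrite ?sqrrN ?lerDl ?lerDr sqr_ge0.
  by rewrite /q; move: umax; lra.
have in0 : crect (- r) r (- r) r 0.
  by split; rewrite /= oppr_le0 (ltW r0).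
have := psh_curve_comparison Uo vpsh vc cc c_holo qc kp0 qmean inU bdry in0.
rewrite /q /c X_0 /= expr0n /= addr0 sub0r mulrN.
have : 0 < k * r ^+ 2 by rewrite mulr_gt0// exprn_gt0.
by lra.
Qed.

Lemma poincare0 (x : R) : 0 < x < 1 ->
  poincare (0 : Cx R) x%:C = 2^-1 * ln ((1 + x) / (1 - x)).
Proof.
move=> /andP[x0 x1]; rewrite /poincare /pseudo_hyp; set z := (_^* * _)%R.
have -> : z = 0 by apply: eqC; rewrite /z ?ReM ?ImM /=; ring.
by rewrite subr0 sub0r normr1 divr1 normrN normcE normc_real gtr0_norm.
Qed.

(** From [ln (1 + y) <= y] with [y = 2 x / (1 - x)], and [1 - x >= 1 / 2]. *)
Lemma poincare0_le (x : R) : 0 < x -> x <= 2^-1 -> poincare (0 : Cx R) x%:C <= 2 * x.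
Proof.
move=> x0 x2; have x1 : x < 1 by lra.
rewrite poincare0 ?x0// ler_pdivrMl//.
have y0 : 0 < 1 - x by rewrite subr_gt0.
have -> : (1 + x) / (1 - x) = 1 + 2 * x / (1 - x) by field; rewrite gt_eqF.
apply: le_trans (le_ln1Dx _) _.
  by apply: lt_le_trans (_ : 0 <= _); [rewrite ltrN10|rewrite divr_ge0 ?mulr_ge0// ltW].
rewrite ler_pdivrMr//.
have : x * x <= x * 2^-1 by rewrite ler_pM2l.
by lra.
Qed.

Lemma udisc_real (x : R) : 0 <= x -> x < 1 -> @udisc R x%:C.
Proof. by move=> x0 x1; rewrite /udisc /= normcE normc_real ger0_norm// ltcR. Qed.

(* The points [w] and [X s w] are joined by three discs: a small linear one from [w] to [w'],
   the disc [zeta |-> X (zeta s / x) w'], and a small linear one from [X s w'] to [X s w];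
   each contributes [poincare 0 x], with [x] as small as we please. *)
Lemma kobayashi_chain (s x : R) : 0 <= s -> 0 < x < 1 -> D w -> D (X s%:C w) ->
  (kobayashi D w (X s%:C w) <= (3 * poincare (0 : Cx R) x%:C)%:E)%E.
Proof.
move=> s0 /andP[x0 x1] Dw Ds.
have /nbhs_nrmP[d1 d10 h1] : nbhs w D by apply: open_nbhs_nbhs.
have /nbhs_nrmP[d2 d20 h2] : nbhs (X s%:C w) D by apply: open_nbhs_nbhs.
(* A linear disc reaches its second point at parameter [x], which magnifies displacements by
   [1 / x]; in the last disc, the other half of [d2] is for the offset of its centre [X s w']. *)
have xd2 : 0 < x * (d2 / 2) by rewrite mulr_gt0// divr_gt0.
have [d3 d30 h3] := flow_dependence V_holo X_0 X_ode w s0 xd2.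
have md0 : 0 < Num.min (x * d1) d3 by rewrite lt_min mulr_gt0.
(* In the unit disc the times [zeta s / x] have real part at least [- s / x]. *)
have T0 : 0 <= s / x by rewrite divr_ge0// ltW.
have [w' + DX] := w_approx T0 md0; rewrite lt_min => /andP[n1 n3].
have n2 : nrm (X s%:C w' - X s%:C w) < x * (d2 / 2) by apply: h3 => //; rewrite normc_real ger0_norm.
have xn0 : (x%:C : R[i]) != 0 by rewrite -normc_eq0 normc_real gt_eqF// normr_gt0 gt_eqF.
pose line (p q : Cn R d) (l : Cx R) := p + l *: ((x%:C)^-1 *: (q - p)).
have line0 p q : line p q 0 = p by rewrite /line scale0r addr0.
have linex p q : line p q x%:C = q by rewrite /line scalerA divff// scale1r addrC subrK.
have lineD p q e : nrm (q - p) < x * e -> forall l : Cx R, udisc l -> nrm (line p q l - p) < e.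
  move=> qp l; rewrite /udisc /= normcE ltcR => l1.
  rewrite /line addrC addKr !nrmZ Normc.normcV normc_real gtr0_norm//.
  have e0 : 0 < e.
    by rewrite -(pmulr_rgt0 _ x0); apply: le_lt_trans qp; exact: nrm_ge0.
  apply: (@le_lt_trans _ _ (1 * (x^-1 * nrm (q - p)))).
    by rewrite ler_wpM2r ?(ltW l1)// mulr_ge0 ?nrm_ge0// invr_ge0 ltW.
  by rewrite mul1r mulrC ltr_pdivrMr// mulrC.
have line_holo p q : holo_on (line p q) (@udisc R).
  by move=> l _; exact: differentiable_affine.
pose orb (l : Cx R) := X (l * (s / x)%:C) w'.
have orb_holo : holo_on orb (@udisc R).
  move=> l _; apply: (@differentiable_comp _ _ _ _ (fun l : Cx R => l * (s / x)%:C : Cx R) (fun m => X m w')).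
    have -> : (fun l : Cx R => l * (s / x)%:C : Cx R) = (fun l : Cx R => (0 : Cx R) + l *: ((s / x)%:C : Cx R)).
      by apply/funext => z; rewrite add0r.
    exact: (@differentiable_affine R (Cx R)).
  exact: (flow_differentiable X_ode).
have orbD l : udisc l -> D (orb l).
  rewrite /udisc /= normcE ltcR => l1; apply: DX.
  rewrite [l * _]mulrC ReZ -mulrN1 ler_wpM2l//.
  by have := le_trans (abs_Re_le l) (ltW l1); rewrite ler_norml => /andP[].
have orb0 : orb 0 = w' by rewrite /orb mul0r X_0.
have orbx : orb x%:C = X s%:C w'.
  by rewrite /orb -rmorphM /= mulrC divfK ?gt_eqF.
have x_in : @udisc R x%:C by apply: udisc_real => //; exact: ltW.
have z_in : @udisc R 0 by rewrite /udisc /= normr0 ltr01.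
pose p (n : nat) := match n with 0%N => w | 1%N => w' | 2 => X s%:C w' | _ => X s%:C w end.
pose f (n : nat) := match n with
  0%N => line w w' | 1%N => orb | _ => line (X s%:C w') (X s%:C w) end.
apply: ereal_inf_lbound.
exists 3%N, p, (fun=> 0), (fun=> x%:C), f; split => //; split => //; split; last first.
  by rewrite sumr_const card_ord mulr_natl.
have D_line1 l : udisc l -> D (line w w' l).
  by move=> ul; apply/h1/lineD.
have D_line3 l : udisc l -> D (line (X s%:C w') (X s%:C w) l).
  move=> ul; apply: h2; rewrite -(subrK (X s%:C w') (line _ _ _)) -addrA [d2]splitr.
  apply: le_lt_trans (nrmD _ _) _; apply: ltrD; first by apply: lineD => //; rewrite nrm_distC.
  by apply: lt_le_trans n2 _; rewrite ler_piMl ?ltW// divr_gt0.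
by move=> [|[|[|//]]] _ /=; (split; [|split; [|split; [|split; [|split]]]]) => //;
  rewrite ?line0 ?linex ?orb0 ?orbx.
Qed.

Lemma not_kobayashi_hyperbolic (s : R) : 0 <= s -> D w -> D (X s%:C w) ->
  X s%:C w != w -> ~ kobayashi_hyperbolic D.
Proof.
move=> s0 Dw Ds sw hyp; have := hyp _ _ Dw Ds; rewrite eq_sym => /(_ sw) pos.
have chain x : 0 < x -> x <= 2^-1 -> (kobayashi D w (X s%:C w) <= (6 * x)%:E)%E.
  move=> x0 x2; have x01 : 0 < x < 1 by apply/andP; split => //; lra.
  apply: le_trans (kobayashi_chain s0 x01 Dw Ds) _.
  by rewrite lee_fin; have := poincare0_le x0 x2; lra.
case E : (kobayashi D w (X s%:C w)) pos chain => [k| |] //= k0 chain; last first.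
  by have := chain 2^-1 _ (lexx _); rewrite invr_gt0 ltr0n => /(_ isT).
rewrite lte_fin in k0.
(* The chain costs at most [6 x], now at most [k / 2]. *)
pose x := Num.min 2^-1 (k / 12).
have x0 : 0 < x by rewrite lt_min invr_gt0 ltr0n /= divr_gt0.
have := chain x x0; rewrite ge_min lexx lee_fin => /(_ isT).
have : x <= k / 12 by rewrite ge_min lexx orbT.
by lra.
Qed.

End AtEscapeLimit2.

(** * Bounded domains *)

Section PoincareDistance.
Variable R : realType.
Implicit Types a b : Cx R.

Lemma normc_conj (z : R[i]) : normc (z^*) = normc z.
Proof. by case: z => x y; rewrite /= sqrrN. Qed.

Lemma pseudo_hypE a b : pseudo_hyp a b = normc (a - b) / normc (1 - a^* * b).
Proof. by rewrite /pseudo_hyp !normcE -fmorphV -rmorphM. Qed.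

(** For [a] and [b] in the unit disc the right side is positive, whence a nonzero denominator and a
    quotient below 1 in [pseudo_hyp]. *)
Lemma disc_denominator a b : normc (1 - a^* * b) ^+ 2 - normc (a - b) ^+ 2 =
  (1 - normc a ^+ 2) * (1 - normc b ^+ 2).
Proof.
by rewrite !normc_sqr; case: a b => [x y] [x' y'] /=; ring.
Qed.

Lemma pseudo_hyp_bounds a b : normc a < 1 -> normc b < 1 ->
  0 < normc (1 - a^* * b) /\ 0 <= pseudo_hyp a b < 1.
Proof.
move=> a1 b1; have sq1 (z : R[i]) : normc z < 1 -> 0 < 1 - normc z ^+ 2.
  by move=> z1; rewrite subr_gt0 expr_lt1// normc_ge0.
have := disc_denominator a b; have := mulr_gt0 (sq1 _ a1) (sq1 _ b1) => + E.
rewrite -E subr_gt0 ltr_sqr ?nnegrE ?normc_ge0// => lt.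
have pos : 0 < normc (1 - a^* * b) by apply: le_lt_trans lt; exact: normc_ge0.
by rewrite pseudo_hypE divr_ge0 ?normc_ge0// ltr_pdivrMr// mul1r.
Qed.

(** With [p] the left side, [ln ((1 + p) / (1 - p)) = - ln (1 - 2 p / (1 + p)) >= 2 p / (1 + p)],
    and [1 + p <= 2]. *)
Lemma poincare_ge a b : normc a < 1 -> normc b < 1 -> pseudo_hyp a b <= 2 * poincare a b.
Proof.
move=> a1 b1; have [_ /andP[]] := pseudo_hyp_bounds a1 b1.
rewrite /poincare; move: (pseudo_hyp a b) => p p0 p1.
rewrite mulrA divff ?gt_eqF// mul1r.
have p1' : 0 < 1 + p by rewrite ltr_wpDr.
have p1'' : 0 < 1 - p by rewrite subr_gt0.
have -> : (1 + p) / (1 - p) = ((1 - p) / (1 + p))^-1 by rewrite invfM invrK mulrC.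
rewrite lnV ?posrE ?divr_gt0// lerNr.
have -> : (1 - p) / (1 + p) = 1 + (- (2 * p / (1 + p))) by field; rewrite gt_eqF.
apply: le_trans (le_ln1Dx _) _.
  by rewrite ltrN2 ltr_pdivrMr// mul1r; lra.
by rewrite lerN2 ler_pdivlMr// mulrDr mulr1 mulr_natl mulr2n lerD2l ler_piMr// ltW.
Qed.

(* Either [b] is close to [a] relative to the distance of [a] to the circle, and Cauchy's
   estimate applies, or the pseudo-hyperbolic distance is at least [1 / 5]. *)
Lemma disc_lipschitz (f : R[i] -> R[i]) (M : R) a b :
  (forall z, normc z < 1 -> (exists l, cderiv f z l) /\ normc (f z) <= M) ->
  normc a < 1 -> normc b < 1 -> normc (f a - f b) <= 96 * M * pseudo_hyp a b.
Proof.
move=> fd a1 b1; have [den /andP[p0 p1]] := pseudo_hyp_bounds a1 b1.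
have M0 : 0 <= M by apply: le_trans (fd a a1).2; exact: normc_ge0.
pose g := 1 - normc a; have g0 : 0 < g by rewrite subr_gt0.
(* The number is [1 - |a|^2], at most [2 g], plus the conjugate of [a] times [a - b]. *)
have den_le : normc (1 - a^* * b) <= 2 * g + normc (a - b).
  have -> : 1 - a^* * b = (1 - (normc a ^+ 2)%:C) + a^* * (a - b).
    have -> : (normc a ^+ 2)%:C = a^* * a.
      by rewrite normc_sqr; case: (a : R[i]) => x y; apply: eqC => /=; ring.
    by ring.
  apply: le_trans (normcD _ _) _; apply: lerD.
    rewrite -rmorphB normc_real ger0_norm; last first.
      by rewrite subr_ge0 expr_le1 ?normc_ge0// ltW.
    have -> : 1 - normc a ^+ 2 = (1 + normc a) * g by rewrite /g; ring.
    by rewrite ler_pM2r//; move: a1; move: (normc a) => y; lra.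
  by rewrite normcM normc_conj ler_piMl ?normc_ge0// ltW.
have pE : normc (a - b) = pseudo_hyp a b * normc (1 - a^* * b).
  by rewrite pseudo_hypE divfK// gt_eqF.
(* In the near case the denominator is at most [3 g]; with discs of radius [g / 2] this gives
   [96 = 16 * 2 * 3]. *)
have [near|far] := leP (normc (a - b)) (g / 2).
  have lip : normc (f a - f b) <= 16 * M / (g / 2) * normc (a - b).
    rewrite normc_distC [normc (a - b)]normc_distC.
    apply: cauchy_lipschitz => [|t z /andP[t0 t1] zt]; first by rewrite divr_gt0.
    apply: fd; have -> : z = (z - (a + t%:C * (b - a))) + (a + t%:C * (b - a)) by rewrite subrK.
    have n1 : normc (a + t%:C * (b - a)) <= normc a + g / 2.
      apply: le_trans (normcD _ _) _; rewrite lerD2l normcM normc_real ger0_norm// normc_distC.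
      by apply: le_trans near; rewrite ler_piMl ?normc_ge0.
    apply: le_lt_trans (normcD _ _) _.
    by move: zt n1; rewrite /g; move: (normc _) (normc _) (normc _) => x y u; lra.
  apply: le_trans lip _.
  have h : normc (a - b) <= pseudo_hyp a b * (3 * g).
    rewrite [X in X <= _]pE ler_wpM2l//; apply: le_trans den_le _.
    by move: near g0; move: (normc _) g => x y; lra.
  have -> : 96 * M * pseudo_hyp a b = 16 * M / (g / 2) * (pseudo_hyp a b * (3 * g)).
    by field; rewrite gt_eqF.
  by apply: ler_wpM2l => //; apply: divr_ge0; [exact: mulr_ge0|apply: ltW; rewrite divr_gt0].
have p5 : 1 <= 5 * pseudo_hyp a b.
  have d5 : normc (1 - a^* * b) <= 5 * normc (a - b).
    by apply: le_trans den_le _; move: far; move: (normc (a - b)) => x; lra.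
  by rewrite pseudo_hypE mulrA ler_pdivlMr// mul1r.
apply: (@le_trans _ _ (M + M)).
  by apply: le_trans (normcB _ _) _; apply: lerD; [exact: (fd a a1).2|exact: (fd b b1).2].
have : M * 1 <= M * (5 * pseudo_hyp a b) by rewrite ler_wpM2l.
have : 0 <= M * pseudo_hyp a b by rewrite mulr_ge0.
have -> : M * (5 * pseudo_hyp a b) = 5 * (M * pseudo_hyp a b) by ring.
have -> : 96 * M * pseudo_hyp a b = 96 * (M * pseudo_hyp a b) by ring.
by move: (M * pseudo_hyp a b) => y; lra.
Qed.

End PoincareDistance.

Section BoundedDomains.
Variables (R : realType) (d : nat) (D : set (Cn R d)).

Lemma bounded_biholo : is_domain D -> bounded_set D -> biholo_to_bounded_domain D.
Proof.
move=> dom bD; exists id, id, D; split => //.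
by split => //; rewrite image_id.
Qed.

(** Each disc moves the point by at most [C] times its Poincare length, so the triangle inequality
    bounds all chains below by [|z - w| / C]. The added 1 keeps [C] positive if [M = 0]. *)
Lemma bounded_kobayashi (M : R) : (forall z, D z -> nrm z <= M) -> kobayashi_hyperbolic D.
Proof.
move=> DM z w Dz Dw zw.
have M0 : 0 <= M := le_trans (nrm_ge0 _) (DM z Dz).
pose C := 96 * (M + 1) * 2; have C0 : 0 < C by rewrite !mulr_gt0// ltr_wpDl.
have zw0 : 0 < nrm (z - w) by rewrite lt_neqAle nrm_ge0 andbT eq_sym nrm_eq0 subr_eq0.
apply: (@lt_le_trans _ _ (nrm (z - w) / C)%:E); first by rewrite lte_fin divr_gt0.
apply: le_ereal_inf_tmp => _ [n [p [a [b [f [pz [pw [chain ->]]]]]]]].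
rewrite lee_fin ler_pdivrMr// mulrC mulr_sumr.
have step j : (j < n)%N -> nrm (p j - p j.+1) <= C * poincare (a j) (b j).
  move=> /chain[fh [fD [aj [bj [<- <-]]]]].
  have a1 : normc (a j) < 1 by move: aj; rewrite /udisc /= normcE ltcR.
  have b1 : normc (b j) < 1 by move: bj; rewrite /udisc /= normcE ltcR.
  have [_ /andP[p0 _]] := pseudo_hyp_bounds a1 b1.
  apply: (@le_trans _ _ (96 * (M + 1) * pseudo_hyp (a j) (b j))); last first.
    have -> : C * poincare (a j) (b j) = 96 * (M + 1) * (2 * poincare (a j) (b j)).
      by rewrite /C; ring.
    by apply: ler_wpM2l; [rewrite mulr_ge0// addr_ge0|exact: poincare_ge].
  apply: nrm_le_coord => [|i]; first by rewrite !mulr_ge0// addr_ge0.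
  rewrite !mxE; apply: (@disc_lipschitz R (fun l => f j l ord0 i)) => // l l1.
  have ul : @udisc R l by rewrite /udisc /= normcE ltcR.
  split.
    apply: (@differentiable_cderiv R (fun l => f j l ord0 i)).
    apply: (@differentiable_comp _ _ _ _ (f j) (fun w : Cn R d => w ord0 i : Cx R)); first exact: fh.
    exact: differentiable_coord.
  apply: le_trans (normc_coord_le _ _) _; apply: le_trans (DM _ (fD _ ul)) _.
  by rewrite lerDl.
rewrite -pz -pw; move: step => {chain pz pw}.
elim: n => [|n IH] step; first by rewrite subrr nrm0 big_ord0.
rewrite big_ord_recr /=.
have -> : p 0%N - p n.+1 = (p 0%N - p n) + (p n - p n.+1) by rewrite addrA subrK.
apply: le_trans (nrmD _ _) _; apply: lerD; last exact: step.
by apply: IH => j jn; apply: step; exact: ltnW.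
Qed.

(** The coordinate in which [z] and [w] differ most, scaled into the unit disc, separates them. *)
Lemma bounded_caratheodory (M : R) : (forall z, D z -> nrm z <= M) -> caratheodory_hyperbolic D.
Proof.
move=> DM z w Dz Dw zw.
have M0 : 0 <= M := le_trans (nrm_ge0 _) (DM z Dz).
have zw0 : 0 < nrm (z - w) by rewrite lt_neqAle nrm_ge0 andbT eq_sym nrm_eq0 subr_eq0.
have [j jE] := nrm_coord zw0.
have M1 : 0 < M + 1 by rewrite ltr_wpDl.
pose f (x : Cn R d) : Cx R := ((M + 1)^-1)%:C *: (x ord0 j : Cx R).
have nf x : normc (f x) = normc (x ord0 j) / (M + 1).
  by rewrite /f -[_ *: _]/(_ * _) normcM normc_real gtr0_norm ?invr_gt0// mulrC.
have f1 x : D x -> normc (f x) < 1.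
  move=> Dx; rewrite nf ltr_pdivrMr// mul1r; apply: le_lt_trans (normc_coord_le _ _) _.
  by apply: le_lt_trans (DM _ Dx) _; rewrite ltrDl.
have ff : holo_on f D /\ (forall x, D x -> udisc (f x)).
  split=> x Dx; last by rewrite /udisc /= normcE ltcR f1.
  apply: (@differentiableZ _ _ _ (fun x : Cn R d => x ord0 j : Cx R)).
  exact: differentiable_coord.
apply: (@lt_le_trans _ _ (poincare (f z) (f w))%:E); last first.
  by apply: ereal_sup_ubound; exists f.
have := poincare_ge (f1 _ Dz) (f1 _ Dw); have [den _] := pseudo_hyp_bounds (f1 _ Dz) (f1 _ Dw).
have : 0 < pseudo_hyp (f z) (f w).
  rewrite pseudo_hypE divr_gt0//.
  have -> : f z - f w = ((M + 1)^-1)%:C * ((z - w) ord0 j) by rewrite /f -!scalerBr !mxE.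
  by rewrite normcM mulr_gt0 -?jE// normc_real normr_gt0 gt_eqF// invr_gt0.
by rewrite lte_fin => p1 p2; have := lt_le_trans p1 p2; rewrite pmulr_rgt0.
Qed.

Lemma eucl2_psh : psh_on (@eucl2 R d) D.
Proof.
move=> a b l r r0 _.
have ch (z : R[i]) j : cderiv (fun m => (a + (m : Cx R) *: b) ord0 j) z (b ord0 j).
  apply: (@cderiv_ext _ (fun m => a ord0 j + b ord0 j * m)).
    by move=> m; rewrite !mxE mulrC.
  rewrite -[X in cderiv _ _ X]mulr1 -[b ord0 j * 1]add0r.
  by apply: cderivD; [exact: cderiv_cst|apply: cderivZ; exact: cderiv_id].
have := @eucl2_submean R d (fun m : Cx R => a + m *: b) (fun=> b) ch l r r0.
rewrite -lee_fin -cintE//.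
exact: (@curve_circ_continuous R d (fun m : Cx R => a + m *: b) (fun=> b) ch l r).1.
Qed.

Lemma bounded_core (M : R) : open D -> (forall z, D z -> nrm z <= M) -> core D = set0.
Proof.
move=> Do DM; rewrite -subset0 => z [Dz /(_ (@eucl2 R d))]; apply.
- by apply: continuous_subspaceT; exact: continuous_eucl2.
- exists (d%:R * M ^+ 2) => x Dx; apply: le_trans (eucl2_le_nrm2 _) _.
  have xM := DM _ Dx; rewrite ler_wpM2l// ler_sqr ?nnegrE ?nrm_ge0//.
  exact: le_trans (nrm_ge0 x) xM.
- exact: eucl2_psh.
(* With constant 1 the function to be tested is identically 0. *)
- exists D, 1; split => // a b l r r0 _.
  rewrite [X in (_ <= X)%E](_ : _ = (cint (fun _ : R => 0 : R))%:E).
    by rewrite cint_cst mulr0 lee_fin mul1r subrr mulr0.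
  rewrite -cintE; last by move=> t; exact: cvg_cst.
  by apply: eq_integral => t _; rewrite mul1r subrr.
Qed.

End BoundedDomains.

(** * Consequences of two points not separated by bounded holomorphic functions *)

Section UnboundedDomains.
Variables (R : realType) (d : nat) (D : set (Cn R d)).

Lemma not_caratheodory_hyperbolic (z w : Cn R d) : D z -> D w -> z != w ->
  (forall f : Cn R d -> Cx R, holo_on f D -> (forall x, D x -> normc (f x) <= 1) -> f z = f w) ->
  ~ caratheodory_hyperbolic D.
Proof.
move=> Dz Dw zw fE hyp; have := hyp z w Dz Dw zw; apply/negP; rewrite -leNgt.
apply: ge_ereal_sup => _ [f [fh fD] <-].
have -> : f z = f w.
  by apply: fE => // x /fD; rewrite /udisc /= normcE ltcR => /ltW.
rewrite lee_fin /poincare /pseudo_hyp subrr normr0 mul0r /= addr0 subr0 divr1 ln1 mulr0.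
by [].
Qed.

(** The coordinates of a map onto a bounded set are bounded holomorphic functions, so the map would
    not be injective. *)
Lemma not_biholo (z w : Cn R d) : D z -> D w -> z != w ->
  (forall (f : Cn R d -> Cx R) M, holo_on f D -> (forall x, D x -> normc (f x) <= M) -> f z = f w) ->
  ~ biholo_to_bounded_domain D.
Proof.
move=> Dz Dw zw fE [f [g [G [_ /bounded_nrmP[M GM] fh _ [fDG gf _]]]]].
suff fzw : f z = f w by move: zw; rewrite -(gf _ Dz) fzw gf// eqxx.
apply/matrixP => i j; rewrite ord1.
apply: (fE (fun x => f x ord0 j) M).
  move=> x Dx; apply: (@differentiable_comp _ _ _ _ f (fun w : Cn R d => w ord0 j : Cx R)).
    exact: fh.
  exact: differentiable_coord.
move=> x Dx; apply: le_trans (normc_coord_le _ _) _; apply: GM.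
by rewrite -fDG; exists x.
Qed.

End UnboundedDomains.

Unset Implicit Arguments.

Theorem theorem1p1 (R : realType) (d : nat)
  (V : Cn R d -> Cn R d) (X : Cx R -> Cn R d -> Cn R d) (D : set (Cn R d)) :
  (* V is a holomorphic vector field on C^d with V(0) = 0 *)
  (forall z, differentiable V z) -> V 0 = 0 ->
  (* V is complete, X its complex-time flow *)
  (forall z, X 0 z = z) ->
  (forall (l : Cx R) z, is_derive l (1 : Cx R) (fun m => X m z) (V (X l z))) ->
  (* 0 is globally asymptotically stable *)
  (forall eps : R, 0 < eps -> exists2 delta : R, 0 < delta &
     forall (t : R) z, 0 <= t -> `|z| < delta%:C -> `|X t%:C z| < eps%:C) ->
  (forall z, X t%:C z @[t --> +oo] --> (0 : Cn R d)) ->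
  (* D is a domain containing 0, spirallike and circularlike wrt V *)
  is_domain D -> D 0 ->
  (forall (t : R) z, 0 <= t -> D z -> D (X t%:C z)) ->
  (forall (s : R) z, - (pi / 2) < s < pi / 2 -> D z -> D (X (0 +i* s) z)) ->
  [/\ bounded_set D <-> biholo_to_bounded_domain D,
      bounded_set D <-> kobayashi_hyperbolic D,
      bounded_set D <-> core D = set0
    & bounded_set D <-> caratheodory_hyperbolic D].
Proof.
move=> V_holo _ X_0 X_ode _ X_attr Ddom D0 D_spiral D_circ.
have D_open : open D by case: Ddom.
have unb : ~ bounded_set D -> exists w (s : R),
    [/\ D w, 0 <= s, D (X s%:C w), X s%:C w != w
      & forall T dl : R, 0 <= T -> 0 < dl ->
          (exists2 w', nrm (w' - w) < dl & forall l, - T <= complex.Re l -> D (X l w'))].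
  move=> nb; have [|w [w0 Dw ap]] := escape_limit V_holo X_0 X_ode X_attr D_open D0 D_spiral D_circ.
    move=> M; apply: contrapT => H; apply: nb; apply/bounded_nrmP; exists M => z Dz.
    by rewrite leNgt; apply/negP => Mz; apply: H; exists z.
  (* At this time the orbit is closer to 0 than [w]: thus [X s w] differs from [w], and it lies in
     [D] with the ball of radius [|w|]. *)
  have [s s0 sw] := flow_attracted X_attr w w0.
  exists w, s; split => //; [exact: Dw|exact: ltW|by apply: Dw; exact: ltW|].
  by apply/eqP => E; move: sw; rewrite E ltxx.
split; split.
- exact: bounded_biholo.
- move=> bih; apply: contrapT => /unb[w [s [Dw s0 Ds sw ap]]].
  apply: (not_biholo Ds Dw sw _ bih) => f M fh fM.
  exact: (orbit_liouville V_holo X_0 X_ode ap fh fM s0 Dw Ds).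
- by move=> /bounded_nrmP[M]; exact: bounded_kobayashi.
- move=> hyp; apply: contrapT => /unb[w [s [Dw s0 Ds sw ap]]].
  exact: (not_kobayashi_hyperbolic V_holo X_0 X_ode D_open ap s0 Dw Ds sw hyp).
- by move=> /bounded_nrmP[M]; exact: bounded_core.
- move=> core0; apply: contrapT => /unb[w [s [Dw s0 Ds sw ap]]].
  suff : core D w by rewrite core0.
  split => // u uc [M uM] upsh.
  apply: (not_strictly_psh V_holo X_0 X_ode D_open ap _ Dw upsh _ uM).
    by apply: contra sw => /eqP Vw; apply/eqP; exact: (equilibrium_fixed V_holo X_0 X_ode).
  move=> z Dz; move: uc; rewrite (continuous_open_subspace _ D_open); apply.
  exact/mem_set.
- by move=> /bounded_nrmP[M]; exact: bounded_caratheodory.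
- move=> hyp; apply: contrapT => /unb[w [s [Dw s0 Ds sw ap]]].
  apply: (not_caratheodory_hyperbolic Ds Dw sw _ hyp) => f fh fM.
  exact: (orbit_liouville V_holo X_0 X_ode ap fh fM s0 Dw Ds).
Qed.
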